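(* The functions $EG^{\pm}$ are plurisubharmonic and locally H\''older continuous on $\mathbb{C}^2$. Moreover, $EG^{\pm}$ are strictly positive pluriharmonic functions outside $\overline{\bigcup_{\Lambda\in X}K_\Lambda^{\pm}}$ and vanish precisely on $\bigcap_{\Lambda\in X}K_\Lambda^{\pm}$.
   Context: $M$ is a compact set in $\mathbb{C}^k$, $\nu$ is the normalized Lebesgue measure on $M$, $X=\prod_{i=1}^\infty M$ with the product topology, and $\bar\nu=\nu\times\nu\times\cdots$ is the product probability measure on $X$. Fix $m\ge1$ and integers $d_1,\dots,d_m\ge2$, and put $d=d_1\cdots d_m$. For $\lambda\in M$ and $1\le j\le m$ let $H_\lambda^{(j)}(x,y)=(y,\,p_{j,\lambda}(y)-a_j(\lambda)x)$ on $\mathbb{C}^2$, where $p_{j,\lambda}$ is a monic polynomial of degree $d_j$ whose coefficients are continuous functions of $\lambda\in M$ and $a_j$ is a continuous nowhere vanishing function on $M$; let $H_\lambda=H_\lambda^{(m)}\circ\cdots\circ H_\lambda^{(1)}$. For $\Lambda=(\lambda_1,\lambda_2,\dots)\in X$ and $n\ge1$ let $H_{n,\Lambda}^{\pm}=H_{\lambda_n}^{\pm1}\circ\cdots\circ H_{\lambda_1}^{\pm1}$, $K_\Lambda^{\pm}=\{z\in\mathbb{C}^2:\ (H_{n,\Lambda}^{\pm}(z))_{n}\text{ is bounded}\}$, and $G_\Lambda^{\pm}=\lim_{n\to\infty}d^{-n}\log^+\|H_{n,\Lambda}^{\pm}\|$ (the limit exists uniformly on compact subsets of $\mathbb{C}^2$,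 and $\Lambda\mapsto G_\Lambda^\pm$ is continuous). The average Green functions are $$EG^{\pm}(z)=\int_XG_\Lambda^{\pm}(z)\,d\bar\nu(\Lambda),\qquad z\in\mathbb{C}^2 .$$
   Formalization: M is taken of positive Lebesgue measure, and that EG^± vanish only on the intersection of the K_Λ^± is claimed only when every nonempty relatively open subset of M has positive Lebesgue measure; it fails e.g. for p_λ(y)=y²+λ, small a and M a small disc plus the point 100. *)

(* Defs.v *)
From HB Require Import structures.
From mathcomp Require Import all_boot all_order all_algebra.
From mathcomp Require Import complex.
From mathcomp Require Import all_classical all_reals all_analysis.

Set Implicit Arguments.
Unset Strict Implicit.
Unset Printing Implicit Defensive.

Import Order.TTheory GRing.Theory Num.Theory.
Import numFieldNormedType.Exports.

Local Open Scope classical_set_scope.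
Local Open Scope ring_scope.

(* [R[i]] only receives its topology from MathComp-Analysis when seen as an
   abstract numeric field, whence this alias. *)
Definition Cplx (R : realType) : numClosedFieldType := R[i].

Definition toC {R : realType} (x : R) : Cplx R := (x +i* 0)%C.
Definition imag_unit {R : realType} : Cplx R := (0 +i* 1)%C.
Definition expi {R : realType} (t : R) : Cplx R := (cos t +i* sin t)%C.

(* The library norm on a product is the sup norm, with values in [Cplx R]. *)
Definition norm2 {R : realType} (z : Cplx R * Cplx R) : R :=
  Num.sqrt (complex.Re z.1 ^+ 2 + complex.Im z.1 ^+ 2
            + complex.Re z.2 ^+ 2 + complex.Im z.2 ^+ 2).

Section FunctionClasses.
Context {R : realType}.

Definition upper_semicontinuous {E : topologicalType} (u : E -> \bar R) :=
  lower_semicontinuous (fun z => (- u z)%E).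

Definition circle_mean (u : Cplx R -> \bar R) (c : Cplx R) (r : R) : \bar R :=
  (((2 * pi)^-1)%:E *
    \int[lebesgue_measure]_(t in `[0%R, (2 * pi)%R]) u (c + toC r * expi t)%R)%E.

(* Values in [-oo, +oo[; the function identically -oo is allowed. *)
Definition subharmonic (u : Cplx R -> \bar R) : Prop :=
  [/\ forall z, (u z < +oo)%E,
      upper_semicontinuous u &
      forall (c : Cplx R) (r : R), 0 < r -> (u c <= circle_mean u c r)%E].

Definition plurisubharmonic {E : normedModType (Cplx R)} (u : E -> \bar R) :
    Prop :=
  [/\ forall z, (u z < +oo)%E,
      upper_semicontinuous u &
      forall a b : E, subharmonic (fun zeta : Cplx R => u (a + zeta *: b))].

(* Real directional derivative along [v]. *)
Definition dird {E : normedModType (Cplx R)} (v : E) (u : E -> R) (z : E) : R :=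
  derive1 (fun t : R => u (z + toC t *: v)) 0.

(* C^n on [Omega], for the underlying real structure. *)
Fixpoint Ck {E : normedModType (Cplx R)} (n : nat) (Omega : set E)
    (u : E -> R) : Prop :=
  (forall z, Omega z -> {for z, continuous u}) /\
  (if n is n'.+1 then
     forall v : E,
       (forall z, Omega z ->
          derivable (fun t : R => u (z + toC t *: v)) 0 1) /\
       Ck n' Omega (dird v u)
   else True).

Definition harmonic (Omega : set (Cplx R)) (u : Cplx R -> R) : Prop :=
  Ck 2 Omega u /\
  forall z, Omega z ->
    dird (1 : Cplx R) (dird (1 : Cplx R) u) z
    + dird (imag_unit : Cplx R) (dird (imag_unit : Cplx R) u) z = 0.

Definition pluriharmonic {E : normedModType (Cplx R)} (Omega : set E)
    (u : E -> R) : Prop :=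
  Ck 2 Omega u /\
  forall a b : E,
    harmonic [set zeta : Cplx R | Omega (a + zeta *: b)]
             (fun zeta : Cplx R => u (a + zeta *: b)).

Definition locally_holder (u : Cplx R * Cplx R -> R) : Prop :=
  forall z0 : Cplx R * Cplx R,
  exists alpha c : R, 0 < alpha <= 1 /\
    exists2 U : set (Cplx R * Cplx R), nbhs z0 U &
      forall z w, U z -> U w -> `|u z - u w| <= c * norm2 (z - w) `^ alpha.

End FunctionClasses.

Section LebesgueAndProduct.
Context {R : realType} {k : nat}.
Local Notation V := 'rV[Cplx R]_k.

(* Closed box of C^k = R^(2k) with opposite corners [ab.1] and [ab.2]. *)
Definition box (ab : V * V) : set V :=
  [set z | forall j,
     (complex.Re (ab.1 0%R j) <= complex.Re (z 0%R j)
        <= complex.Re (ab.2 0%R j)) &&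
     (complex.Im (ab.1 0%R j) <= complex.Im (z 0%R j)
        <= complex.Im (ab.2 0%R j))].

Definition box_volume (ab : V * V) : R :=
  \prod_(j < k)
    (Num.max 0 (complex.Re (ab.2 0%R j) - complex.Re (ab.1 0%R j)) *
     Num.max 0 (complex.Im (ab.2 0%R j) - complex.Im (ab.1 0%R j))).

(* Lebesgue (outer) measure on C^k, for k > 0. *)
Definition lebesgueC (A : set V) : \bar R :=
  ereal_inf [set (\sum_(n <oo) (box_volume (B n))%:E)%E
            | B in [set B : nat -> V * V | A `<=` \bigcup_n box (B n)]].

Definition normalized_lebesgue (M A : set V) : R :=
  fine (lebesgueC (A `&` M)) / fine (lebesgueC M).

Definition borelC : set (set V) := <<s [set U : set V | open U] >>.

Definition cylinders : set (set (nat -> V)) :=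
  [set S | exists (i : nat) (A : set V), borelC A /\ S = [set L | A (L i)]].

(* The sequences in C^k, with the product of the Borel sigma-algebras. *)
Definition seqC := g_sigma_algebraType cylinders.

(* The product space X = M x M x ..., as a subset of [seqC]. *)
Definition prodM (M : set V) : set seqC :=
  [set L : nat -> V | forall i, M (L i)].

(* By the pi-lambda theorem at most one [P] satisfies this; such a [P] is
   carried by [prodM M]. *)
Definition is_product_measure (nu : set V -> R) (P : probability seqC R) :
    Prop :=
  forall (n : nat) (A : nat -> set V), (forall i, borelC (A i)) ->
    P [set L : nat -> V | forall i, (i < n)%N -> A i (L i)]
      = (\prod_(i < n) nu (A i))%:E.

End LebesgueAndProduct.

Section Henon.
Context {R : realType}.
Local Notation C := (Cplx R).

Definition henon1 (p : {poly C}) (a : C) (z : C * C) : C * C :=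
  (z.2, p.[z.2] - a * z.1).

Definition henon1_inv (p : {poly C}) (a : C) (z : C * C) : C * C :=
  ((p.[z.1] - z.2) / a, z.1).

Lemma henon1K p a : a != 0 -> cancel (henon1 p a) (henon1_inv p a).
Proof.
by move=> a0 [x y]; rewrite /henon1 /henon1_inv /= subKr mulrAC mulfV// mul1r.
Qed.

Lemma henon1_invK p a : a != 0 -> cancel (henon1_inv p a) (henon1 p a).
Proof.
by move=> a0 [x y]; rewrite /henon1 /henon1_inv /= mulrC divfK// subKr.
Qed.

Context {k m : nat}.
Variables (p : 'I_m -> 'rV[C]_k -> {poly C}) (a : 'I_m -> 'rV[C]_k -> C).

(* The factor of index 0 is applied first. *)
Definition henon (l : 'rV[C]_k) (z : C * C) : C * C :=
  foldl (fun w j => henon1 (p j l) (a j l) w) z (enum 'I_m).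

Definition henon_inv (l : 'rV[C]_k) (z : C * C) : C * C :=
  foldr (fun j w => henon1_inv (p j l) (a j l) w) z (enum 'I_m).

Lemma henonK l : (forall j, a j l != 0) -> cancel (henon l) (henon_inv l).
Proof.
move=> a0 z; rewrite /henon /henon_inv.
elim: (enum 'I_m) z => [//|j s IH] z /=.
by rewrite IH henon1K.
Qed.

Lemma henon_invK l : (forall j, a j l != 0) -> cancel (henon_inv l) (henon l).
Proof.
move=> a0 z; rewrite /henon /henon_inv.
by elim: (enum 'I_m) => [//|j s IH] /=; rewrite henon1_invK.
Qed.

(* The sign [s] is [true] for + and [false] for -. *)
Definition henon_sign (s : bool) : 'rV[C]_k -> C * C -> C * C :=
  if s then henon else henon_inv.

(* [L] is indexed from 0: the parameter lambda_(i+1) is [L i]. *)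
Fixpoint henon_seq (s : bool) (L : nat -> 'rV[C]_k) (n : nat) (z : C * C) :
    C * C :=
  if n is n'.+1 then henon_sign s (L n') (henon_seq s L n' z) else z.

Definition Kset (s : bool) (L : nat -> 'rV[C]_k) : set (C * C) :=
  [set z | exists B : R, forall n, norm2 (henon_seq s L n z) <= B].

Definition logp (x : R) : R := Num.max 0 (ln x).

Definition green (d : nat) (s : bool) (L : nat -> 'rV[C]_k) (z : C * C) : R :=
  lim ((fun n => logp (norm2 (henon_seq s L n z)) / (d ^ n)%:R) @ \oo).

Definition average_green (M : set 'rV[C]_k) (P : probability seqC R) (d : nat)
    (s : bool) (z : C * C) : R :=
  \int[P]_(L in prodM M) green d s L z.

End Henon.

(* Main.v *)
Require Import Defs.
From HB Require Import structures.
From mathcomp Require Import all_boot all_order all_algebra.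
From mathcomp Require Import complex.
From mathcomp Require Import all_classical all_reals all_analysis.
From mathcomp Require Import measurable_realfun.
From mathcomp Require Import ring lra.

(** Everything asserted of the average Green function EG comes from bounds that
hold for the Green functions G_L of all sequences L at once and that are
inequalities |Phi u| <= c, where Phi is a finite linear combination of point
evaluations.  Such an inequality passes from the approximations of G_L to G_L
by taking limits, and from the functions G_L to EG by integrating over L
([lincomb_average], [mean_green_dominated]).  In this way no derivative and no
circle mean is ever exchanged with the integral over the sequences.

Dynamics.  A generalized Henon map, like its inverse, applies a polynomial of
degree D to one dominant coordinate z' and subtracts a multiple of the other
coordinate z''.  With T(z) = max(Rad, |z'|, |z''|) and Rad large, the region
|z'| > Rad, |z'| > |z''| is invariant, T(F z) is comparable to T(z)^D there, and
T does not increase on orbits that stay outside.  These bounds are stable under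
composition ([tame_comp]), with constants uniform over the compact parameter
set.  Hence D^-n ln T(orbit_n) converges geometrically, uniformly in L, to the
Green function; the limit is bounded below by an explicit positive constant if
the orbit has entered the region by time n ([rgreen_esc]), it is 0 if the orbit
never enters it ([rgreen_nesc]), and the latter means that the orbit is bounded
([bounded_orb_nesc]).

Regularity.  Relative errors are multiplied by at most K at each step, so two
points at distance delta share the first N values of ln T up to ln 2 as long as
K^N delta <= 1; the geometric convergence turns this into a Holder estimate with
exponent ln 2 / ln K, uniform in L ([rgreen_holder]).

Plurisubharmonicity.  On a complex line the approximations are maxima of
constants and of D^-n ln|f| with f a polynomial.  As
prod_j (x - w_j) = x^N - 1 over the N-th roots of unity w_j, the mean of ln|f|
over N equidistributed points of a circle without zeros of f is, up to a
constant divided by N, at least ln|f| at the center ([discrete_jensen]).  The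
inequality passes to EG in its discrete form, and the discrete means of the
continuous function EG tend to its circle mean ([mean_green_submean]).

Pluriharmonicity and positivity.  If the orbits of z under all sequences enter
the invariant region, then by compactness of the space of sequences some N works
for all sequences and all points near z ([uniform_escape]).  There the
approximations with n >= N are, on complex lines, D^-n ln|f| with f zero-free of
degree at most D^n, so that their second-order Taylor expansions have bounds
independent of n and L ([ln_poly_taylor]).  Written as inequalities between
difference quotients ([taylor_ineqs]) these bounds pass to EG, and they force EG
to be C^2 with vanishing Laplacian on complex lines ([taylor_pluriharmonic]).

Zeros.  If the orbit of z under a sequence L0 enters the invariant region at
time n, then so does the orbit under any L whose first n entries are close to
those of L0.  When every nonempty relatively open subset of M has positive
measure, such L form a set of positive probability, on which G_L(z) is bounded
below by a positive constant ([mean_green_gt0]). *)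

Set Implicit Arguments.
Unset Strict Implicit.
Unset Printing Implicit Defensive.

Import Order.TTheory GRing.Theory Num.Theory.
Import numFieldNormedType.Exports.
Local Open Scope classical_set_scope.
Local Open Scope ring_scope.

(** * Modulus and sup norm *)

Section Modulus.
Context {R : realType}.
Local Notation C := (Cplx R).
Implicit Types (z w : C) (x : R).

(** The modulus as a real number: the library norm of a complex number is itself
complex. *)
Definition cabs (z : C) : R := complex.Re `|z|.

Lemma normC_cabs z : `|z| = toC (cabs z).
Proof. by rewrite /cabs [`|z|]normc_def. Qed.

Lemma cabsE z : cabs z = Num.sqrt (complex.Re z ^+ 2 + complex.Im z ^+ 2).
Proof. by rewrite /cabs [`|z|]normc_def. Qed.

Lemma toCD (x y : R) : toC (x + y) = toC x + toC y.
Proof. exact: (rmorphD (real_complex R)). Qed.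
Lemma toCM (x y : R) : toC (x * y) = toC x * toC y.
Proof. exact: (rmorphM (real_complex R)). Qed.
Lemma toCN (x : R) : toC (- x) = - toC x.
Proof. exact: (rmorphN (real_complex R)). Qed.
Lemma toC0 : toC 0 = 0 :> C. Proof. by []. Qed.
Lemma toC_inj : injective (@toC R). Proof. by move=> x y []. Qed.
Lemma ler_toC (x y : R) : (toC x <= toC y) = (x <= y).
Proof. exact: lecR. Qed.
Lemma ltr_toC (x y : R) : (toC x < toC y) = (x < y).
Proof. exact: ltcR. Qed.

Lemma cabs_ge0 z : 0 <= cabs z.
Proof. by rewrite cabsE sqrtr_ge0. Qed.

Lemma sqr_cabs z : cabs z ^+ 2 = complex.Re z ^+ 2 + complex.Im z ^+ 2.
Proof. by rewrite cabsE sqr_sqrtr// addr_ge0 ?sqr_ge0. Qed.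

Lemma cabsM z w : cabs (z * w) = cabs z * cabs w.
Proof. by apply: toC_inj; rewrite toCM -!normC_cabs normrM. Qed.

Lemma cabsD z w : cabs (z + w) <= cabs z + cabs w.
Proof. by rewrite -ler_toC toCD -!normC_cabs ler_normD. Qed.

Lemma cabsN z : cabs (- z) = cabs z.
Proof. by rewrite /cabs normrN. Qed.

Lemma cabsC z w : cabs (z - w) = cabs (w - z).
Proof. by rewrite /cabs distrC. Qed.

Lemma cabsB z w : cabs (z - w) <= cabs z + cabs w.
Proof. by rewrite (le_trans (cabsD _ _))// cabsN. Qed.

Lemma cabs0 : cabs 0 = 0. Proof. by rewrite /cabs normr0. Qed.
Lemma cabs1 : cabs 1 = 1. Proof. by rewrite /cabs normr1. Qed.

Lemma cabs_eq0 z : (cabs z == 0) = (z == 0).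
Proof.
by rewrite -(inj_eq toC_inj) -normC_cabs toC0 normr_eq0.
Qed.

Lemma cabs_gt0 z : (0 < cabs z) = (z != 0).
Proof. by rewrite lt0r cabs_eq0 cabs_ge0 andbT. Qed.

Lemma cabsX z n : cabs (z ^+ n) = cabs z ^+ n.
Proof.
by elim: n => [|n IH]; rewrite ?expr0 ?cabs1// !exprS cabsM IH.
Qed.

Lemma cabsV z : cabs z^-1 = (cabs z)^-1.
Proof.
have [->|z0] := eqVneq z 0; first by rewrite invr0 cabs0 invr0.
have cz : cabs z != 0 by rewrite cabs_eq0.
apply: (mulfI cz); rewrite -cabsM !mulfV// cabs1//.
Qed.

Lemma cabs_prod (I : Type) (r : seq I) (F : I -> C) :
  cabs (\prod_(i <- r) F i) = \prod_(i <- r) cabs (F i).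
Proof.
elim: r => [|i r IH]; first by rewrite !big_nil cabs1.
by rewrite !big_cons cabsM IH.
Qed.

Lemma cabs_sum (I : Type) (r : seq I) (F : I -> C) :
  cabs (\sum_(i <- r) F i) <= \sum_(i <- r) cabs (F i).
Proof.
elim: r => [|i r IH]; first by rewrite !big_nil cabs0.
by rewrite !big_cons (le_trans (cabsD _ _))// lerD2l.
Qed.

Lemma cabs_toC x : cabs (toC x) = `|x|.
Proof. by rewrite cabsE /= expr0n addr0 sqrtr_sqr. Qed.

Lemma cabs_expi x : cabs (expi x) = 1.
Proof. by rewrite cabsE /= cos2Dsin2 sqrtr1. Qed.

Lemma cabs_Re z : `|complex.Re z| <= cabs z.
Proof.
by rewrite cabsE -sqrtr_sqr ler_wsqrtr// lerDl sqr_ge0.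
Qed.
Lemma cabs_Im z : `|complex.Im z| <= cabs z.
Proof.
by rewrite cabsE -sqrtr_sqr ler_wsqrtr// lerDr sqr_ge0.
Qed.
Lemma ReN z : complex.Re (- z) = - complex.Re z. Proof. by case: z. Qed.

Lemma cabs_le_ReIm z : cabs z <= `|complex.Re z| + `|complex.Im z|.
Proof.
have h : 0 <= `|complex.Re z| + `|complex.Im z| by rewrite addr_ge0.
rewrite -(ler_pXn2r (n:=2))// ?nnegrE ?cabs_ge0// sqr_cabs.
rewrite sqrrD !real_normK ?num_real// lerD2r lerDl mulrn_wge0// mulr_ge0//.
Qed.

Lemma dist_cabs z w : `|cabs z - cabs w| <= cabs (z - w).
Proof.
rewrite ler_norml; apply/andP; split.
  by rewrite lerNl opprB lerBlDr cabsC (le_trans _ (cabsD _ _))// subrK.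
by rewrite lerBlDr (le_trans _ (cabsD _ _))// subrK.
Qed.

(** Neighbourhoods are defined through complex radii; those reduce to real radii
because a positive complex number is real. *)
Lemma nbhsC_ballP z (P : set C) :
  nbhs z P <-> exists2 e : R, 0 < e & forall w, cabs (w - z) < e -> P w.
Proof.
split.
  move=> /nbhs_ballP[e /= e0 H].
  have er : e = toC (complex.Re e).
    by move: e0 {H}; case: e => a b; rewrite ltcE /= => /andP[/eqP -> _].
  exists (complex.Re e); first by rewrite -ltr_toC -er.
  by move=> w hw; apply: H; rewrite /ball /= er distrC normC_cabs ltr_toC.
move=> [e e0 H]; apply/nbhs_ballP; exists (toC e); first by rewrite /= ltr_toC.
by move=> w; rewrite /ball /= distrC normC_cabs ltr_toC; exact: H.
Qed.

Lemma cvgC_P {T : Type} (F : set_system T) (FF : Filter F) (f : T -> C) l :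
  f @ F --> l <-> forall e : R, 0 < e -> \forall t \near F, cabs (f t - l) < e.
Proof.
split=> [h e e0|h A /nbhsC_ballP[e e0 H]].
  by apply: (h [set w | cabs (w - l) < e]); apply/nbhsC_ballP; exists e.
by apply: filterS (h e e0) => t; apply: H.
Qed.

Lemma cvgC_sum {T : Type} {F : set_system T} {FF : Filter F} n (f : nat -> T -> C)
    (l : nat -> C) : (forall i, f i @ F --> l i) ->
  (\sum_(i < n) f i t) @[t --> F] --> \sum_(i < n) l i.
Proof.
move=> fl; elim: n => [|n IH].
  rewrite big_ord0 (_ : (fun t => _) = (fun=> 0)); first exact: cvg_cst.
  by apply/funext => t; rewrite big_ord0.
rewrite big_ord_recr /= (_ : (fun t => _) = (fun t => \sum_(i < n) f i t + f n t)).
  exact: (cvgD IH (fl n)).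
by apply/funext => t; rewrite big_ord_recr.
Qed.

End Modulus.

Section SupNorm.
Context {R : realType}.
Local Notation C := (Cplx R).
Implicit Types z w h : C * C.

(** The sup norm of C^2 with real values, multiplicative under scalars and hence
simpler than [norm2], to which it is equivalent. *)
Definition supn z : R := Num.max (cabs z.1) (cabs z.2).

Lemma nbhsC2_ballP z (P : set (C * C)) :
  nbhs z P <-> exists2 e : R, 0 < e & forall w : C * C, supn (w - z) < e -> P w.
Proof.
split.
  move=> [[A B] /= [/nbhsC_ballP[e1 e10 H1] /nbhsC_ballP[e2 e20 H2]] H].
  exists (Num.min e1 e2); first by rewrite lt_min e10.
  move=> w; rewrite /supn gt_max !lt_min => /andP[/andP[? ?] /andP[? ?]].
  by apply: H; split => /=; [apply: H1|apply: H2].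
move=> [e e0 H].
exists ([set w | cabs (w - z.1) < e], [set w | cabs (w - z.2) < e]).
  by split; apply/nbhsC_ballP; exists e.
by move=> w [/= h1 h2]; apply: H; rewrite /supn gt_max; apply/andP.
Qed.

Lemma supn_ge0 z : 0 <= supn z.
Proof. by rewrite le_max cabs_ge0. Qed.

Lemma supnD z w : supn (z + w) <= supn z + supn w.
Proof.
rewrite /supn ge_max; apply/andP; split; apply: le_trans (cabsD _ _) _;
  by apply: lerD; rewrite le_max lexx ?orbT.
Qed.

Lemma supnC z w : supn (z - w) = supn (w - z).
Proof. by rewrite /supn /= cabsC [cabs (z.2 - _)]cabsC. Qed.

Lemma supnZ (x : C) h : supn (x *: h) = cabs x * supn h.
Proof.
rewrite /supn /= !cabsM.
by rewrite maxr_pMr ?cabs_ge0.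
Qed.

Lemma supn_eq0 z : supn z = 0 -> z = 0.
Proof.
case: z => x y h.
have : supn (x, y) <= 0 by rewrite h.
rewrite ge_max => /andP[/= h1 h2].
have /eqP : cabs x == 0 by rewrite eq_le h1 cabs_ge0.
have /eqP : cabs y == 0 by rewrite eq_le h2 cabs_ge0.
by move=> /eqP; rewrite cabs_eq0 => /eqP -> /eqP; rewrite cabs_eq0 => /eqP ->.
Qed.

Lemma supn_norm2 z : supn z <= norm2 z.
Proof.
have e : norm2 z = Num.sqrt (cabs z.1 ^+ 2 + cabs z.2 ^+ 2).
  by rewrite /norm2 !sqr_cabs addrA.
rewrite e /supn ge_max -[X in X <= _]ger0_norm ?cabs_ge0// -[X in _ && (X <= _)]ger0_norm ?cabs_ge0//.
by rewrite -!sqrtr_sqr !ler_wsqrtr// ?lerDl ?lerDr sqr_ge0.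
Qed.

Lemma norm2_supn z : norm2 z <= 2 * supn z.
Proof.
have e : norm2 z = Num.sqrt (cabs z.1 ^+ 2 + cabs z.2 ^+ 2).
  by rewrite /norm2 !sqr_cabs addrA.
have h0 := supn_ge0 z.
rewrite e -[leRHS]ger0_norm ?mulr_ge0// -sqrtr_sqr ler_wsqrtr//.
have h1 : cabs z.1 ^+ 2 <= supn z ^+ 2.
  by rewrite lerXn2r ?nnegrE ?cabs_ge0// le_max lexx.
have h2 : cabs z.2 ^+ 2 <= supn z ^+ 2.
  by rewrite lerXn2r ?nnegrE ?cabs_ge0// le_max lexx orbT.
by rewrite exprMn; move: h1 h2 (sqr_ge0 (supn z)); lra.
Qed.

End SupNorm.

(** * Discrete Jensen inequality *)

Section DiscreteJensen.
Context {R : realType}.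
Local Notation C := (Cplx R).

Lemma expiD (x y : R) : expi (x + y) = expi x * expi y.
Proof. by rewrite /expi cosD sinD; apply/eqP; rewrite eq_complex /= addrC [X in _ && (_ == X)]addrC !eqxx. Qed.

Lemma expi0 : expi 0 = 1 :> C.
Proof. by rewrite /expi cos0 sin0. Qed.

Lemma expi_natmul (x : R) n : expi (n%:R * x) = expi x ^+ n.
Proof.
elim: n => [|n IH]; first by rewrite mul0r expi0 expr0.
by rewrite -addn1 natrD mulrDl mul1r expiD IH exprD expr1.
Qed.

(** If expi (2 pi / N) had a smaller order m, then 1 - cos (2y) = 2 sin(y)^2 would
vanish at y = m pi / N, which lies strictly between 0 and pi. *)
Lemma expi_root_prim (N : nat) : (0 < N)%N ->
  N.-primitive_root (expi (2 * pi / N%:R) : C).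
Proof.
move=> N0; have NR : 0 < N%:R :> R by rewrite ltr0n.
have h1 : (expi (2 * pi / N%:R) : C) ^+ N = 1.
  rewrite -expi_natmul mulrC divfK ?gt_eqF//.
  by rewrite /expi mulrC mulr_natr cos2pi sin2pi.
have [m mp mN] := prim_order_exists N0 h1.
suff mE : m = N by move: mp; rewrite mE.
apply/eqP; rewrite eqn_leq dvdn_leq//= leqNgt; apply/negP => mltN.
have m0 := prim_order_gt0 mp.
have := prim_expr_order mp; rewrite -expi_natmul => -[h _].
pose y : R := m%:R * pi / N%:R.
have hy : 0 < sin y.
  apply: sin_gt0_pi; apply/andP; split.
    by rewrite /y !mulr_gt0 ?ltr0n ?pi_gt0 ?invr_gt0.
  by rewrite /y ltr_pdivrMr// mulrC ltr_pM2l ?pi_gt0// ltr_nat.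
have : cos (y *+ 2) = 1 by rewrite -h /y; congr cos; rewrite mulr2n; ring.
rewrite cos_mulr2n => /eqP; rewrite subr_eq.
have -> : 1 + 1 = 1 *+ 2 :> R by [].
rewrite eqr_pMn2r// cos2sin2 subr_eq addrC -subr_eq subrr eq_sym sqrf_eq0.
by rewrite gt_eqF.
Qed.

Lemma prod_root_unity (N : nat) (x : C) : (0 < N)%N ->
  \prod_(j < N) (x - expi (2 * pi / N%:R) ^+ j) = x ^+ N - 1.
Proof.
move=> N0; have := factor_Xn_sub_1 (expi_root_prim N0).
move/(congr1 (horner^~ x)); rewrite hornerD hornerN hornerXn hornerC => <-.
rewrite horner_prod big_mkord; apply: eq_bigr => i _.
by rewrite hornerXsubC.
Qed.

Definition circ_pt (c : C) (r : R) (N j : nat) : C :=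
  c + toC r * expi (2 * pi * (j%:R / N%:R)).

Lemma circ_ptE c r N j :
  circ_pt c r N j = c + toC r * expi (2 * pi / N%:R) ^+ j.
Proof. by rewrite /circ_pt -expi_natmul; congr (_ + _ * expi _); ring. Qed.

Lemma prod_circ_pt (N : nat) (c w : C) (r : R) : (0 < N)%N -> 0 < r ->
  \prod_(j < N) cabs (circ_pt c r N j - w) = cabs ((w - c) ^+ N - toC r ^+ N).
Proof.
move=> N0 r0.
have rC : toC r != 0 :> C by rewrite -cabs_gt0 cabs_toC gtr0_norm.
rewrite -[X in cabs X]opprK cabsN opprB.
have -> : toC r ^+ N - (w - c) ^+ N = - (toC r ^+ N * (((w - c) / toC r) ^+ N - 1)).
  by rewrite mulrBr mulr1 expr_div_n mulrCA mulfV ?expf_neq0// mulr1 opprB.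
rewrite cabsN cabsM cabsX -prod_root_unity// cabs_prod.
have -> : cabs (toC r) ^+ N = \prod_(j < N) cabs (toC r).
  by rewrite prodr_const card_ord.
rewrite -big_split /=.
apply: eq_bigr => j _; rewrite -cabsM mulrBr [toC r * (_ / _)]mulrCA mulfV// mulr1 cabsC.
by rewrite circ_ptE; congr cabs; ring.
Qed.

(** The product equals |(w - c)^N - r^N|; as |w - c| <> r, the larger of the two
terms dominates and exceeds |c - w|^N up to a constant factor. *)
Lemma prod_circ_ge (c w : C) (r : R) : 0 < r -> cabs (w - c) != r ->
  exists2 kap : R, 0 < kap & forall N, (0 < N)%N ->
    kap * cabs (c - w) ^+ N <= \prod_(j < N) cabs (circ_pt c r N j - w).
Proof.
move=> r0 hr; rewrite [cabs (c - w)]cabsC.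
set q := cabs (w - c) in hr *.
have q0 : 0 <= q by exact: cabs_ge0.
have pw (t : R) N : 0 <= t < 1 -> (0 < N)%N -> 1 - t <= 1 - t ^+ N.
  move=> /andP[t0 t1]; case: N => // N _; rewrite lerD2l lerN2 exprS.
  by rewrite ler_piMr// exprn_ile1// ltW.
have low N : (0 < N)%N -> `|q ^+ N - r ^+ N| <= \prod_(j < N) cabs (circ_pt c r N j - w).
  move=> N0; rewrite prod_circ_pt//.
  by apply: le_trans (dist_cabs _ _); rewrite !cabsX cabs_toC (gtr0_norm r0).
case: (ltgtP q r) hr => // qr _.
  exists (1 - q / r); first by rewrite subr_gt0 ltr_pdivrMr// mul1r.
  move=> N N0; apply: le_trans (low N N0).
  rewrite distrC; apply: le_trans (ler_norm _).
  have h : 1 - q / r <= 1 - (q / r) ^+ N.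
    by apply: pw => //; rewrite divr_ge0//= ?ltr_pdivrMr ?mul1r// ltW.
  have e : r ^+ N - q ^+ N = (1 - (q / r) ^+ N) * r ^+ N.
    by rewrite mulrBl mul1r expr_div_n divfK// expf_neq0// gt_eqF.
  rewrite e ler_pM ?exprn_ge0//.
    by rewrite subr_ge0 ler_pdivrMr// mul1r ltW.
  by rewrite lerXn2r ?nnegrE// ltW.
exists (1 - r / q); first by rewrite subr_gt0 ltr_pdivrMr ?mul1r// (lt_trans r0).
move=> N N0; apply: le_trans (low N N0); apply: le_trans (ler_norm _).
have qp : 0 < q by exact: lt_trans qr.
have h : 1 - r / q <= 1 - (r / q) ^+ N.
  by apply: pw => //; rewrite divr_ge0//= ?ltr_pdivrMr ?mul1r// ltW.
have -> : q ^+ N - r ^+ N = (1 - (r / q) ^+ N) * q ^+ N.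
  by rewrite mulrBl mul1r expr_div_n divfK// expf_neq0// gt_eqF.
by rewrite ler_wpM2r// exprn_ge0.
Qed.

Lemma poly_factor (f : {poly C}) : f != 0 ->
  exists s : seq C, [/\ (size s).+1 = size f,
    (forall x, f.[x] = lead_coef f * \prod_(w <- s) (x - w)) &
    forall w, w \in s -> root f w].
Proof.
move=> f0; have [s fs] := closed_field_poly_normal f.
have lf : lead_coef f != 0 by rewrite lead_coef_eq0.
exists s; split.
- by rewrite [f in RHS]fs size_scale// size_prod_XsubC.
- move=> x; rewrite {1}fs hornerZ horner_prod; congr (_ * _).
  by apply: eq_bigr => w _; rewrite hornerXsubC.
- by move=> w ws; rewrite fs rootZ// root_prod_XsubC.
Qed.

Lemma avoid_radius (s : seq R) (r eta : R) : 0 < eta ->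
  exists2 r', r < r' < r + eta & r' \notin s.
Proof.
elim: s eta => [|x s IH] eta eta0.
  by exists (r + eta / 2) => //; lra.
have [xr|rx] := leP x r.
  have [r' hr' ns] := IH _ eta0; exists r' => //.
  rewrite inE negb_or ns andbT; case/andP: hr' => h _.
  by rewrite gt_eqF// (le_lt_trans xr).
have h : 0 < Num.min eta (x - r) by rewrite lt_min eta0 subr_gt0.
have [r' /andP[h1 h2] ns] := IH _ h; exists r'.
  by rewrite h1 (lt_le_trans h2)// lerD2l ge_min lexx.
rewrite inE negb_or ns andbT lt_eqF// (lt_le_trans h2)//.
by rewrite -lerBrDl ge_min lexx orbT.
Qed.

(** Jensen's inequality for polynomials with the circle mean replaced by a product
over equidistributed points.  Each linear factor of f contributes a bounded
factor by [prod_circ_ge]; the radius has to avoid the moduli of the roots, which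
is why it is only prescribed up to eta. *)
Lemma discrete_jensen (f : {poly C}) (c : C) (r eta : R) :
  0 < r -> 0 < eta -> f.[c] != 0 ->
  exists r' kap : R, [/\ r < r' < r + eta, 0 < kap & forall N, (0 < N)%N ->
    kap * cabs f.[c] ^+ N <= \prod_(j < N) cabs f.[circ_pt c r' N j]].
Proof.
move=> r0 eta0 fc.
have f0 : f != 0 by apply: contra_neq fc => ->; rewrite horner0.
have [s [_ fE _]] := poly_factor f0.
have [r' hr ns] := avoid_radius [seq cabs (w - c) | w <- s] r eta0.
have r'0 : 0 < r' by case/andP: hr => h _; exact: lt_trans h.
have {ns} ns w : w \in s -> cabs (w - c) != r'.
  move=> ws; apply: contra_notN (negP ns) => /eqP <-.
  by apply/mapP; exists w.
exists r'.
have [kap k0 H] : exists2 kap : R, 0 < kap & forall N, (0 < N)%N ->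
    kap * (\prod_(w <- s) cabs (c - w)) ^+ N <=
    \prod_(j < N) \prod_(w <- s) cabs (circ_pt c r' N j - w).
  elim: s ns {fE} => [|w s IH] ns.
    exists 1 => // N N0; rewrite !big_nil expr1n mul1r.
    by rewrite big1// => i _; rewrite big_nil.
  have [k1 k10 H1] := prod_circ_ge r'0 (ns w (mem_head _ _)).
  have [|k2 k20 H2] := IH; first by move=> v vs; rewrite ns// inE vs orbT.
  exists (k1 * k2); first exact: mulr_gt0.
  move=> N N0; rewrite big_cons exprMn mulrACA.
  rewrite (eq_bigr (fun j : 'I_N => cabs (circ_pt c r' N j - w) *
     \prod_(w <- s) cabs (circ_pt c r' N j - w))); last first.
    by move=> j _; rewrite big_cons.
  have p0 : 0 <= \prod_(w <- s) cabs (c - w).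
    by apply: prodr_ge0 => i _; exact: cabs_ge0.
  by rewrite big_split /= ler_pM ?H1 ?H2// mulr_ge0 ?exprn_ge0 ?cabs_ge0// ltW.
exists kap; split => // N N0.
rewrite fE cabsM cabs_prod exprMn mulrCA.
rewrite (eq_bigr (fun j : 'I_N => cabs (lead_coef f) *
     \prod_(w <- s) cabs (circ_pt c r' N j - w))); last first.
  by move=> j _; rewrite fE cabsM cabs_prod.
rewrite big_split /= prodr_const card_ord ler_wpM2l ?exprn_ge0 ?cabs_ge0//.
exact: H.
Qed.

(** The logarithm of [discrete_jensen] divided by N: the constant kap contributes
ln kap / N, which is eventually at least -eps.  The majorant u stands for ln T
of an orbit, in which ln|f| is only one of the competing terms. *)
Lemma discrete_submean (f : {poly C}) (u : C -> R) (c : C) (r eta eps : R) :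
  0 < r -> 0 < eta -> 0 < eps -> f.[c] != 0 ->
  (forall x, f.[x] != 0 -> ln (cabs f.[x]) <= u x) ->
  exists r' : R, r < r' < r + eta /\ exists N0, forall N, (N0 <= N)%N ->
    ln (cabs f.[c]) - eps <= N%:R^-1 * \sum_(j < N) u (circ_pt c r' N j).
Proof.
move=> r0 eta0 eps0 fc fu.
have [r' [kap [hr k0 H]]] := discrete_jensen r0 eta0 fc.
exists r'; split => //.
exists (Num.truncn (`|ln kap| / eps)).+1 => N hN.
have N0 : (0 < N)%N by case: N hN.
have NR : 0 < N%:R :> R by rewrite ltr0n.
rewrite ler_pdivlMl//.
have afc : 0 < cabs f.[c] by rewrite cabs_gt0.
have hl := H N N0.
have lp : 0 < kap * cabs f.[c] ^+ N by rewrite mulr_gt0// exprn_gt0.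
have pp := lt_le_trans lp hl.
have nz (j : 'I_N) : f.[circ_pt c r' N j] != 0.
  apply: contraTneq pp => e; rewrite (bigD1 j)//= e cabs0 mul0r ltxx//.
have {}hl : ln kap + N%:R * ln (cabs f.[c]) <= \sum_(j < N) ln (cabs f.[circ_pt c r' N j]).
  have -> : \sum_(j < N) ln (cabs f.[circ_pt c r' N j]) =
            ln (\prod_(j < N) cabs f.[circ_pt c r' N j]).
    have gen (s : seq 'I_N) : 0 < \prod_(j <- s) cabs f.[circ_pt c r' N j] /\
       \sum_(j <- s) ln (cabs f.[circ_pt c r' N j]) = ln (\prod_(j <- s) cabs f.[circ_pt c r' N j]).
      elim: s => [|j s [IH1 IH2]]; first by rewrite !big_nil ln1.
      rewrite !big_cons; split; first by rewrite mulr_gt0// cabs_gt0.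
      by rewrite lnM ?posrE ?cabs_gt0// IH2.
    exact: (gen _).2.
  have -> : ln kap + N%:R * ln (cabs f.[c]) = ln (kap * cabs f.[c] ^+ N).
    by rewrite lnM ?posrE ?exprn_gt0// lnXn// mulr_natl.
  by rewrite ler_ln ?posrE.
have : \sum_(j < N) ln (cabs f.[circ_pt c r' N j]) <= \sum_(j < N) u (circ_pt c r' N j).
  by apply: ler_sum => j _; apply: fu.
move/(le_trans hl); apply: le_trans; rewrite mulrBr [_ - _]addrC lerD2r.
have : `|ln kap| <= N%:R * eps.
  rewrite -ler_pdivrMr// ltW// (lt_le_trans (truncnS_gt _))// ler_nat//.
by move=> h; rewrite lerNl (le_trans _ h)// -normrN ler_norm.
Qed.

End DiscreteJensen.

(** * Logarithm of a zero-free polynomial *)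

Section LogTaylor.
Context {R : realType}.
Local Notation C := (Cplx R).

Let h (y : R) := ln (1 + y) - (y - y ^+ 2 / 2).

Let dh (y : R) : -1 < y -> is_derive y 1 h (y ^+ 2 / (1 + y)).
Proof.
move=> y1; have y1' : 0 < 1 + y by lra.
have d1 : is_derive (1 + y) 1 (@ln R) (1 + y)^-1 by exact: is_derive1_ln.
have dc : is_derive y 1 (cst 1 + (id : R -> R)) (0 + 1) by exact: is_deriveD.
have d1' : is_derive ((cst 1 + (id : R -> R)) y) 1 (@ln R) (1 + y)^-1 by [].
have da := @is_derive1_comp _ _ _ _ _ _ d1' dc.
have e : h = (@ln R \o (cst 1 + (id : R -> R))) - ((id : R -> R) - (2^-1 \*: ((id : R -> R) ^+ 2))).
  by apply/funext => t; rewrite /h /= !fctE /= mulrC.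
rewrite e; apply: is_derive_eq.
rewrite /GRing.scale /= expr1; field; rewrite gt_eqF//.
Qed.

(** The function ln (1 + y) - (y - y^2 / 2) has derivative y^2 / (1 + y), so the mean
value theorem gives the cubic bound. *)
Lemma ln1p_taylor (x : R) : `|x| <= 3 / 4 ->
  `|ln (1 + x) - (x - x ^+ 2 / 2)| <= 4 * `|x| ^+ 3.
Proof.
move=> hx.
have h0 : h 0 = 0 by rewrite /h addr0 ln1 expr0n /= mul0r !subr0.
have bd c : `|c| <= `|x| -> `|c ^+ 2 / (1 + c)| <= 4 * `|x| ^+ 2.
  move=> cx; have := le_trans cx hx; rewrite ler_norml => /andP[c1 c2].
  have c0 : 0 < 1 + c by lra.
  rewrite normrM normrX normfV (gtr0_norm c0) ler_pdivrMr//.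
  have : `|c| ^+ 2 <= `|x| ^+ 2 by rewrite lerXn2r ?nnegrE.
  move/le_trans; apply; rewrite -mulrA mulrCA ler_peMr ?sqr_ge0//; lra.
have cont a b : -1 < a -> {within `[a, b], continuous h}.
  move=> a1; apply: derivable_within_continuous => y; rewrite in_itv /= => /andP[ay _].
  by case: (dh (lt_le_trans a1 ay)).
have fin c : `|c| <= `|x| -> `|h x| = `|c ^+ 2 / (1 + c)| * `|x| ->
    `|h x| <= 4 * `|x| ^+ 3.
  by move=> cx ->; rewrite [`|x| ^+ 3]exprSr mulrA ler_wpM2r// bd.
have x1 : -1 < x by move: hx; rewrite ler_norml => /andP[? _]; lra.
have [x0|x0] := leP 0 x.
  have dx y : y \in `]0, x[ -> is_derive y 1 h (y ^+ 2 / (1 + y)).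
    by rewrite in_itv /= => /andP[y0 _]; apply: dh; rewrite (lt_trans _ y0)// ltrN10.
  have [c] := MVT_segment x0 dx (cont _ _ (ltrN10 _)).
  rewrite in_itv /= h0 !subr0 => /andP[c0 cx] hh.
  apply: (fin c); first by rewrite !ger0_norm.
  by rewrite hh normrM (ger0_norm x0).
have dx y : y \in `]x, 0[ -> is_derive y 1 h (y ^+ 2 / (1 + y)).
  by rewrite in_itv /= => /andP[y0 _]; apply: dh; rewrite (lt_trans _ y0).
have [c] := MVT_segment (ltW x0) dx (cont _ _ x1).
rewrite in_itv /= h0 !sub0r => /andP[xc c0] hh.
apply: (fin c); first by rewrite !ler0_norm ?lerN2// ltW.
by rewrite -normrN hh normrM normrN.
Qed.

(** Apply [ln1p_taylor] to |1 - s|^2 = 1 + (|s|^2 - 2 Re s): the second-order terms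
combine to - Re (s^2) / 2, whose harmonicity is the point of the expansion. *)
Lemma ln_cabs_taylor (s : C) : cabs s <= 1 / 4 ->
  `|ln (cabs (1 - s)) + complex.Re s + complex.Re (s ^+ 2) / 2|
    <= 26 * cabs s ^+ 3.
Proof.
move=> hs; have s0 := cabs_ge0 s.
have ReIm := sqr_cabs s.
set p := cabs s in hs s0 ReIm *.
set a := complex.Re s in ReIm *; set b := complex.Im s in ReIm.
have ap : `|a| <= p by exact: cabs_Re.
have s2 : complex.Re (s ^+ 2) = a ^+ 2 - b ^+ 2.
  by rewrite /a /b; case: (s) => u v; rewrite expr2 /= -!expr2.
have e1 : cabs (1 - s) = Num.sqrt (1 + (p ^+ 2 - 2 * a)).
  rewrite cabsE; congr Num.sqrt; rewrite ReIm /a /b; case: (s) => u v /=.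
  by ring.
pose x := p ^+ 2 - 2 * a.
have xb : `|x| <= 9 / 4 * p.
  rewrite /x (le_trans (ler_normB _ _))// (ger0_norm (sqr_ge0 p)) normrM normr_nat.
  have : p ^+ 2 <= 1 / 4 * p by rewrite expr2 ler_wpM2r.
  by move: ap; lra.
have x34 : `|x| <= 3 / 4 by apply: le_trans xb _; lra.
have px : 0 < 1 + x by move: x34; rewrite ler_norml => /andP[? _]; lra.
have lns : ln (cabs (1 - s)) = ln (1 + x) / 2.
  rewrite e1 -/x; have := lnXn 2 (x := Num.sqrt (1 + x)).
  by rewrite sqrtr_gt0 => /(_ px); rewrite sqr_sqrtr ?ltW// => ->; rewrite mulr2n; field.
rewrite lns s2.
have tx := ln1p_taylor x34.
have x3 : `|x| ^+ 3 <= 12 * p ^+ 3.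
  have : `|x| ^+ 3 <= (9 / 4 * p) ^+ 3.
    by rewrite lerXn2r ?nnegrE// mulr_ge0//; lra.
  move/le_trans; apply; rewrite exprMn ler_wpM2r ?exprn_ge0//.
  by rewrite !exprS expr0; lra.
have -> : ln (1 + x) / 2 + a + (a ^+ 2 - b ^+ 2) / 2 =
   ((ln (1 + x) - (x - x ^+ 2 / 2)) + (2 * a * p ^+ 2 - p ^+ 4 / 2)) / 2.
  have -> : p ^+ 4 = (a ^+ 2 + b ^+ 2) ^+ 2 by rewrite -ReIm -exprM.
  by rewrite /x ReIm; field.
have h3 : `|2 * a * p ^+ 2| <= 2 * p ^+ 3.
  rewrite [p ^+ 3]exprS mulrA normrM (ger0_norm (sqr_ge0 p)).
  by rewrite ler_wpM2r ?sqr_ge0// normrM normr_nat ler_wpM2l.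
have h4 : `|p ^+ 4 / 2| <= p ^+ 3.
  rewrite ger0_norm ?divr_ge0 ?exprn_ge0// exprS.
  have := exprn_ge0 3 s0; move: (p ^+ 3) => P P0.
  have : p * P <= 1 / 4 * P by rewrite ler_wpM2r.
  lra.
have p30 := exprn_ge0 3 s0.
rewrite normrM (ger0_norm (_ : 0 <= 2^-1))// ler_pdivrMr//.
apply: (le_trans (ler_normD _ _)).
have := ler_normB (2 * a * p ^+ 2) (p ^+ 4 / 2).
by move: tx x3 h3 h4 p30; lra.
Qed.

(** Factor f over its roots w, all of modulus at least sig, and add the expansions of
ln|1 - x / w|.  The bounds are proportional to the number of roots, so after
division by the degree they do not depend on f. *)
Lemma ln_poly_taylor (f : {poly C}) (K : nat) (sig : R) : 0 < sig ->
  (size f <= K.+1)%N -> (forall x, cabs x < sig -> f.[x] != 0) ->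
  exists al be : C, cabs be <= K%:R / sig ^+ 2 /\ forall x, cabs x <= sig / 4 ->
    `|ln (cabs f.[x]) - ln (cabs f.[0]) - complex.Re (al * x) - complex.Re (be * x ^+ 2)|
      <= 26 * K%:R / sig ^+ 3 * cabs x ^+ 3.
Proof.
move=> sig0 sf nz.
have f00 : f.[0] != 0 by apply: nz; rewrite cabs0.
have f0 : f != 0 by apply: contra_neq f00 => ->; rewrite horner0.
have [s [ss fE rs]] := poly_factor f0.
have ws w : w \in s -> sig <= cabs w.
  by move=> /rs rw; rewrite leNgt; apply/negP => /nz; rewrite -rootE rw.
have [al [be [hbe H]]] : exists al be : C, cabs be <= (size s)%:R / sig ^+ 2 /\
   forall x, cabs x <= sig / 4 -> 0 < cabs (\prod_(w <- s) (1 - x / w)) /\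
    `|ln (cabs (\prod_(w <- s) (1 - x / w))) - complex.Re (al * x) - complex.Re (be * x ^+ 2)|
      <= 26 * (size s)%:R / sig ^+ 3 * cabs x ^+ 3.
  elim: s ws {ss fE rs} => [|w s IH] ws.
    exists 0, 0; split; first by rewrite cabs0 mul0r.
    by move=> x _; rewrite big_nil cabs1 ln1 !mul0r !subr0 normr0 mulr0 !mul0r.
  have [|al [be [hbe H]]] := IH; first by move=> v vs; apply: ws; rewrite inE vs orbT.
  have sE : (size (w :: s))%:R = (size s)%:R + 1 :> R by rewrite /= -natr1.
  have wsig := ws _ (mem_head _ _).
  have w0 : 0 < cabs w by exact: lt_le_trans wsig.
  have iw : (cabs w)^-1 <= sig^-1 by rewrite lef_pV2.
  exists (al - w^-1), (be - toC 2^-1 * w^-1 ^+ 2); split.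
    rewrite (le_trans (cabsB _ _))// sE mulrDl lerD// mul1r.
    rewrite cabsM cabsX cabsV cabs_toC ger0_norm// -exprVn.
    have : (cabs w)^-1 ^+ 2 <= sig^-1 ^+ 2.
      by rewrite lerXn2r ?nnegrE ?invr_ge0// ltW.
    have := sqr_ge0 (cabs w)^-1; lra.
  move=> x hx; have [P0 HP] := H x hx; rewrite big_cons.
  have xw : cabs (x / w) <= 1 / 4.
    rewrite cabsM cabsV ler_pdivrMr// (le_trans hx)//.
    by rewrite mulrC; move: wsig; lra.
  have h1 : 0 < cabs (1 - x / w).
    rewrite cabs_gt0 subr_eq0; apply: contraTneq xw => <-.
    by rewrite cabs1 -ltNge; lra.
  rewrite cabsM; split; first exact: mulr_gt0.
  rewrite lnM ?posrE//.
  have T := ln_cabs_taylor xw.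
  have -> : complex.Re ((al - w^-1) * x) = complex.Re (al * x) - complex.Re (x / w).
    by rewrite mulrBl [w^-1 * x]mulrC; case: (al * x) => ? ?; case: (x / w).
  have -> : complex.Re ((be - toC 2^-1 * w^-1 ^+ 2) * x ^+ 2) =
      complex.Re (be * x ^+ 2) - complex.Re ((x / w) ^+ 2) / 2.
    rewrite mulrBl -mulrA -exprMn [w^-1 * x]mulrC.
    by case: (be * x ^+ 2) => ? ?; case: ((x / w) ^+ 2) => u v /=; ring.
  set A := ln _; set B := ln _ in HP *.
  have -> : A + B - (complex.Re (al * x) - complex.Re (x / w)) -
     (complex.Re (be * x ^+ 2) - complex.Re ((x / w) ^+ 2) / 2) =
     (A + complex.Re (x / w) + complex.Re ((x / w) ^+ 2) / 2) +
     (B - complex.Re (al * x) - complex.Re (be * x ^+ 2)) by ring.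
  rewrite (le_trans (ler_normD _ _))// sE addrC.
  rewrite (_ : 26 * (_ + 1) / _ * _ = 26 * (size s)%:R / sig ^+ 3 * cabs x ^+ 3
     + 26 * (cabs x ^+ 3 / sig ^+ 3)); last by ring.
  apply: lerD => //; apply: (le_trans T); rewrite ler_wpM2l//.
  rewrite cabsM exprMn cabsV ler_wpM2l ?exprn_ge0 ?cabs_ge0//.
  by rewrite -exprVn lerXn2r ?nnegrE ?invr_ge0// ltW.
have sK : (size s)%:R <= K%:R :> R by rewrite ler_nat -ltnS ss.
exists al, be; split.
  by rewrite (le_trans hbe)// ler_wpM2r// invr_ge0 sqr_ge0.
move=> x hx; have [P0 HP] := H x hx.
have e : f.[x] = f.[0] * \prod_(w <- s) (1 - x / w).
  rewrite !fE -mulrA -big_split /=; congr (_ * _).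
  rewrite !big_seq; apply: eq_bigr => w /ws wsig.
  have w0 : w != 0 by rewrite -cabs_gt0 (lt_le_trans sig0).
  by field; rewrite w0.
rewrite e cabsM lnM ?posrE ?cabs_gt0//; last by rewrite -cabs_gt0.
rewrite [X in X - ln (cabs f.[0])]addrC addrK (le_trans HP)//.
rewrite ler_wpM2r ?exprn_ge0 ?cabs_ge0// ler_wpM2r ?ler_wpM2l//.
by rewrite invr_ge0 exprn_ge0// ltW.
Qed.

End LogTaylor.

(** * Pluriharmonicity from difference quotients *)

Section PuncturedLimits.
Context {R : realType}.

Lemma near0_bound (d : R) : 0 < d -> \forall t \near (0 : R)^', 0 < `|t| < d.
Proof.
move=> d0; near=> t; apply/andP; split.
  by rewrite normr_gt0; near: t; exact: nbhs_dnbhs_neq.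
near: t; apply: nbhs_dnbhs; apply/nbhs_ballP; exists d => //= t.
by rewrite /ball /= sub0r normrN.
Unshelve. all: by end_near. Qed.

(** Difference quotients with these Cauchy estimates converge as t tends to 0. *)
Lemma punctured_cauchy (f : R -> R) (K d : R) : 0 < d ->
  (forall t s, 0 < `|t| < d -> 0 < `|s| < d ->
     `|f t - f s| <= K * (`|t| + `|s|)) ->
  cvg (f t @[t --> (0 : R)^']).
Proof.
move=> d0 H; apply/cauchy_cvgP/cauchy_exP => e e0 /=.
pose K' := `|K| + 1.
have K0 : 0 < K' by rewrite /K' ltr_wpDl.
pose d' := Num.min d (e / (2 * K')).
have d'0 : 0 < d' by rewrite lt_min d0 divr_gt0// mulr_gt0.
exists (f (d' / 2)).
apply: filterS (near0_bound d'0) => t /andP[t0 td].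
have [d'd d'e] : d' <= d /\ d' <= e / (2 * K') by rewrite !ge_min !lexx orbT.
have d2 : `|d' / 2| = d' / 2 by rewrite gtr0_norm// divr_gt0.
have h2 : 0 < d' / 2 by rewrite divr_gt0.
rewrite /ball /=; apply: le_lt_trans (H _ _ _ _) _.
- by rewrite d2 h2 (lt_le_trans _ d'd)//; move: d'0; lra.
- by rewrite t0 (lt_le_trans td).
rewrite d2.
have : K * (d' / 2 + `|t|) <= K' * (d' / 2 + `|t|).
  by rewrite ler_wpM2r ?addr_ge0 ?(ltW h2)// /K' (le_trans (ler_norm _))// lerDl.
move/le_lt_trans; apply.
have : K' * (d' / 2 + `|t|) < K' * (2 * d').
  by rewrite ltr_pM2l//; move: td d'0; lra.
move/lt_le_trans; apply.
have -> : e = K' * (2 * (e / (2 * K'))) by field; rewrite gt_eqF.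
by rewrite ler_pM2l// ler_pM2l.
Qed.

Lemma punctured_lim_bound (f : R -> R) (l a b K d : R) : 0 < d ->
  f t @[t --> (0 : R)^'] --> l ->
  (forall t, 0 < `|t| < d -> `|a - f t| <= b + K * `|t|) -> `|a - l| <= b.
Proof.
move=> d0 fl H.
have h1 : `|a - f t| @[t --> (0 : R)^'] --> `|a - l|.
  by apply: cvg_norm; apply: cvgB => //; exact: cvg_cst.
have h2 : (b + K * `|t|) @[t --> (0 : R)^'] --> b + K * `|0 : R|.
  apply: cvgD; first exact: cvg_cst.
  apply: cvgMr; apply: cvg_norm; apply: cvg_within.
move: h2; rewrite normr0 mulr0 addr0 => h2.
apply: ler_cvg_to h1 h2 _.
by apply: filterS (near0_bound d0) => t; exact: H.
Qed.

Lemma five_bound (x a b c e k1 k2 k3 k4 k5 : R) :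
  `|a| <= k2 -> `|b| <= k3 -> `|c| <= k4 -> `|e| <= k5 -> `|x| <= k1 ->
  `|- x + a / 2 - b / 2 + c / 2 - e / 2| <= k1 + k1 + k2 + k3 + k4 + k5.
Proof.
rewrite !ler_norml => /andP[? ?] /andP[? ?] /andP[? ?] /andP[? ?] /andP[? ?].
by apply/andP; split; lra.
Qed.

Lemma lin_solve (x y z : R) : x - y - 2 * z = 0 -> x = y + 2 * z.
Proof. by lra. Qed.

End PuncturedLimits.

Section TaylorC2.
Context {R : realType} {E : normedModType (Cplx R)}.
Local Notation C := (Cplx R).
Implicit Types (u : E -> R) (z h v w : E) (t s : R).

(** The first-order difference symmetric in t; its quotient by t approximates the
derivative along h up to O(t^2). *)
Definition odd_diff u z h t : R := (u (z + toC t *: h) - u (z - toC t *: h)) / 2.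
(** The second-order difference; its quotient by t^2 approximates half the second
derivative along h. *)
Definition even_diff u z h t : R :=
  (u (z + toC t *: h) + u (z - toC t *: h) - 2 * u z) / 2.

Lemma odd_even u z h t :
  u (z + toC t *: h) = u z + odd_diff u z h t + even_diff u z h t.
Proof. by rewrite /odd_diff /even_diff; field. Qed.

(** What remains of a second-order expansion with harmonic quadratic part once the
unknown Taylor coefficients are eliminated: every inequality bounds a linear
functional of u, so all of them are inherited by limits and averages.  The second
one, where the differences along h and i h cancel to order 3, encodes the
Laplace equation. *)
Definition taylor_ineqs u z h K d := forall t, 0 < `|t| < d ->
  [/\ `|even_diff u z h t| <= K * `|t| ^+ 2,
      `|even_diff u z h t + even_diff u z (imag_unit *: h) t| <= K * `|t| ^+ 3 &
   forall s, 0 < `|s| < d ->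
     `|odd_diff u z h t / t - odd_diff u z h s / s| <= K * (`|t| ^+ 2 + `|s| ^+ 2)
     /\ `|even_diff u z h t / t ^+ 2 - even_diff u z h s / s ^+ 2|
        <= K * (`|t| + `|s|)].

Definition taylor_at u z0 := forall h, exists K d : R, [/\ 0 <= K, 0 < d &
  \forall z \near z0, taylor_ineqs u z h K d].

(** Half the second derivative along h. *)
Definition second u h z : R :=
  lim ((fun t => even_diff u z h t / t ^+ 2) @ (0 : R)^').

Lemma toC_cvg (t0 : R) : (@toC R) @ t0 --> toC t0.
Proof.
apply/cvgC_P => e e0; apply/nbhs_ballP; exists e => //= t.
by rewrite /ball /= -toCN -toCD cabs_toC distrC.
Qed.

Lemma near_shift (U : set E) z0 h : nbhs z0 U ->
  exists2 d : R, 0 < d & \forall z \near z0, forall t, `|t| < d -> U (z + toC t *: h).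
Proof.
move=> U0.
have : (fun p : E * R => p.1 + toC p.2 *: h) @ filter_prod (nbhs z0) (nbhs (0 : R))
    --> z0 + toC 0 *: h.
  apply: cvgD; first exact: cvg_fst.
  apply: cvgZ; last exact: cvg_cst.
  by apply: cvg_comp (@toC_cvg 0); exact: cvg_snd.
rewrite toC0 scale0r addr0.
move=> /(_ _ U0) [[A B] /= [zA /nbhs_ballP[d d0 dB]] AB].
exists d => //; apply: filterS zA => z Az t td.
by apply: (AB (z, t)); split => //; apply: dB; rewrite /ball /= sub0r normrN.
Qed.

(** Near z0 the symmetric and the one-sided quotients converge to the derivative at
uniform rates.  The quadratic rate of the symmetric one makes second
derivatives computable from first differences in [dird_dird]. *)
Lemma taylor_dird u z0 h : taylor_at u z0 -> exists K d : R, [/\ 0 <= K, 0 < d &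
  \forall z \near z0, derivable (fun t : R => u (z + toC t *: h)) 0 1 /\
   forall t, 0 < `|t| < d ->
    `|odd_diff u z h t / t - dird h u z| <= K * `|t| ^+ 2 /\
    `|(u (z + toC t *: h) - u z) / t - dird h u z| <= K * `|t|].
Proof.
move=> /(_ h)[K [d [K0 d0 H]]].
pose d1 := Num.min d 1; exists (2 * K), d1.
have d10 : 0 < d1 by rewrite lt_min d0 ltr01.
have d1d : d1 <= d by rewrite ge_min lexx.
have d11 : d1 <= 1 by rewrite ge_min lexx orbT.
split => //; first by rewrite mulr_ge0.
apply: filterS H => z H.
pose q t := (u (z + toC t *: h) - u z) / t.
have qE t : t != 0 -> q t = odd_diff u z h t / t + even_diff u z h t / t.
  by move=> t0; rewrite /q odd_even; field.
have ev t : 0 < `|t| < d1 -> `|even_diff u z h t / t| <= K * `|t|.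
  move=> /andP[t0 td]; have [|h1 _ _] := H t; first by rewrite t0 (lt_le_trans td).
  rewrite normrM normfV ler_pdivrMr//; apply: le_trans h1 _.
  by rewrite expr2 mulrA.
have oq t s : 0 < `|t| < d1 -> 0 < `|s| < d1 ->
    `|odd_diff u z h t / t - q s| <= K * `|t| ^+ 2 + 2 * K * `|s|.
  move=> /andP[t0 td] /andP[s0 sd].
  have [|_ _ /(_ s)[|h1 _]] := H t; rewrite ?t0 ?s0 ?(lt_le_trans td) ?(lt_le_trans sd)//.
  rewrite qE -?normr_gt0// opprD addrA (le_trans (ler_normB _ _))//.
  have := ev s; rewrite s0 sd => /(_ isT) h2.
  have : K * `|s| ^+ 2 <= K * `|s|.
    rewrite ler_wpM2l// expr2 ler_piMr// ltW// (lt_le_trans sd)//.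
  move: h1 h2; lra.
have qq t s : 0 < `|t| < d1 -> 0 < `|s| < d1 ->
    `|q t - q s| <= 2 * K * (`|t| + `|s|).
  move=> ht hs; have h1 := oq t s ht hs; have h2 := ev t ht.
  case/andP: ht => t0 td.
  rewrite (qE t) -?normr_gt0// addrAC (le_trans (ler_normD _ _))//.
  have : K * `|t| ^+ 2 <= K * `|t|.
    rewrite ler_wpM2l// expr2 ler_piMr// ltW// (lt_le_trans td)//.
  move: h1 h2; lra.
have qcvg := punctured_cauchy d10 qq.
have qfun : (fun t : R => t^-1 *: (((fun t : R => u (z + toC t *: h)) \o shift 0)
    (t *: (1 : R)) - u (z + toC 0 *: h))) = q.
  apply/funext => t; have t1 : t *: (1 : R) = t by exact: mulr1.
  by rewrite /q /= t1 toC0 scale0r !addr0 [RHS]mulrC.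
have dq : dird h u z = lim (q t @[t --> (0:R)^']).
  rewrite /dird /derive1.
  suff -> : (fun t : R => t^-1 *: (u (z + toC (t + 0) *: h) - u (z + toC 0 *: h))) = q by [].
  by apply/funext => t; rewrite /q toC0 scale0r !addr0 [RHS]mulrC.
split; first by rewrite /derivable qfun.
rewrite dq => t ht; split.
  apply: (@punctured_lim_bound _ q _ _ _ (2 * K) d1 d10 qcvg) => s hs.
  apply: le_trans (oq _ _ ht hs) _.
  by rewrite lerD2r ler_wpM2r ?exprn_ge0// ler_peMl// ler1n.
apply: (@punctured_lim_bound _ q _ _ _ (2 * K) d1 d10 qcvg) => s hs.
by rewrite -mulrDr; apply: qq.
Qed.

Lemma taylor_second u z0 h : taylor_at u z0 -> exists K d : R, [/\ 0 <= K, 0 < d &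
  \forall z \near z0,
   second u h z + second u (imag_unit *: h) z = 0 /\
   forall t, 0 < `|t| < d ->
    `|even_diff u z h t / t ^+ 2 - second u h z| <= K * `|t|].
Proof.
move=> H; have H1 := H h; have H2 := H (imag_unit *: h).
case: H1 => [K [d [K0 d0 H1]]]; case: H2 => [K' [d' [K'0 d'0 H2]]].
exists K, d; split => //.
apply: filterS2 H1 H2 => z H1 H2.
pose f t := even_diff u z h t / t ^+ 2.
pose f' t := even_diff u z (imag_unit *: h) t / t ^+ 2.
have ff t s : 0 < `|t| < d -> 0 < `|s| < d -> `|f t - f s| <= K * (`|t| + `|s|).
  by move=> ht hs; have [_ _ /(_ s hs)[]] := H1 t ht.
have ff' t s : 0 < `|t| < d' -> 0 < `|s| < d' -> `|f' t - f' s| <= K' * (`|t| + `|s|).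
  by move=> ht hs; have [_ _ /(_ s hs)[]] := H2 t ht.
have c := punctured_cauchy d0 ff.
have c' := punctured_cauchy d'0 ff'.
split; last first.
  move=> t ht; apply: (@punctured_lim_bound _ f _ _ _ K d d0 c) => s hs.
  by rewrite -mulrDr; apply: ff.
have cs : (f t + f' t) @[t --> (0 : R)^'] --> second u h z + second u (imag_unit *: h) z.
  exact: (cvgD c c').
apply/eqP; rewrite -normr_le0 -normrN -sub0r.
apply: (@punctured_lim_bound _ _ _ _ _ K d d0 cs) => t ht.
case/andP: (ht) => t0 td.
rewrite sub0r normrN add0r /f /f' -mulrDl normrM normfV normrX.
rewrite ler_pdivrMr ?exprn_gt0//.
by have [_ hh _] := H1 t ht; rewrite -mulrA -exprS.
Qed.

Lemma lim_continuous (g : E -> R) (f : R -> E -> R) z0 (K d : R) : 0 < d ->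
  (\forall z \near z0, forall t, 0 < `|t| < d -> `|f t z - g z| <= K * `|t|) ->
  (\forall t \near (0 : R)^', {for z0, continuous (f t)}) ->
  {for z0, continuous g}.
Proof.
move=> d0 H cf; apply/cvgrPdist_le => e e0.
have [t [[/andP[t0 td] Kt] ct]] : exists t,
  (0 < `|t| < d /\ `|K| * `|t| <= e / 3) /\ {for z0, continuous (f t)}.
  have d'0 : 0 < Num.min d (e / 3 / (`|K| + 1)).
    by rewrite lt_min d0 !divr_gt0// ltr_wpDl.
  have [t [/andP[t0]]] := filter_ex (filterI (near0_bound d'0) cf).
  rewrite lt_min => /andP[td te] ct.
  exists t; split => //; split; first by rewrite t0.
  have Kp : 0 < `|K| + 1 by rewrite ltr_wpDl.
  move: te; rewrite ltr_pdivlMr// => /ltW/(le_trans _); apply.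
  by rewrite mulrC ler_wpM2l// lerDl.
have KK z : `|f t z - g z| <= K * `|t| -> `|f t z - g z| <= e / 3.
  by move/le_trans; apply; apply: le_trans Kt; rewrite ler_wpM2r// ler_norm.
have Hz0 := nbhs_singleton H; have {Hz0} Hz0 := KK _ (Hz0 t (introT andP (conj t0 td))).
have e3 : 0 < e / 3 by rewrite divr_gt0.
move/cvgrPdist_le : ct => /(_ _ e3) ct.
apply: filterS2 H ct => z Hz ct.
have {Hz} Hz := KK _ (Hz t (introT andP (conj t0 td))).
have -> : g z0 - g z = (f t z - g z) - (f t z0 - g z0) + (f t z0 - f t z) by ring.
rewrite (le_trans (ler_normD _ _))//.
have := ler_normB (f t z - g z) (f t z0 - g z0); move: Hz Hz0 ct; lra.
Qed.

Variables (Om : set E) (u : E -> R).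
Hypothesis Om_open : open Om.
Hypothesis u_cont : forall z, Om z -> {for z, continuous u}.
Hypothesis u_taylor : forall z, Om z -> taylor_at u z.

Let near_shift_cont z0 h : Om z0 ->
  \forall t \near (0 : R), {for z0, continuous (fun z => u (z + toC t *: h))}.
Proof.
move=> Oz; have [d d0 H] := near_shift h (open_nbhs_nbhs (conj Om_open Oz)).
apply/nbhs_ballP; exists d => // t; rewrite /ball /= sub0r normrN => td.
have Ozt := nbhs_singleton H t td.
apply: (@continuous_comp _ _ _ (fun z => z + toC t *: h) u); last exact: u_cont.
by apply: cvgD; [exact: cvg_id|exact: cvg_cst].
Qed.

Let near_shift_contN z0 h : Om z0 ->
  \forall t \near (0 : R), {for z0, continuous (fun z => u (z - toC t *: h))}.
Proof.
move=> Oz; apply: filterS (near_shift_cont (- h) Oz) => t.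
by rewrite (_ : (fun z => u (z + toC t *: - h)) = (fun z => u (z - toC t *: h)))//;
  apply/funext => z; rewrite scalerN.
Qed.

Lemma dird_continuous h z0 : Om z0 -> {for z0, continuous (dird h u)}.
Proof.
move=> Oz; have [K [d [K0 d0 H]]] := taylor_dird h (u_taylor Oz).
apply: (@lim_continuous _ (fun t z => (u (z + toC t *: h) - u z) / t) _ K d d0).
  by apply: filterS H => z [_ H] t ht; have [] := H t ht.
apply: nbhs_dnbhs; apply: filterS (near_shift_cont h Oz) => t ct.
apply: cvgM; last exact: cvg_cst.
by apply: cvgB => //; exact: u_cont.
Qed.

Lemma second_continuous h z0 : Om z0 -> {for z0, continuous (second u h)}.
Proof.
move=> Oz; have [K [d [K0 d0 H]]] := taylor_second h (u_taylor Oz).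
apply: (@lim_continuous _ (fun t z => even_diff u z h t / t ^+ 2) _ K d d0).
  by apply: filterS H => z [_ H] t ht; exact: H.
apply: nbhs_dnbhs; apply: filterS2 (near_shift_cont h Oz) (near_shift_contN h Oz) => t ct ct'.
apply: cvgM; last exact: cvg_cst.
apply: cvgM; last exact: cvg_cst.
apply: cvgB; first exact: cvgD.
by apply: cvgM; [exact: cvg_cst|exact: u_cont].
Qed.

(** Additivity of v |-> dird v u: the increment along v + w at z0 is the sum of the
increment along v at z0 and of the one along w at the shifted point, where the
derivative is close by [dird_continuous]. *)
Lemma dirdD v w z0 : Om z0 -> dird (v + w) u z0 = dird v u z0 + dird w u z0.
Proof.
move=> Oz.
have [K1 [d1 [K10 d10 H1]]] := taylor_dird (v + w) (u_taylor Oz).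
have [K2 [d2 [K20 d20 H2]]] := taylor_dird v (u_taylor Oz).
have [K3 [d3 [K30 d30 H3]]] := taylor_dird w (u_taylor Oz).
have [_ {}H1] := nbhs_singleton H1; have [_ {}H2] := nbhs_singleton H2.
have [d4 d40 /nbhs_singleton H4] := near_shift v H3.
pose d := Num.min (Num.min d1 d2) (Num.min d3 d4).
have d0 : 0 < d by rewrite !lt_min d10 d20 d30.
have cw : dird w u (z0 + toC t *: v) @[t --> (0 : R)^'] --> dird w u z0.
  have zc : (z0 + toC t *: v) @[t --> (0 : R)^'] --> z0.
    rewrite -[X in _ --> X]addr0 -(scale0r v) -toC0.
    apply: cvgD; first exact: cvg_cst.
    apply: cvgZ; last exact: cvg_cst.
    by apply: cvg_comp (@toC_cvg 0); exact: cvg_within.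
  apply: (@cvg_comp _ _ _ (fun t : R => z0 + toC t *: v) (dird w u) _ (nbhs z0) _ zc).
  exact: dird_continuous.
apply/eqP; rewrite -subr_eq0 -normr_le0.
have cw' : (dird v u z0 + dird w u (z0 + toC t *: v)) @[t --> (0 : R)^']
   --> dird v u z0 + dird w u z0 by apply: cvgD => //; exact: cvg_cst.
apply: (@punctured_lim_bound _ _ _ _ _ (K1 + K2 + K3) d d0 cw') => t /andP[t0].
rewrite !lt_min add0r => /andP[/andP[td1 td2] /andP[td3 td4]].
have [_ h1] := H1 t (introT andP (conj t0 td1)).
have [_ h2] := H2 t (introT andP (conj t0 td2)).
have [_ /(_ t (introT andP (conj t0 td3)))[_ h3]] := H4 t td4.
set p1 := _ / t in h1; set p2 := _ / t in h2; set p3 := _ / t in h3.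
have e : p1 = p2 + p3.
  rewrite /p1 /p2 /p3 -mulrDl scalerDr addrA [X in _ = X / t]addrC; congr (_ / _).
  by rewrite addrA subrK.
have -> : dird (v + w) u z0 - (dird v u z0 + dird w u (z0 + toC t *: v)) =
  (p2 - dird v u z0) + (p3 - dird w u (z0 + toC t *: v)) - (p1 - dird (v + w) u z0).
  by rewrite e; ring.
rewrite (le_trans (ler_normB _ _))//.
have := ler_normD (p2 - dird v u z0) (p3 - dird w u (z0 + toC t *: v)).
move: h1 h2 h3; rewrite !mulrDl; lra.
Qed.

Lemma dirdN v z0 : Om z0 -> dird (- v) u z0 = - dird v u z0.
Proof.
move=> Oz; apply/eqP; rewrite -addr_eq0 -dirdD// addNr.
rewrite /dird (_ : (fun t => u (z0 + toC t *: 0)) = cst (u z0)) ?derive1_cst//.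
by apply/funext => t; rewrite scaler0 addr0.
Qed.

(** Polarization: the mixed derivative is the difference of the second derivatives
along w + v and w - v.  At the level of differences the identity is exact up to
first-order terms, which cancel because dird (w + v) - dird (w - v) = 2 dird v. *)
Lemma dird_dird v w z0 : Om z0 ->
  derivable (fun t : R => dird v u (z0 + toC t *: w)) 0 1 /\
  dird w (dird v u) z0 = (second u (w + v) z0 - second u (w - v) z0) / 2.
Proof.
move=> Oz.
have [K1 [d1 [K10 d10 H1]]] := taylor_dird v (u_taylor Oz).
have [K2 [d2 [K20 d20 /nbhs_singleton[_ H2]]]] := taylor_dird (w + v) (u_taylor Oz).
have [K3 [d3 [K30 d30 /nbhs_singleton[_ H3]]]] := taylor_dird (w - v) (u_taylor Oz).
have [K4 [d4 [K40 d40 /nbhs_singleton[_ H4]]]] := taylor_second (w + v) (u_taylor Oz).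
have [K5 [d5 [K50 d50 /nbhs_singleton[_ H5]]]] := taylor_second (w - v) (u_taylor Oz).
have [d6 d60 /nbhs_singleton H6] := near_shift w H1.
have [_ {}H1] := nbhs_singleton H1.
pose d := Num.min (Num.min (Num.min d1 d2) (Num.min d3 d4)) (Num.min d5 d6).
have d0 : 0 < d by rewrite !lt_min d10 d20 d30 d40 d50.
set S := (second u (w + v) z0 - second u (w - v) z0) / 2.
pose q t := (dird v u (z0 + toC t *: w) - dird v u z0) / t.
have lin : dird (w + v) u z0 - dird (w - v) u z0 - 2 * dird v u z0 = 0.
  by rewrite !dirdD// dirdN//; ring.
pose K := K1 + K1 + K2 + K3 + K4 + K5.
have bd t : 0 < `|t| < d -> `|q t - S| <= K * `|t|.
  move=> /andP[t0]; rewrite !lt_min.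
  move=> /andP[/andP[/andP[td1 td2] /andP[td3 td4]] /andP[td5 td6]].
  have [h1 _] := H1 t (introT andP (conj t0 td1)).
  have [h2 _] := H2 t (introT andP (conj t0 td2)).
  have [h3 _] := H3 t (introT andP (conj t0 td3)).
  have h4 := H4 t (introT andP (conj t0 td4)).
  have h5 := H5 t (introT andP (conj t0 td5)).
  have [_ /(_ t (introT andP (conj t0 td1)))[h6 _]] := H6 t td6.
  have tn0 : t != 0 by rewrite -normr_gt0.
  set z1 := z0 + toC t *: w in h6 *.
  (* Polarization at the level of differences. *)
  have e1 : odd_diff u z1 v t - odd_diff u z0 v t =
    (odd_diff u z0 (w + v) t - odd_diff u z0 (w - v) t - 2 * odd_diff u z0 v t
     + (even_diff u z0 (w + v) t - even_diff u z0 (w - v) t)) / 2.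
    have := odd_even u z0 (w + v) t; have := odd_even u z0 (w - v) t.
    have -> : z0 + toC t *: (w + v) = z1 + toC t *: v by rewrite scalerDr addrA.
    have -> : z0 + toC t *: (w - v) = z1 - toC t *: v by rewrite scalerBr addrA.
    by rewrite [odd_diff u z1 v t]/odd_diff => -> ->; field.
  set o1 := odd_diff u z1 v t in e1 h6; set o0 := odd_diff u z0 v t in e1 h1.
  set o2 := odd_diff u z0 (w + v) t in e1 h2.
  set o3 := odd_diff u z0 (w - v) t in e1 h3.
  set e4 := even_diff u z0 (w + v) t in e1 h4.
  set e5 := even_diff u z0 (w - v) t in e1 h5.
  set g2 := dird (w + v) u z0 in lin h2; set g3 := dird (w - v) u z0 in lin h3.
  set g0 := dird v u z0 in lin h1 q *; set g1 := dird v u z1 in h6 *.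
  have -> : q t - S = (- (o1 / t - g1) + (o0 / t - g0)) / t
      + ((o2 / t - g2) / 2 - (o3 / t - g3) / 2 - (o0 / t - g0)) / t
      + (e4 / t ^+ 2 - second u (w + v) z0) / 2 - (e5 / t ^+ 2 - second u (w - v) z0) / 2.
    have o1E : o1 = o0 + (o2 - o3 - 2 * o0 + (e4 - e5)) / 2 by rewrite -e1; ring.
    have g2E := lin_solve lin.
    by rewrite /q -/z1 -/g1 o1E /S g2E; field.
  set A := _ - g1 in h6 *; set B := _ - g0 in h1 *.
  set A2 := _ - g2 in h2 *; set A3 := _ - g3 in h3 *.
  set A4 := _ - second _ _ _ in h4 *; set A5 := _ - second _ _ _ in h5 *.
  have -> : (- A + B) / t + (A2 / 2 - A3 / 2 - B) / t + A4 / 2 - A5 / 2 =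
    (- A + A2 / 2 - A3 / 2) / t + A4 / 2 - A5 / 2 by field.
  have ha (x : R) k : `|x| <= k * `|t| ^+ 2 -> `|x / t| <= k * `|t|.
    by rewrite normrM normfV ler_pdivrMr// expr2 mulrA.
  have {h6} h6 := ha _ _ h6; have {h2} h2 := ha _ _ h2; have {h3} h3 := ha _ _ h3.
  have -> : (- A + A2 / 2 - A3 / 2) / t + A4 / 2 - A5 / 2 =
     - (A / t) + (A2 / t) / 2 - (A3 / t) / 2 + A4 / 2 - A5 / 2 by field.
  rewrite (_ : K * `|t| = K1 * `|t| + K1 * `|t| + K2 * `|t| + K3 * `|t| + K4 * `|t|
     + K5 * `|t|); last by rewrite /K !mulrDl.
  exact: five_bound.
have qcvg : q t @[t --> (0 : R)^'] --> S.
  apply/cvgrPdist_le => e e0.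
  have Kp : 0 < `|K| + 1 by rewrite ltr_wpDl.
  have d'0 : 0 < Num.min d (e / (`|K| + 1)) by rewrite lt_min d0 divr_gt0.
  apply: filterS (near0_bound d'0) => t /andP[t0]; rewrite lt_min => /andP[td te].
  rewrite distrC (le_trans (bd t _)) ?t0//.
  move: te; rewrite ltr_pdivlMr// => /ltW; apply: le_trans.
  by rewrite mulrC ler_wpM2l// (le_trans (ler_norm _))// lerDl.
have qfun : (fun t : R => t^-1 *: (((fun t : R => dird v u (z0 + toC t *: w)) \o shift 0)
    (t *: (1 : R)) - dird v u (z0 + toC 0 *: w))) = q.
  apply/funext => t; have t1 : t *: (1 : R) = t by exact: mulr1.
  by rewrite /q /= t1 toC0 scale0r !addr0 [RHS]mulrC.
split; first by rewrite /derivable qfun; apply/cvg_ex; exists S.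
rewrite /dird /derive1.
suff -> : (fun t : R => t^-1 *: (dird v u (z0 + toC (t + 0) *: w) - dird v u (z0 + toC 0 *: w))) = q.
  exact: cvg_lim.
by apply/funext => t; rewrite /q toC0 scale0r !addr0 [RHS]mulrC.
Qed.

Lemma taylor_Ck2 : Ck 2 Om u.
Proof.
split=> // v; split.
  by move=> z Oz; have [K [d [_ _ /nbhs_singleton[]]]] := taylor_dird v (u_taylor Oz).
split; first by move=> z Oz; exact: dird_continuous.
move=> w; split; first by move=> z Oz; have [] := dird_dird v w Oz.
split=> // z Oz.
have c : {for z, continuous (fun z => (second u (w + v) z - second u (w - v) z) / 2)}.
  apply: cvgM; last exact: cvg_cst.
  by apply: cvgB; exact: second_continuous.
move: c; rewrite /prop_for /continuous_at -(dird_dird v w Oz).2 => c.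
apply: cvg_trans c; apply: near_eq_cvg.
near=> y; rewrite (dird_dird v w _).2//.
by near: y; exact: open_nbhs_nbhs.
Unshelve. all: by end_near. Qed.

(** By [dird_dird] the Laplacian along b is half the sum of the second differences
along 2 b and 2 i b, which [taylor_second] makes vanish. *)
Lemma taylor_laplace b z : Om z ->
  dird b (dird b u) z + dird (imag_unit *: b) (dird (imag_unit *: b) u) z = 0.
Proof.
move=> Oz; rewrite !(dird_dird _ _ Oz).2 !subrr.
have [K [d [_ _ /nbhs_singleton[h0 _]]]] := taylor_second (0 : E) (u_taylor Oz).
have [K' [d' [_ _ /nbhs_singleton[h1 _]]]] := taylor_second (b + b) (u_taylor Oz).
move: h0 h1; rewrite scaler0 scalerDr; lra.
Qed.

End TaylorC2.

Section LinearFunctionals.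
Context {R : realType} {E : normedModType (Cplx R)}.
Local Notation C := (Cplx R).

Definition lincomb (cs : seq (R * E)) (u : E -> R) : R := \sum_(i <- cs) i.1 * u i.2.
Definition is_lincomb (Phi : (E -> R) -> R) := exists cs, forall u, Phi u = lincomb cs u.

Lemma is_lincomb_ev z : is_lincomb (fun u => u z).
Proof. by exists [:: (1, z)] => u; rewrite /lincomb big_seq1 mul1r. Qed.

Lemma is_lincombD Phi Psi : is_lincomb Phi -> is_lincomb Psi -> is_lincomb (fun u => Phi u + Psi u).
Proof.
move=> [c1 h1] [c2 h2]; exists (c1 ++ c2) => u.
by rewrite /lincomb big_cat h1 h2.
Qed.

Lemma is_lincombZ c Phi : is_lincomb Phi -> is_lincomb (fun u => c * Phi u).
Proof.
move=> [c1 h1]; exists [seq (c * i.1, i.2) | i <- c1] => u.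
rewrite h1 /lincomb big_map mulr_sumr; apply: eq_bigr => i _.
by rewrite mulrA.
Qed.

Lemma is_lincombZr c Phi : is_lincomb Phi -> is_lincomb (fun u => Phi u * c).
Proof.
by move=> /(is_lincombZ c)[cs h]; exists cs => u; rewrite -h mulrC.
Qed.

Lemma is_lincombB Phi Psi : is_lincomb Phi -> is_lincomb Psi -> is_lincomb (fun u => Phi u - Psi u).
Proof.
move=> h1 h2; have [cs h] := is_lincombD h1 (is_lincombZ (-1) h2).
by exists cs => u; rewrite -h mulN1r.
Qed.

Lemma is_lincomb_sum n (p : nat -> E) :
  is_lincomb (fun u : E -> R => \sum_(j < n) u (p j)).
Proof.
elim: n => [|n [cs IH]]; first by exists [::] => u; rewrite big_ord0 /lincomb big_nil.
exists ((1, p n) :: cs) => u.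
by rewrite big_ord_recr /= IH /lincomb big_cons mul1r addrC.
Qed.

Lemma is_lincomb_even z h t : is_lincomb (fun u => even_diff u z h t).
Proof.
apply: is_lincombZr; apply: is_lincombB; first by apply: is_lincombD; exact: is_lincomb_ev.
by apply: is_lincombZ; exact: is_lincomb_ev.
Qed.

Lemma is_lincomb_odd z h t : is_lincomb (fun u => odd_diff u z h t).
Proof. by apply: is_lincombZr; apply: is_lincombB; exact: is_lincomb_ev. Qed.

(** Satisfied by limits and averages of the family; see [rgreen_dominated] and
[mean_green_dominated]. *)
Definition dominated (Fam : set (E -> R)) (u0 : E -> R) := forall Phi c, is_lincomb Phi ->
  (forall u, Fam u -> `|Phi u| <= c) -> `|Phi u0| <= c.

Lemma dominated_taylor (Fam : set (E -> R)) (u0 : E -> R) z h K d :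
  dominated Fam u0 -> (forall u, Fam u -> taylor_ineqs u z h K d) ->
  taylor_ineqs u0 z h K d.
Proof.
move=> D H t ht; split.
- apply: (D (fun u => even_diff u z h t)) (is_lincomb_even _ _ _) _ => u Fu.
  by have [] := H u Fu t ht.
- apply: (D (fun u => even_diff u z h t + even_diff u z (imag_unit *: h) t)).
    by apply: is_lincombD; exact: is_lincomb_even.
  by move=> u Fu; have [] := H u Fu t ht.
- move=> s hs; split.
    apply: (D (fun u => odd_diff u z h t / t - odd_diff u z h s / s)).
      by apply: is_lincombB; apply: is_lincombZr; exact: is_lincomb_odd.
    by move=> u Fu; have [_ _ /(_ s hs)[]] := H u Fu t ht.
  apply: (D (fun u => even_diff u z h t / t ^+ 2 - even_diff u z h s / s ^+ 2)).
    by apply: is_lincombB; apply: is_lincombZr; exact: is_lincomb_even.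
  by move=> u Fu; have [_ _ /(_ s hs)[]] := H u Fu t ht.
Qed.

(** Substituting x = t, -t, i t, -i t in the expansion, the linear terms cancel in
even differences and the quadratic ones in odd differences, and
Re (be x^2) changes sign when x is multiplied by i. *)
Lemma expansion_taylor (u : E -> R) z h (al be : C) (b c rho : R) :
  rho <= 1 -> 0 <= b -> 0 <= c -> cabs be <= b ->
  (forall x : C, cabs x <= rho ->
     `|u (z + x *: h) - u z - complex.Re (al * x) - complex.Re (be * x ^+ 2)|
        <= c * cabs x ^+ 3) ->
  taylor_ineqs u z h (b + 2 * c) rho.
Proof.
move=> rho1 b0 c0 bb H.
pose A := complex.Re al; pose B := complex.Re be.
have Bb : `|B| <= b by apply: le_trans (cabs_Re _) bb.
have ReM (x : C) (r : R) : complex.Re (x * toC r) = complex.Re x * r.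
  by case: x => p q; rewrite /= mulr0 subr0.
have est t : `|t| <= rho -> [/\ `|u (z + toC t *: h) - u z - A * t - B * t ^+ 2| <= c * `|t| ^+ 3,
    `|u (z - toC t *: h) - u z + A * t - B * t ^+ 2| <= c * `|t| ^+ 3 &
    exists A', `|u (z + toC t *: (imag_unit *: h)) - u z - A' * t + B * t ^+ 2| <= c * `|t| ^+ 3 /\
     `|u (z - toC t *: (imag_unit *: h)) - u z + A' * t + B * t ^+ 2| <= c * `|t| ^+ 3].
  move=> tr.
  have sq : toC t ^+ 2 = toC (t ^+ 2) :> C by rewrite !expr2 toCM.
  have i2 : (imag_unit : C) ^+ 2 = - 1.
    by apply/eqP; rewrite expr2 eq_complex /= !mulr0 !mul0r mulr1 !(sub0r,addr0) oppr0 !eqxx.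
  have ci : cabs (imag_unit : C) = 1 by rewrite cabsE /= expr0n expr1n add0r sqrtr1.
  split.
  - by have := H (toC t); rewrite cabs_toC sq !ReM; exact.
  - by have := H (- toC t); rewrite cabsN cabs_toC sqrrN sq mulrN ReN !ReM scaleNr opprK; exact.
  exists (complex.Re (al * imag_unit)); split.
    have := H (toC t * imag_unit); rewrite cabsM ci mulr1 cabs_toC exprMn sq i2 -scalerA.
    by rewrite mulrN1 mulrN ReN ReM mulrA [al * _ * _]mulrAC ReM opprK; exact.
  have := H (- (toC t * imag_unit)); rewrite cabsN cabsM ci mulr1 cabs_toC sqrrN exprMn sq i2.
  rewrite scaleNr -scalerA.
  by rewrite mulrN1 !mulrN !ReN ReM mulrA [al * _ * _]mulrAC ReM !opprK; exact.
have ev t : `|t| <= rho -> `|even_diff u z h t - B * t ^+ 2| <= c * `|t| ^+ 3.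
  move=> /est[]; rewrite /even_diff !ler_norml => /andP[? ?] /andP[? ?] _.
  by apply/andP; split; lra.
have evi t : `|t| <= rho -> `|even_diff u z (imag_unit *: h) t + B * t ^+ 2| <= c * `|t| ^+ 3.
  move=> /est[_ _ [A' []]]; rewrite /even_diff !ler_norml => /andP[? ?] /andP[? ?].
  by apply/andP; split; lra.
have od t : `|t| <= rho -> `|odd_diff u z h t - A * t| <= c * `|t| ^+ 3.
  move=> /est[]; rewrite /odd_diff !ler_norml => /andP[? ?] /andP[? ?] _.
  by apply/andP; split; lra.
have t32 (t : R) : `|t| <= rho -> `|t| ^+ 3 <= `|t| ^+ 2.
  by move=> tr; rewrite exprS ler_piMl ?exprn_ge0// (le_trans tr).
have odq (t : R) : 0 < `|t| < rho -> `|odd_diff u z h t / t - A| <= c * `|t| ^+ 2.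
  move=> /andP[t0 tr]; have tn0 : t != 0 by rewrite -normr_gt0.
  have -> : odd_diff u z h t / t - A = (odd_diff u z h t - A * t) / t by field.
  rewrite normrM normfV ler_pdivrMr// -mulrA -exprSr; exact: od (ltW tr).
have evq (t : R) : 0 < `|t| < rho -> `|even_diff u z h t / t ^+ 2 - B| <= c * `|t|.
  move=> /andP[t0 tr]; have tn0 : t != 0 by rewrite -normr_gt0.
  have -> : even_diff u z h t / t ^+ 2 - B = (even_diff u z h t - B * t ^+ 2) / t ^+ 2 by field.
  rewrite normrM normfV normrX ler_pdivrMr ?exprn_gt0// -mulrA -exprS; exact: ev (ltW tr).
move=> t ht; have /andP[t0 /ltW tr] := ht; split.
- have h1 := ev t tr; have h2 := t32 t tr.
  have h3 : c * `|t| ^+ 3 <= c * `|t| ^+ 2 by rewrite ler_wpM2l.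
  have h4 : `|B * t ^+ 2| <= b * `|t| ^+ 2 by rewrite normrM normrX ler_wpM2r ?exprn_ge0.
  have h5 : 0 <= c * `|t| ^+ 2 by rewrite mulr_ge0 ?exprn_ge0.
  rewrite -[X in `|X|](subrK (B * t ^+ 2)) (le_trans (ler_normD _ _))// mulrDl.
  by move: h1 h3 h4 h5; lra.
- have h1 := ev t tr; have h2 := evi t tr.
  have h5 : 0 <= b * `|t| ^+ 3 by rewrite mulr_ge0 ?exprn_ge0.
  rewrite mulrDl; move: h1 h2; rewrite !ler_norml => /andP[? ?] /andP[? ?].
  by apply/andP; split; lra.
- move=> s hs; split.
    have h1 := odq t ht; have h2 := odq s hs.
    have h5 : 0 <= (b + c) * (`|t| ^+ 2 + `|s| ^+ 2) by rewrite mulr_ge0 ?addr_ge0 ?exprn_ge0.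
    move: h1 h2 h5; rewrite !ler_norml => /andP[? ?] /andP[? ?] ?.
    by apply/andP; split; lra.
  have h1 := evq t ht; have h2 := evq s hs.
  have h5 : 0 <= (b + c) * (`|t| + `|s|) by rewrite mulr_ge0 ?addr_ge0.
  move: h1 h2 h5; rewrite !ler_norml => /andP[? ?] /andP[? ?] ?.
  by apply/andP; split; lra.
Qed.

End LinearFunctionals.

Section Lines.
Context {R : realType} {E : normedModType (Cplx R)}.
Local Notation C := (Cplx R).

Lemma cvg_line {T : Type} (F : set_system T) {FF : Filter F} (f : T -> C) (a b : E) (z : C) :
  f @ F --> z -> (a + f x *: b) @[x --> F] --> a + z *: b.
Proof.
move=> fz; apply: cvgD; first exact: cvg_cst.
by apply: cvgZ => //; exact: cvg_cst.
Qed.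

Lemma line_continuous (a b : E) (z : C) : {for z, continuous (fun x : C => a + x *: b)}.
Proof. exact: (@cvg_line _ (nbhs z) _ id). Qed.

Lemma dird_line (u : E -> R) (a b : E) (v z : C) :
  dird v (fun zeta : C => u (a + zeta *: b)) z = dird (v *: b) u (a + z *: b).
Proof.
rewrite /dird; congr (derive1 _ _); apply/funext => t.
by rewrite scalerDl addrA scalerA.
Qed.

Lemma Ck_line n (Om : set E) (u : E -> R) (a b : E) :
  Ck n Om u -> Ck n [set zeta : C | Om (a + zeta *: b)] (fun zeta : C => u (a + zeta *: b)).
Proof.
elim: n u => [|n IH] u [cu H].
  split=> // z Oz; apply: continuous_comp; last exact: cu.
  exact: line_continuous.
split=> [z Oz|v].
  apply: continuous_comp; last exact: cu.
  exact: line_continuous.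
have [d1 d2] := H (v *: b); split.
  move=> z Oz; have := d1 _ Oz.
  suff -> : (fun t : R => u (a + z *: b + toC t *: (v *: b))) = (fun t : R => u (a + (z + toC t *: v) *: b)) by [].
  by apply/funext => t; rewrite scalerDl addrA scalerA.
have -> : dird v (fun zeta : C => u (a + zeta *: b)) = (fun zeta : C => dird (v *: b) u (a + zeta *: b)).
  by apply/funext => z; rewrite dird_line.
exact: IH.
Qed.

(** Restriction to complex lines turns directions v into v b, so [taylor_Ck2] and
[taylor_laplace] in E are enough. *)
Lemma taylor_pluriharmonic (Om : set E) (u : E -> R) : open Om ->
  (forall z, Om z -> {for z, continuous u}) -> (forall z, Om z -> taylor_at u z) ->
  pluriharmonic Om u.
Proof.
move=> Oo uc ut; have C2 := taylor_Ck2 Oo uc ut; split=> // a b.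
split; first exact: Ck_line.
move=> z Oz; rewrite /= in Oz.
have e v : dird v (fun zeta : C => u (a + zeta *: b)) = (fun zeta : C => dird (v *: b) u (a + zeta *: b)).
  by apply/funext => y; rewrite dird_line.
by rewrite !e !dird_line scale1r; exact: (taylor_laplace Oo uc ut b Oz).
Qed.

End Lines.

(** * Measurability on the space of sequences *)

Section Measurability.
Context {R : realType} {k : nat}.
Local Notation C := (Cplx R).
Local Notation V := 'rV[C]_k.

Definition cmeas (D : set (@seqC R k)) (f : seqC -> C) :=
  measurable_fun D (fun L => complex.Re (f L)) /\
  measurable_fun D (fun L => complex.Im (f L)).

Lemma cmeas_cst D (c : C) : cmeas D (fun=> c).
Proof. by split; exact: measurable_cst. Qed.

Lemma cmeasD D f g : cmeas D f -> cmeas D g -> cmeas D (fun L => f L + g L).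
Proof.
move=> [f1 f2] [g1 g2]; split.
  rewrite (_ : (fun L => _) = (fun L => complex.Re (f L)) \+ (fun L => complex.Re (g L))).
    exact: measurable_funD.
  by apply/funext => L /=; case: (f L) => ? ?; case: (g L).
rewrite (_ : (fun L => _) = (fun L => complex.Im (f L)) \+ (fun L => complex.Im (g L))).
  exact: measurable_funD.
by apply/funext => L /=; case: (f L) => ? ?; case: (g L).
Qed.

Lemma cmeasM D f g : cmeas D f -> cmeas D g -> cmeas D (fun L => f L * g L).
Proof.
move=> [f1 f2] [g1 g2]; split.
  rewrite (_ : (fun L => _) = (fun L => complex.Re (f L)) \* (fun L => complex.Re (g L))
     \- (fun L => complex.Im (f L)) \* (fun L => complex.Im (g L))).
    by apply: measurable_funB; exact: measurable_funM.
  by apply/funext => L /=; case: (f L) => ? ?; case: (g L).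
rewrite (_ : (fun L => _) = (fun L => complex.Re (f L)) \* (fun L => complex.Im (g L))
     \+ (fun L => complex.Im (f L)) \* (fun L => complex.Re (g L))).
  by apply: measurable_funD; exact: measurable_funM.
by apply/funext => L /=; case: (f L) => ? ?; case: (g L).
Qed.

Lemma cmeasX D f n : cmeas D f -> cmeas D (fun L => f L ^+ n).
Proof.
move=> mf; elim: n => [|n IH]; first exact: cmeas_cst.
rewrite (_ : (fun L => _) = (fun L => f L * f L ^+ n)); first exact: cmeasM.
by apply/funext => L; rewrite exprS.
Qed.

Lemma cmeas_sum D n (f : nat -> seqC -> C) : (forall i, cmeas D (f i)) ->
  cmeas D (fun L => \sum_(i < n) f i L).
Proof.
move=> mf; elim: n => [|n IH].
  rewrite (_ : (fun L => _) = (fun=> 0)); first exact: cmeas_cst.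
  by apply/funext => L; rewrite big_ord0.
rewrite (_ : (fun L => _) = (fun L => \sum_(i < n) f i L + f n L)).
  exact: cmeasD.
by apply/funext => L; rewrite big_ord_recr.
Qed.

Lemma eq_cmeas D f g : (forall L, D L -> f L = g L) -> cmeas D f -> cmeas D g.
Proof.
move=> fg [h1 h2]; split.
  by apply: eq_measurable_fun h1 => L; rewrite inE => DL; rewrite fg.
by apply: eq_measurable_fun h2 => L; rewrite inE => DL; rewrite fg.
Qed.

Lemma borelC_open (U : set V) : open U -> borelC U.
Proof. by move=> Uo; apply: sub_sigma_algebra. Qed.

Lemma borelC_compact (M : set V) : compact M -> borelC M.
Proof.
move=> /(compact_closed (@norm_hausdorff _ _)) Mc.
rewrite -(setCK M) -setTD; apply: sigma_algebraCD.
by apply: borelC_open; rewrite openC.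
Qed.

Lemma measurable_cylinder i (A : set V) : borelC A ->
  measurable [set L : @seqC R k | A (L i)].
Proof. by move=> bA; apply: sub_sigma_algebra; exists i, A. Qed.

Lemma measurable_prodM (M : set V) : compact M -> measurable (@prodM R k M).
Proof.
move=> /borelC_compact bM.
rewrite (_ : prodM M = \bigcap_i [set L : @seqC R k | M (L i)]).
  by apply: bigcap_measurable; [exists 0%N|move=> i _; exact: measurable_cylinder].
by apply/seteqP; split => [L HL i _|L HL i]; [exact: HL|exact: HL].
Qed.

(** Continuity within M without the subspace topology, so that limit lemmas apply. *)
Definition cont_on (M : set V) (f : V -> C) :=
  forall l, M l -> f @ within M (nbhs l) --> f l.

Lemma cont_on_within (M : set V) f :
  {within M, continuous f} -> cont_on M f.
Proof. by move/subspace_continuousP. Qed.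

Lemma cont_on_near (M : set V) f l (O : set C) : cont_on M f -> M l -> open O -> O (f l) ->
  exists U : set V, [/\ open U, U l & forall l', U l' -> M l' -> O (f l')].
Proof.
move=> cf Ml Oo Ofl.
have : nbhs l [set l' | M l' -> O (f l')] by exact: (cf l Ml O (open_nbhs_nbhs (conj Oo Ofl))).
by rewrite nbhsE => -[U [Uo Ul] UH]; exists U.
Qed.

(** Open preimages under f are traces on M of open sets, and M itself is measurable. *)
Lemma cmeas_cont_on (M : set V) f n : compact M -> cont_on M f ->
  cmeas (prodM M) (fun L => f (L n)).
Proof.
move=> cM cf; have mP := measurable_prodM cM.
have gen (g : C -> R) : (forall (a : R), open [set z | a < g z]) ->
    measurable_fun (prodM M) (fun L => g (f (L n))).
  move=> og; apply: (measurability _ (RGenOInfty.measurableE R)).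
  move=> _ [_ [a ->] <-].
  pose W := \bigcup_(U in [set U : set V | open U /\ forall l, U l -> M l -> a < g (f l)]) U.
  have Wo : open W by apply: bigcup_open => U [].
  have -> : prodM M `&` (fun L => g (f (L n))) @^-1` `]a, +oo[%classic
     = prodM M `&` [set L : @seqC R k | W (L n)].
    apply/seteqP; split => L [ML]; rewrite /= in_itv /= ?andbT => h; split => //.
      have [U [Uo Ul UH]] := cont_on_near cf (ML n) (og a) h.
      by exists U => //; split.
    by case: h => U [Uo UH] /UH /(_ (ML n)).
  by apply: measurableI => //; apply: measurable_cylinder; exact: borelC_open.
have oh (g : C -> R) : (forall z w, `|g z - g w| <= cabs (z - w)) -> forall a, open [set z | a < g z].
  move=> lip a; rewrite openE => z /= az; apply/nbhsC_ballP.
  exists (g z - a); first by rewrite subr_gt0.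
  move=> w hw /=; have := lip w z; rewrite ler_norml => /andP[h _].
  by move: hw h; set x := cabs _; lra.
split; apply: gen; apply: oh => z w.
  apply: le_trans (cabs_Re (z - w)).
  by rewrite (_ : complex.Re (z - w) = complex.Re z - complex.Re w)//; case: (z) => ? ?; case: (w).
apply: le_trans (cabs_Im (z - w)).
by rewrite (_ : complex.Im (z - w) = complex.Im z - complex.Im w)//; case: (z) => ? ?; case: (w).
Qed.

Lemma cont_on_bounded (M : set V) f : compact M -> cont_on M f ->
  exists2 b : R, 1 <= b & forall l, M l -> cabs (f l) <= b.
Proof.
move=> /compact_near_coveringP cM cf.
have : \forall b \near +oo%R, M `<=` (fun l => M l -> cabs (f l) <= b).
  apply: (cM R (pinfty_nbhs R) (fun b l => M l -> cabs (f l) <= b)) => // l Ml.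
  have := (iffLR (cvgC_P _ _ _) (cf l Ml)) 1 ltr01; rewrite near_withinE => h.
  near_simpl; exists ([set l' | M l' -> cabs (f l' - f l) < 1], [set b : R | cabs (f l) + 1 < b]).
    split => /=; first exact: h.
    by exists (cabs (f l) + 1); split; first exact: num_real.
  move=> [l' b] [/= h1 h2] Ml'.
  have := cabsD (f l' - f l) (f l); rewrite subrK => h3.
  by have := h1 Ml'; move: h2 h3; lra.
move=> [a [_ H]]; exists (Num.max 1 (a + 1)); first by rewrite le_max lexx.
by move=> l Ml; apply: (H _ _ l Ml Ml); rewrite lt_max orbC ltrDl ltr01.
Qed.

End Measurability.

(** * Families of maps with polynomial growth *)

Section PolyBounds.
Context {R : realType}.
Local Notation C := (Cplx R).

Lemma poly_bound (q : {poly C}) n (b T : R) (y : C) : (size q <= n)%N ->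
  (forall i, cabs q`_i <= b) -> 1 <= T -> cabs y <= T ->
  cabs q.[y] <= n%:R * b * T ^+ n.-1.
Proof.
move=> sq qb T1 yT.
have b0 : 0 <= b by apply: le_trans (qb 0%N); exact: cabs_ge0.
rewrite (horner_coef_wide _ sq) (le_trans (cabs_sum _ _))//.
rewrite -mulrA -[n in n%:R](card_ord n) mulr_natl -sumr_const.
apply: ler_sum => i _; rewrite cabsM cabsX ler_pM ?cabs_ge0 ?exprn_ge0 ?cabs_ge0//.
apply: (@le_trans _ _ (T ^+ i)); first by rewrite lerXn2r ?nnegrE ?cabs_ge0 ?(le_trans ler01).
by rewrite ler_weXn2l//; case: n sq i => [|n] _ [i ni]//=; rewrite -ltnS.
Qed.

(** Factor y^i - y'^i and bound each of the at most n terms by a power of T. *)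
Lemma poly_lip (q : {poly C}) n (b T : R) (y y' : C) : (size q <= n)%N ->
  (forall i, cabs q`_i <= b) -> 1 <= T -> cabs y <= T -> cabs y' <= T ->
  cabs (q.[y] - q.[y']) <= cabs (y - y') * (n%:R * n%:R * b * T ^+ n.-2).
Proof.
move=> sq qb T1 yT yT'.
have T0 : 0 <= T by rewrite (le_trans ler01).
have b0 : 0 <= b by apply: le_trans (qb 0%N); exact: cabs_ge0.
rewrite !(horner_coef_wide _ sq) -sumrB (le_trans (cabs_sum _ _))//.
have -> : cabs (y - y') * (n%:R * n%:R * b * T ^+ n.-2) =
   n%:R * (b * (cabs (y - y') * (n%:R * T ^+ n.-2))) by ring.
rewrite -[n in X in _ <= X%:R * _](card_ord n) mulr_natl -sumr_const.
apply: ler_sum => i _; rewrite -mulrBr cabsM ler_pM ?cabs_ge0//.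
rewrite subrXX cabsM ler_wpM2l ?cabs_ge0// (le_trans (cabs_sum _ _))//.
apply: (@le_trans _ _ (\sum_(j < i) T ^+ n.-2)).
  apply: ler_sum => j _; rewrite cabsM !cabsX.
  apply: (@le_trans _ _ (T ^+ (i.-1 - j) * T ^+ j)).
    rewrite -subn1 -subnDA add1n.
    by rewrite ler_pM ?exprn_ge0 ?cabs_ge0// lerXn2r ?nnegrE ?cabs_ge0.
  case: i j => -[|i] hi [j hj]//=.
  by rewrite -exprD subnK// ler_weXn2l//; move: (hi); clear; case: n => [|[|n]].
rewrite sumr_const card_ord -[leLHS]mulr_natl ler_wpM2r ?exprn_ge0// ler_nat.
by apply: ltnW.
Qed.

End PolyBounds.

Section Tame.
Context {R : realType} {k : nat}.
Local Notation C := (Cplx R).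
Local Notation V := 'rV[C]_k.
Variables (s : bool) (M : set V).
Implicit Types (z w : C * C) (Rad A : R) (F G : V -> C * C -> C * C).

(** The coordinate that a map raises to a power: the second one for Henon maps, the
first one for their inverses.  The flag s lets both signs share all proofs. *)
Definition dominant z : C := if s then z.2 else z.1.
Definition recessive z : C := if s then z.1 else z.2.

Lemma supnE z : supn z = Num.max (cabs (dominant z)) (cabs (recessive z)).
Proof. by rewrite /supn /dominant /recessive; case: s; rewrite // maxC. Qed.

Lemma dominantB z w : dominant (z - w) = dominant z - dominant w.
Proof. by rewrite /dominant; case: s. Qed.
Lemma recessiveB z w : recessive (z - w) = recessive z - recessive w.
Proof. by rewrite /recessive; case: s. Qed.

Lemma supn_dominant z : cabs (dominant z) <= supn z.
Proof. by rewrite supnE le_max lexx. Qed.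
Lemma supn_recessive z : cabs (recessive z) <= supn z.
Proof. by rewrite supnE le_max lexx orbT. Qed.

Lemma cvg_dominant {T : Type} {F : set_system T} {FF : Filter F} (f : T -> C * C) z :
  f @ F --> z -> dominant (f t) @[t --> F] --> dominant z.
Proof.
move=> fz; apply/cvgC_P => e e0; apply: (fz [set w | cabs (dominant w - dominant z) < e]).
apply/nbhsC2_ballP; exists e => // w we /=; rewrite -dominantB.
exact: le_lt_trans (supn_dominant _) we.
Qed.

Lemma cvg_recessive {T : Type} {F : set_system T} {FF : Filter F} (f : T -> C * C) z :
  f @ F --> z -> recessive (f t) @[t --> F] --> recessive z.
Proof.
move=> fz; apply/cvgC_P => e e0; apply: (fz [set w | cabs (recessive w - recessive z) < e]).
apply/nbhsC2_ballP; exists e => // w we /=; rewrite -recessiveB.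
exact: le_lt_trans (supn_recessive _) we.
Qed.

(** Truncating the norm at Rad makes its logarithm nonnegative and comparable to
log^+ of the norm up to an additive constant. *)
Definition tnorm Rad z : R := Num.max Rad (supn z).
(** The classical filtration region of Henon maps, where the dominant coordinate is
large and exceeds the other one. *)
Definition escaped Rad z : bool :=
  (Rad < cabs (dominant z)) && (cabs (recessive z) < cabs (dominant z)).

Lemma tnorm_ge Rad z : Rad <= tnorm Rad z.
Proof. by rewrite le_max lexx. Qed.
Lemma dominant_le_tnorm Rad z : cabs (dominant z) <= tnorm Rad z.
Proof. by rewrite le_max supn_dominant orbT. Qed.
Lemma recessive_le_tnorm Rad z : cabs (recessive z) <= tnorm Rad z.
Proof. by rewrite le_max supn_recessive orbT. Qed.
Lemma tnorm_le Rad z t : Rad <= t -> cabs (dominant z) <= t ->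
  cabs (recessive z) <= t -> tnorm Rad z <= t.
Proof. by move=> *; rewrite /tnorm supnE !ge_max; apply/and3P; split. Qed.

Lemma tnorm_esc Rad z : escaped Rad z -> tnorm Rad z = cabs (dominant z).
Proof.
move=> /andP[h1 h2]; apply/eqP; rewrite eq_le dominant_le_tnorm andbT.
by apply: tnorm_le => //; exact: ltW.
Qed.

Lemma tnorm_nesc Rad z : ~~ escaped Rad z -> tnorm Rad z = Num.max Rad (cabs (recessive z)).
Proof.
rewrite negb_and -!leNgt => h; apply/eqP; rewrite eq_le; apply/andP; split.
  by apply: tnorm_le; rewrite ?le_max ?lexx ?orbT//.
by rewrite ge_max tnorm_ge recessive_le_tnorm.
Qed.

(** The last clause says that the truncated norm cannot grow along an orbit that has
not escaped yet: there it is governed by the recessive coordinate, which is a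
previous dominant one. *)
Definition growth D F Rad A := forall l, M l ->
  [/\ forall z, escaped Rad z -> escaped Rad (F l z),
      forall z, escaped Rad z -> tnorm Rad z ^+ D <= A * tnorm Rad (F l z),
      forall z, tnorm Rad (F l z) <= A * tnorm Rad z ^+ D &
      forall z, ~~ escaped Rad z -> ~~ escaped Rad (F l z) -> tnorm Rad (F l z) <= tnorm Rad z].

(** A Lipschitz condition for relative errors rho with respect to the truncated norm.
Unlike the usual one it has a constant K valid on the whole unbounded escape
region, so it can be iterated. *)
Definition rel_lip_at F Rad B K := forall l z w rho, M l ->
  escaped Rad z || (tnorm Rad z <= B) -> escaped Rad w || (tnorm Rad w <= B) ->
  0 <= rho -> K * rho <= 1 ->
  supn (z - w) <= rho * tnorm Rad z -> supn (z - w) <= rho * tnorm Rad w ->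
  supn (F l z - F l w) <= K * rho * tnorm Rad (F l z) /\
  supn (F l z - F l w) <= K * rho * tnorm Rad (F l w).

Definition rel_lip F Rad := forall B : R, exists2 K : R, 1 <= K & rel_lip_at F Rad B K.

(** Pairs of polynomials of degree at most N, as restrictions of polynomial maps to
complex lines. *)
Definition polycurve N (f : C -> C * C) := exists P Q : {poly C},
  [/\ (size P <= N.+1)%N, (size Q <= N.+1)%N & forall x, f x = (P.[x], Q.[x])].

Definition cmeas2 (psi : @seqC R k -> C * C) :=
  cmeas (prodM M) (fun L => (psi L).1) /\ cmeas (prodM M) (fun L => (psi L).2).

(** All that is used of the maps H_l and of their inverses.  The threshold R0 is left
free in the bounds so that composed maps can share one radius while A does not
depend on it; the radius can then be taken larger than A. *)
Record tame (D : nat) F : Prop := Tame {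
  tame_bounds : exists A R0 : R, [/\ 1 <= A, 1 <= R0 &
    forall Rad, R0 <= Rad -> growth D F Rad A /\ rel_lip F Rad];
  tame_poly : forall l N f, M l -> polycurve N f -> polycurve (D * N) (fun x => F l (f x));
  tame_cont : forall l z, M l ->
    (fun p : V * (C * C) => F p.1 p.2) @ filter_prod (within M (nbhs l)) (nbhs z) --> F l z;
  tame_meas : forall n psi, cmeas2 psi -> cmeas2 (fun L => F (L n) (psi L)) }.

Lemma tame_id : tame 1 (fun _ z => z).
Proof.
split.
- exists 1, 1; split => // Rad hR; split.
    by move=> l Ml; split => // z *; rewrite expr1 mul1r.
  by move=> B; exists 1 => // l z w rho *; rewrite mul1r.
- by move=> l N f Ml; rewrite mul1n.
- by move=> l z Ml; exact: cvg_snd.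
- by [].
Qed.

(** Invariance of the escape region makes the estimates for F applicable to the
values of G; the constants compose as A1 A2^D1 and K1 K2. *)
Lemma tame_comp D1 D2 F G : tame D1 F -> tame D2 G ->
  tame (D1 * D2) (fun l z => F l (G l z)).
Proof.
move=> [[A1 [R1 [A11 R11 H1]]] p1 c1 m1] [[A2 [R2 [A21 R21 H2]]] p2 c2 m2]; split.
- exists (A1 * A2 ^+ D1), (Num.max R1 R2); split.
  + by rewrite mulr_ege1// exprn_ege1.
  + by rewrite le_max R11.
  + move=> Rad; rewrite ge_max => /andP[hR1 hR2].
    have [g1 l1] := H1 Rad hR1; have [g2 l2] := H2 Rad hR2.
    have Rad1 : 1 <= Rad by exact: le_trans hR1.
    have tnorm0 z : 0 <= tnorm Rad z by rewrite (le_trans _ (tnorm_ge _ _))// (le_trans ler01).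
    split.
      move=> l Ml; have [a1 b1 d1 e1] := g1 l Ml; have [a2 b2 d2 e2] := g2 l Ml; split.
      * by move=> z /a2/a1.
      * move=> z ez; rewrite mulnC exprM.
        apply: (@le_trans _ _ ((A2 * tnorm Rad (G l z)) ^+ D1)).
          rewrite lerXn2r ?nnegrE ?exprn_ge0 ?b2//.
          by rewrite mulr_ge0// (le_trans ler01).
        rewrite exprMn mulrAC [A1 * _ * _]mulrC ler_wpM2l ?b1 ?a2//.
        by rewrite exprn_ge0// (le_trans ler01).
      * move=> z; apply: le_trans (d1 _) _; rewrite -mulrA ler_wpM2l ?(le_trans ler01)//.
        rewrite mulnC exprM -exprMn lerXn2r ?nnegrE//.
        by rewrite mulr_ge0 ?exprn_ge0// (le_trans ler01).
      * move=> z nz nz'; have [ez|ez] := boolP (escaped Rad (G l z)).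
          by rewrite a1 in nz'.
        by rewrite (le_trans (e1 _ _ _))// e2.
    move=> B; have [K1 K11 {}l1] := l1 B; have [K2 K21 {}l2] := l2 B.
    have K10 : 0 <= K1 by rewrite (le_trans ler01).
    exists (K1 * K2); first by rewrite mulr_ege1.
    move=> l z w rho Ml hz hw r0 Kr h1 h2.
    have [_ _ _ e2] := g2 l Ml; have [a2 _ _ _] := g2 l Ml.
    have K2r : K2 * rho <= 1.
      apply: le_trans Kr; rewrite -mulrA ler_peMl// mulr_ge0// (le_trans ler01)//.
    have prop x : escaped Rad x || (tnorm Rad x <= B) -> escaped Rad (G l x) || (tnorm Rad (G l x) <= B).
      case/orP => [ex|xB]; first by rewrite a2.
      have [//|nGx] := boolP (escaped Rad (G l x)); rewrite /=.
      have [ex|nx] := boolP (escaped Rad x); first by rewrite a2 in nGx.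
      by rewrite (le_trans (e2 _ _ _)).
    have [h3 h4] := l2 l z w rho Ml hz hw r0 K2r h1 h2.
    have KA : K1 * K2 * rho = K1 * (K2 * rho) by rewrite mulrA.
    rewrite KA in Kr *; apply: l1 => //; try exact: prop.
    by rewrite mulr_ge0// (le_trans ler01).
- by move=> l N f Ml pf; rewrite -mulnA; apply: p1 => //; exact: p2.
- move=> l z Ml.
  apply: (@cvg_comp _ _ _ (fun p : V * (C * C) => (p.1, G p.1 p.2))
    (fun p : V * (C * C) => F p.1 p.2) _ (filter_prod (within M (nbhs l)) (nbhs (G l z)))).
    have hf : (fun p : V * (C * C) => p.1) @ filter_prod (within M (nbhs l)) (nbhs z)
      --> within M (nbhs l) by exact: cvg_fst.
    exact: (cvg_pair hf (c2 l z Ml)).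
  exact: c1.
- by move=> n psi /(m2 n)/(m1 n).
Qed.

Lemma cont_onM (f g : V -> C) : cont_on M f -> cont_on M g -> cont_on M (fun l => f l * g l).
Proof. by move=> cf cg l Ml; apply: cvgM; [exact: cf|exact: cg]. Qed.

Lemma cont_onV (f : V -> C) : cont_on M f -> (forall l, M l -> f l != 0) ->
  cont_on M (fun l => (f l)^-1).
Proof. by move=> cf f0 l Ml; apply: cvgV; [exact: f0|exact: cf]. Qed.

Section Step.
Variables (D : nat) (qs : V -> {poly C}) (cs : V -> C).
Hypothesis cM : compact M.
Hypothesis D2 : (2 <= D)%N.
Hypothesis hsize : forall l, M l -> size (qs l) = D.+1.
Hypothesis hq : forall i, cont_on M (fun l => (qs l)`_i).
Hypothesis hc : cont_on M cs.

(** The common form (y, q(y) - c x) of a Henon map and of its inverse, read in the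
order of coordinates given by s. *)
Definition elem_step l z : C * C :=
  let y := (qs l).[dominant z] - cs l * recessive z in
  if s then (dominant z, y) else (y, dominant z).

Lemma dominant_step l z : dominant (elem_step l z) = (qs l).[dominant z] - cs l * recessive z.
Proof. by rewrite /elem_step /dominant; case: s. Qed.
Lemma recessive_step l z : recessive (elem_step l z) = dominant z.
Proof. by rewrite /elem_step /dominant /recessive; case: s. Qed.

Let coef_bounds : exists2 b : R, 1 <= b & forall l, M l ->
  [/\ forall i, cabs (qs l)`_i <= b, cabs (cs l) <= b & b^-1 <= cabs (qs l)`_D].
Proof.
have [b1 b11 H1] : exists2 b : R, 1 <= b & forall l, M l -> forall i, (i < D.+1)%N -> cabs (qs l)`_i <= b.
  elim: (D.+1) => [|n [b b1 H]]; first by exists 1.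
  have [b' b'1 H'] := cont_on_bounded cM (@hq n).
  exists (Num.max b b'); first by rewrite le_max b1.
  move=> l Ml i; rewrite ltnS leq_eqVlt => /orP[/eqP ->|ni].
    by rewrite le_max H' ?orbT.
  by rewrite le_max H.
have [b2 b21 H2] := cont_on_bounded cM hc.
have lead0 l : M l -> (qs l)`_D != 0.
  move=> Ml; have := hsize Ml => sq.
  have -> : (qs l)`_D = lead_coef (qs l) by rewrite lead_coefE sq.
  by rewrite lead_coef_eq0 -size_poly_eq0 sq.
have [b3 b31 H3] := cont_on_bounded cM (cont_onV (@hq D) lead0).
exists (Num.max b1 (Num.max b2 b3)); first by rewrite le_max b11.
move=> l Ml; split.
- move=> i; have [iD|Di] := ltnP i D.+1; first by rewrite le_max H1.
  by rewrite nth_default ?hsize// cabs0 !le_max (le_trans ler01).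
- by rewrite !le_max H2 ?orbT.
- have := H3 l Ml; rewrite cabsV => h.
  have p0 : 0 < cabs (qs l)`_D by rewrite cabs_gt0 lead0.
  rewrite -[leRHS]invrK lef_pV2 ?posrE ?invr_gt0//.
    by rewrite !le_max h !orbT.
  by rewrite lt_max (lt_le_trans ltr01).
Qed.

(** In the escape region the leading monomial beats all other terms, which are of
order at most |y|^(D - 1). *)
Let elem_step_low (b : R) l z : M l -> 1 <= b ->
  [/\ forall i, cabs (qs l)`_i <= b, cabs (cs l) <= b & b^-1 <= cabs (qs l)`_D] ->
  2 * b ^+ 2 * (D%:R + 1) < cabs (dominant z) -> cabs (recessive z) < cabs (dominant z) ->
  cabs (dominant z) ^+ D <= 2 * b * cabs (dominant (elem_step l z)) /\
  cabs (dominant z) < cabs (dominant (elem_step l z)).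
Proof.
move=> Ml b1 [qb cb qD] zR zx.
set y := cabs (dominant z) in zR zx *.
have b0 : 0 < b by rewrite (lt_le_trans ltr01).
have D1 : 1 <= D%:R + 1 :> R by rewrite lerDr.
have bb : b <= b ^+ 2 by rewrite expr2 ler_peMl// ltW.
have y2b : 2 * b < y.
  apply: le_lt_trans zR; rewrite -mulrA ler_wpM2l//.
  by apply: le_trans bb _; rewrite ler_peMr// exprn_ge0// ltW.
have y1 : 1 <= y by move: y2b b1; lra.
have y0 : 0 < y by rewrite (lt_le_trans ltr01).
set P := y ^+ D.-1.
have yDE : y ^+ D = y * P by rewrite /P -exprS prednK// ltnW.
have P0 : 0 < P by rewrite exprn_gt0.
have yP : y <= P by rewrite /P -[leLHS]expr1 ler_weXn2l//; case: (D) D2 => [|[]].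
rewrite dominant_step; set w := _ - _.
have wlow : b^-1 * y ^+ D - D%:R * b * P - b * P <= cabs w.
  have e : w = (qs l)`_D * dominant z ^+ D + (\poly_(i < D) (qs l)`_i).[dominant z] - cs l * recessive z.
    rewrite /w; congr (_ - _); have sq : (size (qs l) <= D.+1)%N by rewrite hsize.
    by rewrite (horner_coef_wide _ sq) big_ord_recr /= horner_poly addrC.
  have h1 : cabs (\poly_(i < D) (qs l)`_i).[dominant z] <= D%:R * b * P.
    apply: poly_bound => //; rewrite ?size_poly//.
    by move=> i; rewrite coef_poly; case: ifP => // _; rewrite cabs0 ltW.
  have h2 : cabs (cs l * recessive z) <= b * P.
    by rewrite cabsM ler_pM ?cabs_ge0// (le_trans (ltW zx)).
  have h3 : b^-1 * y ^+ D <= cabs ((qs l)`_D * dominant z ^+ D).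
    by rewrite cabsM cabsX ler_wpM2r// exprn_ge0// ltW.
  set X := _ * _ in e h3; set Y := (\poly_(i < D) _).[_] in e h1; set Z := cs l * _ in e h2.
  have : cabs X <= cabs w + cabs Y + cabs Z.
    have -> : X = w - Y + Z by rewrite e; ring.
    by rewrite (le_trans (cabsD _ _))// lerD2r cabsB.
  move: h1 h2 h3; lra.
have key : y ^+ D <= 2 * b * cabs w.
  have h : 2 * b * (b^-1 * y ^+ D - D%:R * b * P - b * P) <= 2 * b * cabs w.
    by rewrite ler_wpM2l// mulr_ge0// ltW.
  apply: le_trans h.
  have -> : 2 * b * (b^-1 * y ^+ D - D%:R * b * P - b * P) =
     y ^+ D + P * (y - 2 * b ^+ 2 * (D%:R + 1)).
    by rewrite yDE; field; rewrite gt_eqF.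
  by rewrite lerDl mulr_ge0 ?subr_ge0 ?(ltW P0) ?(ltW zR).
split=> //.
have : 2 * b * y < 2 * b * cabs w.
  by apply: lt_le_trans key; rewrite yDE [_ * y]mulrC ltr_pM2l// (lt_le_trans y2b).
by rewrite ltr_pM2l// mulr_gt0.
Qed.

Let elem_step_growth : exists A R0 : R, [/\ 1 <= A, 1 <= R0 &
    forall Rad, R0 <= Rad -> growth D elem_step Rad A].
Proof.
have [b b1 H] := coef_bounds.
have b0 : 0 < b by rewrite (lt_le_trans ltr01).
have D0 : 0 <= D%:R :> R by [].
pose A := (D%:R + 2) * b.
have A2b : 2 * b <= A by rewrite /A ler_wpM2r ?lerDr// ltW.
exists A, (2 * b ^+ 2 * (D%:R + 1)); split.
- by move: A2b b1; lra.
- have : 1 <= b ^+ 2 by rewrite exprn_ege1.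
  have : 0 <= b ^+ 2 * D%:R by rewrite mulr_ge0 ?sqr_ge0.
  by rewrite -mulrA mulrDr mulr1; lra.
move=> Rad hR l Ml; have [qb cb qD] := H l Ml.
have b2 : 1 <= b ^+ 2 by rewrite exprn_ege1.
have Rad1 : 1 <= Rad.
  apply: le_trans hR; rewrite -mulrA mulr_ege1 ?mulr_ege1 ?lerDr//; lra.
have low z : escaped Rad z -> cabs (dominant z) ^+ D <= 2 * b * cabs (dominant (elem_step l z)) /\
  cabs (dominant z) < cabs (dominant (elem_step l z)).
  by move=> /andP[h1 h2]; apply: elem_step_low (H l Ml) _ _ => //; exact: le_lt_trans h1.
have tnorm1 z : 1 <= tnorm Rad z by rewrite (le_trans Rad1)// tnorm_ge.
split.
- move=> z ez; have [_ h] := low z ez; rewrite /escaped recessive_step h andbT.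
  by case/andP: ez => h1 _; exact: lt_trans h.
- move=> z ez; rewrite (tnorm_esc ez); have [h _] := low z ez.
  apply: le_trans h _; apply: ler_pM; rewrite ?cabs_ge0 ?mulr_ge0 ?dominant_le_tnorm//; exact: ltW.
- move=> z.
  have mD : tnorm Rad z <= tnorm Rad z ^+ D.
    by rewrite -[leLHS]expr1 ler_weXn2l// ltnW.
  have A1 : 1 <= A by move: A2b b1; lra.
  have up : tnorm Rad z <= A * tnorm Rad z ^+ D.
    by rewrite (le_trans mD)// ler_peMl// exprn_ge0// (le_trans ler01).
  apply: tnorm_le.
  + by rewrite (le_trans (tnorm_ge _ z)).
  + rewrite dominant_step (le_trans (cabsB _ _))//.
    have h1 : cabs (qs l).[dominant z] <= (D.+1)%:R * b * tnorm Rad z ^+ D.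
      by apply: (@poly_bound _ _ D.+1) => //; [rewrite hsize|exact: dominant_le_tnorm].
    have h2 : cabs (cs l * recessive z) <= b * tnorm Rad z ^+ D.
      by rewrite cabsM ler_pM ?cabs_ge0// (le_trans (recessive_le_tnorm Rad z)).
    have -> : A * tnorm Rad z ^+ D = (D.+1)%:R * b * tnorm Rad z ^+ D + b * tnorm Rad z ^+ D.
      by rewrite /A -natr1; ring.
    exact: lerD.
  + by rewrite recessive_step (le_trans (dominant_le_tnorm Rad z)).
- move=> z _ ez; rewrite (tnorm_nesc ez) recessive_step ge_max tnorm_ge dominant_le_tnorm//.
Qed.

Let elem_step_rel_lip Rad A : 1 <= A -> 1 <= Rad -> growth D elem_step Rad A -> rel_lip elem_step Rad.
Proof.
move=> A1 Rad1 gr B; have [b b1 H] := coef_bounds.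
have b0 : 0 <= b by rewrite (le_trans ler01).
pose C1 := (D.+1)%:R * (D.+1)%:R * b * 2 ^+ D.-1 + b + 1.
have C11 : 1 <= C1.
  by rewrite /C1 lerDr addr_ge0// !mulr_ge0// exprn_ge0.
(* T(z)^D is at most A T(F z) at escaped points and |B|^D at bounded ones. *)
pose K := C1 * (A + `|B| ^+ D).
have AB1 : 1 <= A + `|B| ^+ D by rewrite -[1]addr0 lerD// exprn_ge0.
have K1 : 1 <= K by rewrite mulr_ege1.
exists K => //.
have tnorm1 z : 1 <= tnorm Rad z by rewrite (le_trans Rad1)// tnorm_ge.
have half l z w rho : M l -> escaped Rad z || (tnorm Rad z <= B) -> 0 <= rho -> K * rho <= 1 ->
    supn (z - w) <= rho * tnorm Rad z -> supn (elem_step l z - elem_step l w) <= K * rho * tnorm Rad (elem_step l z).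
  move=> Ml hz rho0 Kr hzw; have [qb cb _] := H l Ml.
  have rho1 : rho <= 1 by apply: le_trans Kr; rewrite ler_peMl.
  set m := tnorm Rad z in hz hzw *.
  have m1 : 1 <= m by exact: tnorm1.
  have m0 : 0 <= m by rewrite (le_trans ler01).
  have mD : m <= m ^+ D by rewrite -[leLHS]expr1 ler_weXn2l// ltnW.
  have rm : rho * m <= m by rewrite ler_piMl.
  have dd : cabs (dominant z - dominant w) <= rho * m by rewrite -dominantB (le_trans (supn_dominant _)).
  have cd : cabs (recessive z - recessive w) <= rho * m by rewrite -recessiveB (le_trans (supn_recessive _)).
  have zm : cabs (dominant z) <= m by exact: dominant_le_tnorm.
  have wm : cabs (dominant w) <= 2 * m.
    have -> : dominant w = dominant z - (dominant z - dominant w) by rewrite subKr.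
    by rewrite (le_trans (cabsB _ _))//; move: dd rm zm; lra.
  have mDE : m ^+ D = m * m ^+ D.-1 by rewrite -exprS prednK// ltnW.
  have rmD : rho * m <= rho * m ^+ D by rewrite ler_wpM2l.
  have est : supn (elem_step l z - elem_step l w) <= C1 * (rho * m ^+ D).
    rewrite supnE ge_max dominantB recessiveB !dominant_step !recessive_step; apply/andP; split; last first.
      apply: le_trans dd _; apply: le_trans rmD _.
      by rewrite ler_peMl// mulr_ge0// exprn_ge0.
    have -> : (qs l).[dominant z] - cs l * recessive z - ((qs l).[dominant w] - cs l * recessive w) =
      ((qs l).[dominant z] - (qs l).[dominant w]) - cs l * (recessive z - recessive w) by ring.
    rewrite (le_trans (cabsB _ _))//.
    have h1 : cabs ((qs l).[dominant z] - (qs l).[dominant w]) <=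
       cabs (dominant z - dominant w) * ((D.+1)%:R * (D.+1)%:R * b * (2 * m) ^+ D.-1).
      apply: (@poly_lip _ _ D.+1) => //; first by rewrite hsize.
        by move: m1; lra.
      by move: zm m1; lra.
    have h2 : cabs (dominant z - dominant w) * ((D.+1)%:R * (D.+1)%:R * b * (2 * m) ^+ D.-1) <=
       (rho * m) * ((D.+1)%:R * (D.+1)%:R * b * (2 * m) ^+ D.-1).
      by rewrite ler_wpM2r// !mulr_ge0// exprn_ge0// mulr_ge0.
    have h3 : cabs (cs l * (recessive z - recessive w)) <= b * (rho * m ^+ D).
      by rewrite cabsM ler_pM ?cabs_ge0// (le_trans cd).
    have h4 : (rho * m) * ((D.+1)%:R * (D.+1)%:R * b * (2 * m) ^+ D.-1) =
       (D.+1)%:R * (D.+1)%:R * b * 2 ^+ D.-1 * (rho * m ^+ D).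
      by rewrite exprMn mDE; ring.
    have h5 : 0 <= rho * m ^+ D by rewrite mulr_ge0// exprn_ge0.
    rewrite /C1 !mulrDl mul1r; move: h1 h2 h3 h5; rewrite h4.
    set X1 := cabs _; set X2 := cabs (cs l * _); lra.
  apply: le_trans est _.
  have -> : K * rho * tnorm Rad (elem_step l z) = C1 * (rho * ((A + `|B| ^+ D) * tnorm Rad (elem_step l z))).
    by rewrite /K; ring.
  rewrite ler_wpM2l ?(le_trans ler01)// ler_wpM2l//.
  have mF : 0 <= tnorm Rad (elem_step l z) by rewrite (le_trans ler01).
  case/orP: hz => [ez|mB].
    have [_ g _ _] := gr l Ml; apply: le_trans (g z ez) _.
    by rewrite ler_wpM2r// lerDl exprn_ge0.
  apply: (@le_trans _ _ (`|B| ^+ D)).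
    by rewrite lerXn2r ?nnegrE// (le_trans mB)// ler_norm.
  rewrite mulrDl; apply: (@le_trans _ _ (`|B| ^+ D * tnorm Rad (elem_step l z))).
    by rewrite ler_peMr// exprn_ge0.
  by rewrite lerDr mulr_ge0// (le_trans ler01).
move=> l z w rho Ml hz hw r0 Kr h1 h2; split; first exact: half.
have swap (x y : C * C) : supn (x - y) = supn (y - x).
  by rewrite /supn /= cabsC [cabs (x.2 - _)]cabsC.
by rewrite swap; apply: half => //; rewrite swap.
Qed.

Lemma tame_step : tame D elem_step.
Proof.
split.
- have [A [R0 [A1 R01 H]]] := elem_step_growth.
  exists A, R0; split => // Rad hR; split; first exact: H.
  by apply: elem_step_rel_lip (H _ hR) => //; exact: le_trans hR.
- move=> l N f Ml [P [Q [sP sQ fE]]].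
  pose P1 := if s then Q else P; pose Q1 := if s then P else Q.
  have sP1 : (size P1 <= N.+1)%N by rewrite /P1; case: s.
  have sQ1 : (size Q1 <= N.+1)%N by rewrite /Q1; case: s.
  have dE x : dominant (f x) = P1.[x] by rewrite fE /dominant /P1; case: s.
  have cE x : recessive (f x) = Q1.[x] by rewrite fE /recessive /Q1; case: s.
  pose W := qs l \Po P1 - cs l *: Q1.
  have ND : (N <= D * N)%N by rewrite leq_pmull// ltnW.
  have sW : (size W <= (D * N).+1)%N.
    rewrite (leq_trans (size_polyD _ _))// geq_max size_polyN; apply/andP; split.
      apply: leq_trans (size_comp_poly_leq _ _) _.
      by rewrite hsize// ltnS leq_mul2l -ltnS; apply/orP; right; case: (size P1) sP1.
    by rewrite (leq_trans (size_scale_leq _ _))// (leq_trans sQ1).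
  have sP2 : (size P1 <= (D * N).+1)%N by rewrite (leq_trans sP1).
  have WE x : W.[x] = (qs l).[dominant (f x)] - cs l * recessive (f x).
    by rewrite /W hornerD hornerN hornerZ horner_comp dE cE.
  rewrite /elem_step; case: s WE dE {cE} => WE dE.
    by exists P1, W; split => // x; rewrite WE -dE.
  by exists W, P1; split => // x; rewrite WE -dE.
- move=> l z Ml.
  pose FF := filter_prod (within M (nbhs l)) (nbhs z).
  have c1 : (fun p : V * (C * C) => p.1) @ FF --> within M (nbhs l) by exact: cvg_fst.
  have c2 : (fun p : V * (C * C) => p.2) @ FF --> z by exact: cvg_snd.
  have cd : (fun p : V * (C * C) => dominant p.2) @ FF --> dominant z by exact: (cvg_dominant c2).
  have cc : (fun p : V * (C * C) => recessive p.2) @ FF --> recessive z by exact: (cvg_recessive c2).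
  have ccs : (fun p : V * (C * C) => cs p.1) @ FF --> cs l by exact: (cvg_comp _ _ c1 (hc Ml)).
  have cqs i : (fun p : V * (C * C) => (qs p.1)`_i) @ FF --> (qs l)`_i.
    exact: (cvg_comp _ _ c1 (@hq i l Ml)).
  have cX i : (fun p : V * (C * C) => dominant p.2 ^+ i) @ FF --> dominant z ^+ i.
    elim: i => [|i IH]; first by rewrite expr0; exact: cvg_cst.
    rewrite exprS (_ : (fun p : V * (C * C) => _) = (fun p => dominant p.2 * dominant p.2 ^+ i)).
      exact: (cvgM cd IH).
    by apply/funext => p; rewrite exprS.
  have cy : (fun p : V * (C * C) => (qs p.1).[dominant p.2] - cs p.1 * recessive p.2) @ FF
      --> (qs l).[dominant z] - cs l * recessive z.
    apply: cvgB; last exact: (cvgM ccs cc).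
    have sq l' : M l' -> (size (qs l') <= D.+1)%N by move=> Ml'; rewrite hsize.
    rewrite (horner_coef_wide _ (sq l Ml)).
    have : (fun p : V * (C * C) => \sum_(i < D.+1) (qs p.1)`_i * dominant p.2 ^+ i) @ FF
      --> \sum_(i < D.+1) (qs l)`_i * dominant z ^+ i.
      exact: (@cvgC_sum R _ FF _ D.+1 (fun i p => (qs p.1)`_i * dominant p.2 ^+ i)
         (fun i => (qs l)`_i * dominant z ^+ i) (fun i => cvgM (cqs i) (cX i))).
    apply: cvg_trans; apply: near_eq_cvg.
    exists (M, setT) => /=; first by split; [apply: (@filterS _ (nbhs l) _ setT); [by []|exact: filterT]|exact: filterT].
    by move=> p [Mp _]; rewrite (horner_coef_wide _ (sq _ Mp)).
  by rewrite /elem_step; case: s cd cy => cd cy;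
    [exact: (cvg_pair cd cy)|exact: (cvg_pair cy cd)].
- move=> n psi mpsi.
  have md : cmeas (prodM M) (fun L => dominant (psi L)) by rewrite /dominant; case: s; case: mpsi.
  have mc : cmeas (prodM M) (fun L => recessive (psi L)) by rewrite /recessive; case: s; case: mpsi.
  have my : cmeas (prodM M) (fun L => (qs (L n)).[dominant (psi L)] - cs (L n) * recessive (psi L)).
    apply: (@eq_cmeas _ _ _ (fun L => \sum_(i < D.+1) (qs (L n))`_i * dominant (psi L) ^+ i
       + (- 1) * (cs (L n) * recessive (psi L)))).
      move=> L ML; have sq : (size (qs (L n)) <= D.+1)%N by rewrite hsize//; exact: ML.
      by rewrite (horner_coef_wide _ sq) mulN1r.
    apply: cmeasD.
      apply: (cmeas_sum D.+1 (f := fun i L => (qs (L n))`_i * dominant (psi L) ^+ i)) => i.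
      apply: cmeasM; last exact: cmeasX.
      exact: (cmeas_cont_on n cM (@hq i)).
    apply: cmeasM; first exact: cmeas_cst.
    apply: cmeasM => //.
    exact: (cmeas_cont_on n cM hc).
  by rewrite /elem_step; case: s md my => md my; split.
Qed.

End Step.
End Tame.

Section TameHenon.
Context {R : realType} {k m : nat}.
Local Notation C := (Cplx R).
Local Notation V := 'rV[C]_k.
Variables (M : set V) (d : 'I_m -> nat) (p : 'I_m -> V -> {poly C}) (a : 'I_m -> V -> C).
Hypothesis cM : compact M.
Hypothesis hd : forall j, (2 <= d j)%N.
Hypothesis hp : forall j l, M l -> size (p j l) = (d j).+1.
Hypothesis pc : forall j i, cont_on M (fun l => (p j l)`_i).
Hypothesis ac : forall j, cont_on M (a j).
Hypothesis a0 : forall j l, M l -> a j l != 0.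

Lemma tame_henon1 j : tame true M (d j) (fun l => henon1 (p j l) (a j l)).
Proof. exact: (@tame_step R k true M (d j) (p j) (a j) cM (hd j) (@hp j) (@pc j) (@ac j)). Qed.

(** Dividing by a turns the inverse into an elementary step in which the roles of the
coordinates are exchanged. *)
Lemma tame_henon1_inv j : tame false M (d j) (fun l => henon1_inv (p j l) (a j l)).
Proof.
have -> : (fun l => henon1_inv (p j l) (a j l)) =
    elem_step false (fun l => (a j l)^-1 *: p j l) (fun l => (a j l)^-1).
  apply/funext => l; apply/funext => z.
  by rewrite /henon1_inv /elem_step /dominant /recessive /= hornerZ -mulrBr mulrC.
apply: tame_step => //.
- by move=> l Ml; rewrite size_scale ?hp// invr_eq0 a0.
- move=> i; rewrite (_ : (fun l => _) = (fun l => (a j l)^-1 * (p j l)`_i)).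
    by apply: cont_onM => //; apply: cont_onV => // l Ml; exact: a0.
  by apply/funext => l; rewrite coefZ.
- by apply: cont_onV => // l Ml; exact: a0.
Qed.

Lemma tame_henon s : tame s M (\prod_(j < m) d j) (henon_sign p a s).
Proof.
case: s; rewrite /henon_sign.
  have gen (js : seq 'I_m) : tame true M (\prod_(j <- js) d j)
      (fun l z => foldl (fun w j => henon1 (p j l) (a j l) w) z js).
    elim: js => [|j js IH]; first by rewrite big_nil; exact: tame_id.
    rewrite big_cons mulnC /=.
    exact: (tame_comp IH (tame_henon1 j)).
  by have := gen (enum 'I_m); rewrite big_enum.
have gen (js : seq 'I_m) : tame false M (\prod_(j <- js) d j)
    (fun l z => foldr (fun j w => henon1_inv (p j l) (a j l) w) z js).
  elim: js => [|j js IH]; first by rewrite big_nil; exact: tame_id.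
  rewrite big_cons /=.
  exact: (tame_comp (tame_henon1_inv j) IH).
by have := gen (enum 'I_m); rewrite big_enum.
Qed.

End TameHenon.

(** * Green functions of sequences of maps *)

Section Orbit.
Context {R : realType} {k : nat}.
Local Notation C := (Cplx R).
Local Notation V := 'rV[C]_k.
Variables (s : bool) (M : set V) (D : nat) (F : V -> C * C -> C * C).
Variables (Rad A : R).
Hypothesis D2 : (2 <= D)%N.
Hypothesis A1 : 1 <= A.
Hypothesis RadA : A < Rad.
Hypothesis gr : growth s M D F Rad A.
Hypothesis rl : rel_lip s M F Rad.
Implicit Types (L : nat -> V) (z w : C * C).

Fixpoint orb L n z : C * C := if n is n'.+1 then F (L n') (orb L n' z) else z.

Let Rad1 : 1 < Rad. Proof. exact: le_lt_trans RadA. Qed.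

Let DR : 2 <= D%:R :> R. Proof. by rewrite ler_nat. Qed.
Let DR0 : 0 < D%:R :> R. Proof. by rewrite (lt_le_trans _ DR). Qed.
Let Dn0 n : 0 < D%:R ^+ n :> R. Proof. by rewrite exprn_gt0. Qed.

Lemma tnorm_ge1 z : 1 <= tnorm Rad z.
Proof. by rewrite (le_trans (ltW Rad1))// tnorm_ge. Qed.
Lemma tnorm_gt0 z : 0 < tnorm Rad z.
Proof. by rewrite (lt_le_trans ltr01)// tnorm_ge1. Qed.
Lemma ln_tnorm_ge z : ln Rad <= ln (tnorm Rad z).
Proof. by rewrite ler_ln ?posrE ?tnorm_gt0 ?tnorm_ge// (lt_trans ltr01). Qed.
Lemma lnA_ge0 : 0 <= ln A. Proof. exact: ln_ge0. Qed.
Lemma lnA_lt : ln A < ln Rad.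
Proof. by rewrite ltr_ln ?posrE// (lt_le_trans ltr01)// (ltW Rad1). Qed.
Lemma ln_tnorm_ge0 z : 0 <= ln (tnorm Rad z).
Proof. by rewrite ln_ge0// tnorm_ge1. Qed.

Section FixL.
Variable L : nat -> V.
Hypothesis ML : forall i, M (L i).

Lemma orb_esc n j z : escaped s Rad (orb L n z) -> escaped s Rad (orb L (n + j) z).
Proof.
move=> h; elim: j => [|j IH]; first by rewrite addn0.
by rewrite addnS /=; have [g _ _ _] := gr (ML (n + j)); exact: g.
Qed.

Lemma orb_nesc n z : ~~ escaped s Rad (orb L n z) -> tnorm Rad (orb L n z) <= tnorm Rad z.
Proof.
elim: n => [//|n IH] /= ne; have [g _ _ g4] := gr (ML n).
have nn : ~~ escaped s Rad (orb L n z) by apply: contra ne; exact: g.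
exact: le_trans (g4 _ nn ne) (IH nn).
Qed.

(** The n-th approximation of the Green function. *)
Definition pregreen n z : R := ln (tnorm Rad (orb L n z)) / D%:R ^+ n.

(** Bounds D^(n+1) times the difference of consecutive values of [pregreen] on points
of truncated norm at most B, before and after escape. *)
Definition gap_bound (B : R) : R := ln A + D%:R * ln B.

Lemma gap_bound_ge0 B : 1 <= B -> 0 <= gap_bound B.
Proof. by move=> B1; rewrite addr_ge0 ?lnA_ge0// mulr_ge0 ?ln_ge0// ltW. Qed.

Lemma ln_step_up n z : ln (tnorm Rad (orb L n.+1 z)) <= ln A + D%:R * ln (tnorm Rad (orb L n z)).
Proof.
have [_ _ g3 _] := gr (ML n).
have A0 : 0 < A by exact: lt_le_trans A1.
rewrite mulr_natl -lnXn ?tnorm_gt0// -lnM ?posrE ?exprn_gt0 ?tnorm_gt0//.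
by rewrite ler_ln ?posrE ?mulr_gt0 ?exprn_gt0 ?tnorm_gt0//; exact: g3.
Qed.

Lemma ln_step_esc n z : escaped s Rad (orb L n z) ->
  D%:R * ln (tnorm Rad (orb L n z)) <= ln A + ln (tnorm Rad (orb L n.+1 z)).
Proof.
move=> ez; have [_ g2 _ _] := gr (ML n).
have A0 : 0 < A by exact: lt_le_trans A1.
rewrite mulr_natl -lnXn ?tnorm_gt0// -lnM ?posrE ?tnorm_gt0//.
by rewrite ler_ln ?posrE ?mulr_gt0 ?exprn_gt0 ?tnorm_gt0//; exact: g2.
Qed.

(** If the orbit has escaped at time n, then ln T is multiplied by D up to ln A;
otherwise ln T at time n is still at most ln B. *)
Lemma pregreen_step B n z : tnorm Rad z <= B ->
  `|pregreen n.+1 z - pregreen n z| <= gap_bound B / D%:R ^+ n.+1.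
Proof.
move=> zB.
have B1 : 1 <= B by exact: le_trans (tnorm_ge1 z) zB.
have lB : 0 <= D%:R * ln B by rewrite mulr_ge0 ?ln_ge0// ltW.
have -> : pregreen n.+1 z - pregreen n z =
    (ln (tnorm Rad (orb L n.+1 z)) - D%:R * ln (tnorm Rad (orb L n z))) / D%:R ^+ n.+1.
  rewrite /pregreen exprS; field; by rewrite !gt_eqF.
rewrite normrM normfV (gtr0_norm (Dn0 n.+1)) ler_pM2r ?invr_gt0//.
have h1 := ln_step_up n z.
rewrite ler_norml; apply/andP; split; last by rewrite /gap_bound; move: h1 lB; lra.
have [ez|nz] := boolP (escaped s Rad (orb L n z)).
  by have := ln_step_esc ez; rewrite /gap_bound; move: lB; lra.
have h2 : D%:R * ln (tnorm Rad (orb L n z)) <= D%:R * ln B.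
  rewrite ler_pM2l// ler_ln ?posrE ?tnorm_gt0 ?(lt_le_trans ltr01)//.
  exact: le_trans (orb_nesc nz) zB.
by have := ln_tnorm_ge0 (orb L n.+1 z); have := lnA_ge0; rewrite /gap_bound; move: h2; lra.
Qed.

(** The telescoped form of the geometric series, exact at j = 0, which makes the
induction close. *)
Lemma pregreen_dist B n j z : tnorm Rad z <= B ->
  `|pregreen (n + j) z - pregreen n z| <= gap_bound B / D%:R ^+ n - gap_bound B / D%:R ^+ (n + j).
Proof.
move=> zB; elim: j => [|j IH]; first by rewrite addn0 !subrr normr0.
have B1 : 1 <= B by exact: le_trans (tnorm_ge1 z) zB.
have h := pregreen_step (n + j) zB; rewrite addnS.
have -> : pregreen (n + j).+1 z - pregreen n z =
  (pregreen (n + j).+1 z - pregreen (n + j) z) + (pregreen (n + j) z - pregreen n z) by ring.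
apply: le_trans (ler_normD _ _) _.
have e : 2 * (gap_bound B / D%:R ^+ (n + j).+1) <= gap_bound B / D%:R ^+ (n + j).
  rewrite mulrCA ler_wpM2l ?gap_bound_ge0// exprS invfM mulrA ler_piMl ?invr_ge0 ?(ltW (Dn0 _))//.
  by rewrite ler_pdivrMr// mul1r.
move: h IH e; lra.
Qed.

Lemma pregreen_dist_le B n j z : tnorm Rad z <= B ->
  `|pregreen (n + j) z - pregreen n z| <= gap_bound B / D%:R ^+ n.
Proof.
move=> zB; apply: le_trans (pregreen_dist n j zB) _.
rewrite gerBl divr_ge0 ?(ltW (Dn0 _))// gap_bound_ge0//.
exact: le_trans (tnorm_ge1 z) zB.
Qed.

Lemma divDn_cvg0 (c : R) : c / D%:R ^+ n @[n --> \oo] --> (0 : R).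
Proof.
rewrite -(mulr0 c); apply: cvgM; first exact: cvg_cst.
have : (D%:R^-1 ^+ n) @[n --> \oo] --> (0 : R).
  apply: cvg_expr; rewrite ger0_norm ?invr_ge0 ?(ltW DR0)//.
  by rewrite invf_lt1// (lt_le_trans _ DR)// ltr1n.
by apply: cvg_trans; apply: near_eq_cvg; near=> n; rewrite exprVn.
Unshelve. all: by end_near. Qed.

Definition rgreen z : R := lim (pregreen n z @[n --> \oo]).

Lemma pregreen_cvg z : pregreen n z @[n --> \oo] --> rgreen z.
Proof.
suff : cvg (pregreen n z @[n --> \oo]) by [].
apply/cauchy_cvgP/cauchy_exP => e e0.
have := divDn_cvg0 (gap_bound (tnorm Rad z)).
move=> /cvgrPdist_lt/(_ e e0)[n _ Hn]; exists (pregreen n z).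
exists n => // j /= nj; rewrite /ball /= distrC -(subnKC nj).
apply: le_lt_trans (pregreen_dist_le n (j - n) (lexx _)) _.
have := Hn n (leqnn n); rewrite /= sub0r normrN ger0_norm//.
by rewrite divr_ge0 ?(ltW (Dn0 _))// gap_bound_ge0// tnorm_ge1.
Qed.

Lemma rgreen_dist B n z : tnorm Rad z <= B -> `|rgreen z - pregreen n z| <= gap_bound B / D%:R ^+ n.
Proof.
move=> zB.
have c : `|pregreen (n + j) z - pregreen n z| @[j --> \oo] --> `|rgreen z - pregreen n z|.
  apply: cvg_norm; apply: cvgB; last exact: cvg_cst.
  rewrite (_ : (fun j => pregreen (n + j) z) = (fun j => pregreen (j + n) z)).
    by rewrite (cvg_shiftn n (fun j => pregreen j z)); exact: pregreen_cvg.
  by apply/funext => j; rewrite addnC.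
apply: ler_cvg_to c (@cvg_cst _ (gap_bound B / D%:R ^+ n) nat \oo _) _.
by near=> j; exact: pregreen_dist_le.
Unshelve. all: by end_near. Qed.

Lemma pregreen_ge0 n z : 0 <= pregreen n z.
Proof. by rewrite divr_ge0 ?ln_tnorm_ge0// ltW. Qed.

Lemma rgreen_ge0 z : 0 <= rgreen z.
Proof.
apply: ler_cvg_to (@cvg_cst _ (0 : R) nat \oo _) (pregreen_cvg (z := z)) _.
by near=> n; exact: pregreen_ge0.
Unshelve. all: by end_near. Qed.

(** After escape the sequence corrected by ln A / D^n is nondecreasing. *)
Lemma pregreen_esc n j z : escaped s Rad (orb L n z) ->
  pregreen n z - ln A / D%:R ^+ n <= pregreen (n + j) z - ln A / D%:R ^+ (n + j).
Proof.
move=> ez; elim: j => [|j IH]; first by rewrite addn0.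
apply: le_trans IH _; rewrite addnS.
have h := ln_step_esc (orb_esc j ez).
have -> : pregreen (n + j).+1 z - ln A / D%:R ^+ (n + j).+1 =
   (ln A + ln (tnorm Rad (orb L (n + j).+1 z)) - 2 * ln A) / D%:R ^+ (n + j).+1.
  by rewrite /pregreen; ring.
have -> : pregreen (n + j) z - ln A / D%:R ^+ (n + j) =
   (D%:R * ln (tnorm Rad (orb L (n + j) z)) - D%:R * ln A) / D%:R ^+ (n + j).+1.
  by rewrite /pregreen exprS; field; rewrite !gt_eqF.
rewrite ler_pM2r ?invr_gt0//.
have : 2 * ln A <= D%:R * ln A by rewrite ler_wpM2r// lnA_ge0.
by move: h; lra.
Qed.

Lemma pregreen_esc_low n j z : escaped s Rad (orb L n z) ->
  (ln Rad - ln A) / D%:R ^+ n <= pregreen (n + j) z.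
Proof.
move=> ez; have := pregreen_esc j ez => h.
have h1 : (ln Rad - ln A) / D%:R ^+ n <= pregreen n z - ln A / D%:R ^+ n.
  by rewrite mulrBl lerD2r ler_pM2r ?invr_gt0// ln_tnorm_ge.
have : 0 <= ln A / D%:R ^+ (n + j) by rewrite divr_ge0 ?lnA_ge0// ltW.
by move: h h1; lra.
Qed.

Lemma rgreen_esc n z : escaped s Rad (orb L n z) -> (ln Rad - ln A) / D%:R ^+ n <= rgreen z.
Proof.
move=> ez; apply: ler_cvg_to (@cvg_cst _ ((ln Rad - ln A) / D%:R ^+ n) nat \oo _) (pregreen_cvg (z := z)) _.
by exists n => // j /= nj; rewrite -(subnKC nj); exact: pregreen_esc_low.
Qed.

Lemma esc_low_gt0 n : 0 < (ln Rad - ln A) / D%:R ^+ n.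
Proof. by rewrite divr_gt0// subr_gt0 lnA_lt. Qed.

Lemma rgreen_nesc z : (forall n, ~~ escaped s Rad (orb L n z)) -> rgreen z = 0.
Proof.
move=> H; apply/eqP; rewrite eq_le rgreen_ge0 andbT.
apply: ler_cvg_to (pregreen_cvg (z := z)) (divDn_cvg0 (ln (tnorm Rad z))) _.
near=> n; rewrite /pregreen ler_pM2r ?invr_gt0//.
by rewrite ler_ln ?posrE ?tnorm_gt0 ?orb_nesc.
Unshelve. all: by end_near. Qed.

(** Escape forces ln T to grow at least like D^n times a positive constant. *)
Lemma bounded_orb_nesc z : (exists B : R, forall n, norm2 (orb L n z) <= B) <->
  (forall n, ~~ escaped s Rad (orb L n z)).
Proof.
split=> [[B HB] n|H]; last first.
  exists (2 * tnorm Rad z) => n; apply: le_trans (norm2_supn _) _.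
  by rewrite ler_pM2l// (le_trans _ (orb_nesc (H n)))// le_max lexx orbT.
apply/negP => ez; pose c := (ln Rad - ln A) / D%:R ^+ n.
have c0 : 0 < c by exact: esc_low_gt0.
pose B' := Num.max Rad B.
have mB j : tnorm Rad (orb L j z) <= B'.
  by rewrite ge_max !le_max lexx /= (le_trans (supn_norm2 _) (HB j)) orbT.
have lB j : ln (tnorm Rad (orb L j z)) <= ln B'.
  by rewrite ler_ln ?posrE ?tnorm_gt0// (lt_le_trans (tnorm_gt0 z) (mB 0%N)).
have lB0 : 0 <= ln B' by rewrite (le_trans (ln_tnorm_ge0 z) (lB 0%N)).
have [j hj] : exists j : nat, ln B' / c < j%:R.
  by exists (Num.truncn (ln B' / c)).+1; exact: truncnS_gt.
have := pregreen_esc_low j ez; rewrite -/c /pregreen ler_pdivlMr// => h.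
have h2 : j%:R <= D%:R ^+ (n + j) :> R.
  rewrite -natrX ler_nat (leq_trans (ltnW (ltn_expl j (isT : (1 < 2)%N))))//.
  apply: (@leq_trans (D ^ j)); first by case: (j) => // j'; rewrite leq_exp2r.
  by rewrite leq_pexp2l ?leq_addl// ltnW.
have : c * j%:R <= c * D%:R ^+ (n + j) by rewrite ler_pM2l.
move/(le_trans)/(_ h)/(le_trans)/(_ (lB _)).
by rewrite leNgt mulrC -ltr_pdivrMr// hj.
Qed.

(** The truncated norm and [norm2] have comparable logarithms, so both define the
same Green function. *)
Lemma logp_tnorm z : `|logp (norm2 z) - ln (tnorm Rad z)| <= ln 2 + ln Rad.
Proof.
have ln2 : 0 <= ln 2 :> R by rewrite ln_ge0// ler1n.
have lnR : 0 <= ln Rad by rewrite ln_ge0// ltW.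
have Rad0 : 0 < Rad by rewrite (lt_trans ltr01).
have n0 : 0 <= norm2 z by exact: sqrtr_ge0.
rewrite ler_norml; apply/andP; split.
  suff : ln (tnorm Rad z) <= ln Rad + logp (norm2 z) by move: ln2; lra.
  rewrite /tnorm; case: (leP (supn z) Rad) => h.
    by rewrite lerDl le_max lexx.
  have := supn_norm2 z => h2.
  have : ln (supn z) <= ln (norm2 z).
    by rewrite ler_ln ?posrE// ?(lt_trans Rad0 h)// (lt_le_trans _ h2)// (lt_trans Rad0).
  have : ln (norm2 z) <= logp (norm2 z) by rewrite le_max lexx orbT.
  by move: lnR; lra.
suff : logp (norm2 z) <= ln 2 + ln (tnorm Rad z) by move: lnR; lra.
rewrite /logp ge_max addr_ge0 ?ln_tnorm_ge0//=.
have m0 := tnorm_gt0 z.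
rewrite -lnM ?posrE//.
have h : norm2 z <= 2 * tnorm Rad z.
  by apply: le_trans (norm2_supn z) _; rewrite ler_pM2l// le_max lexx orbT.
have [->|nz] := eqVneq (norm2 z) 0; first by rewrite ln0// lnM ?posrE// addr_ge0 ?ln_tnorm_ge0.
by rewrite ler_ln ?posrE ?mulr_gt0// lt0r nz.
Qed.

Lemma green_lim z : (logp (norm2 (orb L n z)) / (D ^ n)%:R) @[n --> \oo] --> rgreen z.
Proof.
pose c0 := ln 2 + ln Rad.
have c1 : (fun n => pregreen n z - c0 / D%:R ^+ n) @ \oo --> rgreen z.
  by rewrite -[rgreen z]subr0; exact: (cvgB (pregreen_cvg (z := z)) (divDn_cvg0 c0)).
have c2 : (fun n => pregreen n z + c0 / D%:R ^+ n) @ \oo --> rgreen z.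
  by rewrite -[rgreen z]addr0; exact: (cvgD (pregreen_cvg (z := z)) (divDn_cvg0 c0)).
apply: (squeeze_cvgr _ c1 c2); near=> n.
rewrite /pregreen natrX -mulrBl -mulrDl !ler_pM2r ?invr_gt0//.
by have := logp_tnorm (orb L n z); rewrite -/c0 ler_norml => /andP[h1 h2]; apply/andP; split; move: h1 h2; lra.
Unshelve. all: by end_near. Qed.

Lemma tnorm_lip z w : tnorm Rad z <= tnorm Rad w + supn (z - w).
Proof.
rewrite ge_max; apply/andP; split.
  by rewrite (le_trans (tnorm_ge Rad w))// lerDl supn_ge0.
rewrite -{1}(subrK w z) addrC (le_trans (supnD _ _))// lerD2r.
by rewrite le_max lexx orbT.
Qed.

(** Points of truncated norm at most B either stay below B or escape, so the
hypothesis of relative Lipschitz continuity holds along the whole orbit. *)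
Lemma orb_rel_lip B K z w n : 1 <= K -> rel_lip_at s M F Rad B K ->
  tnorm Rad z <= B -> tnorm Rad w <= B -> K ^+ n * supn (z - w) <= 1 ->
  supn (orb L n z - orb L n w) <= K ^+ n * supn (z - w) * tnorm Rad (orb L n z) /\
  supn (orb L n z - orb L n w) <= K ^+ n * supn (z - w) * tnorm Rad (orb L n w).
Proof.
move=> K1 H zB wB; elim: n => [|n IH] Kn.
  by rewrite expr0 mul1r /= !ler_peMr ?supn_ge0 ?tnorm_ge1.
have K0 : 0 <= K by rewrite (le_trans ler01).
have ok x : tnorm Rad x <= B -> escaped s Rad (orb L n x) || (tnorm Rad (orb L n x) <= B).
  move=> xB; have [//|/orb_nesc h] := boolP (escaped s Rad (orb L n x)).
  by rewrite (le_trans h).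
have p0 : 0 <= K ^+ n * supn (z - w) by rewrite mulr_ge0 ?exprn_ge0 ?supn_ge0.
have Kn' : K ^+ n * supn (z - w) <= 1.
  by apply: le_trans Kn; rewrite exprS -mulrA ler_peMl.
have [h1 h2] := IH Kn'.
rewrite /= exprS -[K * K ^+ n * _]mulrA; apply: H => //; rewrite ?ok//.
by rewrite mulrA -exprS.
Qed.

(** As long as the relative error at time n is at most 1, the n-th approximations
differ by at most ln 2 / D^n. *)
Lemma rgreen_close B K z w n : 1 <= K -> rel_lip_at s M F Rad B K ->
  tnorm Rad z <= B -> tnorm Rad w <= B -> K ^+ n * supn (z - w) <= 1 ->
  `|rgreen z - rgreen w| <= (2 * gap_bound B + ln 2) / D%:R ^+ n.
Proof.
move=> K1 H zB wB Kn.
have [h1 h2] := orb_rel_lip K1 H zB wB Kn.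
have half x y : supn (x - y) <= K ^+ n * supn (z - w) * tnorm Rad x ->
    ln (tnorm Rad y) <= ln 2 + ln (tnorm Rad x).
  move=> h; rewrite -lnM ?posrE ?tnorm_gt0// ler_ln ?posrE ?mulr_gt0 ?tnorm_gt0//.
  apply: le_trans (tnorm_lip y x) _; rewrite supnC.
  have : K ^+ n * supn (z - w) * tnorm Rad x <= tnorm Rad x.
    by rewrite ler_piMl// ltW// tnorm_gt0.
  by move: h; lra.
have hh : `|pregreen n z - pregreen n w| <= ln 2 / D%:R ^+ n.
  rewrite /pregreen -mulrBl normrM normfV (gtr0_norm (Dn0 n)) ler_pM2r ?invr_gt0//.
  have e1 := half _ _ h1; rewrite supnC in h2; have e2 := half _ _ h2.
  by rewrite ler_norml; apply/andP; split; move: e1 e2; lra.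
have g1 := rgreen_dist n zB; have g2 := rgreen_dist n wB.
have -> : rgreen z - rgreen w = (rgreen z - pregreen n z) - (rgreen w - pregreen n w)
  + (pregreen n z - pregreen n w) by ring.
apply: le_trans (ler_normD _ _) _.
have := ler_normB (rgreen z - pregreen n z) (rgreen w - pregreen n w).
by rewrite mulrDl -mulrA; move: g1 g2 hh; lra.
Qed.

End FixL.

(** Choose N maximal with K^N delta <= 1 in [rgreen_close]; then D^-N <= 2^-N is at
most 2 delta^(ln 2 / ln K). *)
Lemma rgreen_holder B : 1 <= B -> exists alpha c : R, [/\ 0 < alpha <= 1, 0 <= c &
  forall L, (forall i, M (L i)) -> forall z w, tnorm Rad z <= B -> tnorm Rad w <= B ->
    supn (z - w) <= 1 -> `|rgreen L z - rgreen L w| <= c * supn (z - w) `^ alpha].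
Proof.
(* With K at least 2 the exponent ln 2 / ln K is at most 1. *)
move=> B1; have [K' K'1 H'] := rl B; pose K := K' + 1.
have K2 : 2 <= K by rewrite /K; move: K'1; lra.
have K1 : 1 <= K by move: K2; lra.
have KK : K' <= K by rewrite /K lerDl.
have H : rel_lip_at s M F Rad B K.
  move=> l z w rho Ml hz hw r0 Kr h1 h2.
  have Kr' : K' * rho <= 1 by apply: le_trans Kr; rewrite ler_wpM2r.
  have [h3 h4] := H' l z w rho Ml hz hw r0 Kr' h1 h2.
  have up x : K' * rho * tnorm Rad x <= K * rho * tnorm Rad x.
    by rewrite ler_wpM2r ?(ltW (tnorm_gt0 _))// ler_wpM2r.
  by split; [exact: le_trans h3 (up _)|exact: le_trans h4 (up _)].
have ln2 : 0 < ln 2 :> R by rewrite ln_gt0// ltr1n.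
have lnKp : 0 < ln K by rewrite ln_gt0// (lt_le_trans _ K2)// ltr1n.
have lnK2 : ln 2 <= ln K by rewrite ler_ln ?posrE// (lt_le_trans _ K2).
pose alpha := ln 2 / ln K; pose c := 2 * (2 * gap_bound B + ln 2).
have c0 : 0 <= 2 * gap_bound B + ln 2 by rewrite addr_ge0 ?mulr_ge0 ?gap_bound_ge0// ltW.
exists alpha, c; split.
- by rewrite divr_gt0//= ler_pdivrMr// mul1r.
- by rewrite mulr_ge0.
move=> L ML z w zB wB d1; set dl := supn (z - w) in d1 *.
have dl0 : 0 <= dl by exact: supn_ge0.
have [dl00|dlp] := eqVneq dl 0.
  have -> : z = w by apply/eqP; rewrite -subr_eq0; apply/eqP; exact: supn_eq0.
  by rewrite subrr normr0 mulr_ge0 ?powR_ge0// mulr_ge0.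
have {dlp} dlp : 0 < dl by rewrite lt0r dlp.
have exn : exists n, 1 < K ^+ n * dl.
  exists (Num.truncn dl^-1).+1; rewrite -ltr_pdivrMr// mul1r.
  apply: lt_le_trans (truncnS_gt _) _.
  have : (2 : R) ^+ (Num.truncn dl^-1).+1 <= K ^+ (Num.truncn dl^-1).+1.
    by rewrite lerXn2r ?nnegrE// (le_trans _ K2).
  by apply: le_trans; rewrite -natrX ler_nat ltnW// ltn_expl.
have [N hN minN] := ex_minnP exn.
case: N hN minN => [|N] hN minN; first by move: hN; rewrite expr0 mul1r ltNge d1.
have KN : K ^+ N * dl <= 1 by rewrite leNgt; apply/negP => /minN; rewrite ltnn.
have := rgreen_close ML K1 H zB wB KN => /le_trans; apply.
have DN : (D%:R ^+ N)^-1 <= (2 ^+ N)^-1 :> R.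
  by rewrite lef_pV2 ?posrE ?exprn_gt0// lerXn2r ?nnegrE.
have -> : c * dl `^ alpha = (2 * gap_bound B + ln 2) * (2 * dl `^ alpha) by rewrite /c; ring.
rewrite ler_wpM2l// (le_trans DN)//.
have -> : dl `^ alpha = expR (alpha * ln dl) by rewrite /powR gt_eqF.
have h : - (N.+1%:R * ln 2) <= alpha * ln dl.
  have : 0 < N.+1%:R * ln K + ln dl.
    have Kp : 0 < K by move: K1; lra.
    rewrite mulr_natl -lnXn// -lnM ?posrE ?exprn_gt0// ln_gt0//.
  move=> h; have : 0 <= alpha * (N.+1%:R * ln K + ln dl).
    by rewrite mulr_ge0 ?ltW// divr_gt0.
  have -> : alpha * (N.+1%:R * ln K + ln dl) = N.+1%:R * ln 2 + alpha * ln dl.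
    by rewrite /alpha; field; rewrite gt_eqF.
  lra.
have : expR (- (N.+1%:R * ln 2)) <= expR (alpha * ln dl) by rewrite ler_expR.
rewrite expRN mulr_natl -lnXn// lnK ?posrE ?exprn_gt0//.
rewrite exprS invfM; set X := (2 ^+ N)^-1; set Y := expR _; lra.
Qed.

Hypothesis pf : forall l N f, M l -> polycurve N f -> polycurve (D * N) (fun x => F l (f x)).

Lemma orb_poly L n N f : (forall i, M (L i)) -> polycurve N f ->
  polycurve (D ^ n * N) (fun x => orb L n (f x)).
Proof.
move=> ML fN; elim: n => [|n IH] /=; first by rewrite expn0 mul1n.
by rewrite expnS -mulnA; apply: pf.
Qed.

Lemma line_poly (a b : C * C) : polycurve 1 (fun x : C => a + x *: b).
Proof.
exists (a.1%:P + b.1 *: 'X), (a.2%:P + b.2 *: 'X).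
have sz (u v : C) : (size (u%:P + v *: 'X : {poly C})%R <= 2)%N.
  rewrite (leq_trans (size_polyD _ _))// geq_max.
  rewrite (leq_trans (size_polyC_leq1 _))//=.
  by rewrite (leq_trans (size_scale_leq _ _))// size_polyX.
split; rewrite ?sz// => x.
by rewrite !hornerE /= [b.1 * x]mulrC [b.2 * x]mulrC; case: a => ? ?; case: b.
Qed.

Lemma orb_line L n a b : (forall i, M (L i)) ->
  exists P Q : {poly C}, [/\ (size P <= (D ^ n).+1)%N, (size Q <= (D ^ n).+1)%N &
    forall x : C, orb L n (a + x *: b) = (P.[x], Q.[x])].
Proof. by move=> ML; have := orb_poly n ML (line_poly a b); rewrite muln1. Qed.

(** The n-th approximation is D^-n times the maximum of ln Rad and of the logarithms
of two polynomials.  If the constant realizes the maximum at the center, the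
inequality is clear; otherwise [discrete_submean] applies to the polynomial that
realizes it.  The radius depends on n, hence on eps and L. *)
Lemma rgreen_discrete_submean L a b (c : C) (r eta eps B : R) : (forall i, M (L i)) ->
  0 < r -> 0 < eta -> 0 < eps ->
  (forall x : C, cabs (x - c) <= r + eta -> tnorm Rad (a + x *: b) <= B) ->
  exists r' : R, r < r' < r + eta /\ exists N0, forall N, (N0 <= N)%N ->
    rgreen L (a + c *: b) - eps <= N%:R^-1 * \sum_(j < N) rgreen L (a + circ_pt c r' N j *: b).
Proof.
move=> ML r0 eta0 eps0 HB.
have cB : tnorm Rad (a + c *: b) <= B.
  by apply: HB; rewrite subrr cabs0; move: r0 eta0; lra.
have e3 : 0 < eps / 3 by rewrite divr_gt0.
have [n Hn] : exists n, gap_bound B / D%:R ^+ n <= eps / 3.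
  have := divDn_cvg0 (gap_bound B) => /cvgrPdist_le/(_ _ e3)[n _ /(_ n (leqnn n))] /=.
  by rewrite sub0r normrN => /(le_trans (ler_norm _)); exists n.
have close x : tnorm Rad x <= B -> `|rgreen L x - pregreen L n x| <= eps / 3.
  by move=> xB; apply: le_trans (rgreen_dist ML n xB) Hn.
have [P [Q [_ _ PQ]]] := orb_line n a b ML.
(* The n-th approximation is within eps / 3 of the limit on the whole disc. *)
suff [r' [hr' [N0 HN0]]] : exists r' : R, r < r' < r + eta /\ exists N0, forall N, (N0 <= N)%N ->
    pregreen L n (a + c *: b) - eps / 3 <=
      N%:R^-1 * \sum_(j < N) pregreen L n (a + circ_pt c r' N j *: b).
  exists r'; split => //; exists (maxn N0 1) => N; rewrite geq_max => /andP[hN N1].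
  have := HN0 N hN.
  have Np : 0 < N%:R :> R by rewrite ltr0n.
  have : N%:R^-1 * \sum_(j < N) pregreen L n (a + circ_pt c r' N j *: b) <=
     N%:R^-1 * \sum_(j < N) rgreen L (a + circ_pt c r' N j *: b) + eps / 3.
    rewrite -[eps / 3](mulKf (lt0r_neq0 Np)) -mulrDr ler_pM2l ?invr_gt0//.
    rewrite mulr_natl -[in X in _ *+ X](card_ord N) -sumr_const -big_split /=.
    apply: ler_sum => j _.
    have : tnorm Rad (a + circ_pt c r' N j *: b) <= B.
      apply: HB; rewrite /circ_pt [c + _]addrC addrK cabsM cabs_expi mulr1 cabs_toC.
      by case/andP: hr' => h1 h2; rewrite gtr0_norm ?(lt_trans r0)// ltW.
    by move=> /close; rewrite ler_norml => /andP[h _]; move: h; lra.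
  by have := close _ cB; rewrite ler_norml => /andP[h1 h2]; move: h1 h2; lra.
have [eqR|neR] := eqVneq (tnorm Rad (orb L n (a + c *: b))) Rad.
  exists (r + eta / 2); split; first by apply/andP; split; move: eta0; lra.
  exists 1%N => N N1; have Np : 0 < N%:R :> R by rewrite ltr0n.
  apply: (@le_trans _ _ (pregreen L n (a + c *: b))); first by move: e3; lra.
  rewrite ler_pdivlMl// mulr_natl -[in X in _ *+ X](card_ord N) -sumr_const.
  apply: ler_sum => j _; rewrite /pregreen eqR ler_pM2r ?invr_gt0//; exact: ln_tnorm_ge.
have [f [fc fle]] : exists f : {poly C}, cabs f.[c] = tnorm Rad (orb L n (a + c *: b)) /\
   forall x, cabs f.[x] <= tnorm Rad (orb L n (a + x *: b)).
  have PQle x : cabs P.[x] <= tnorm Rad (orb L n (a + x *: b)) /\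
                cabs Q.[x] <= tnorm Rad (orb L n (a + x *: b)).
    by rewrite PQ /tnorm /supn !le_max !lexx !orbT.
  have mE : tnorm Rad (orb L n (a + c *: b)) = Num.max Rad (Num.max (cabs P.[c]) (cabs Q.[c])).
    by rewrite PQ.
  move: neR; rewrite mE.
  case: (leP Rad (Num.max (cabs P.[c]) (cabs Q.[c]))) => [hR _|]; last by rewrite eqxx.
  case: (leP (cabs P.[c]) (cabs Q.[c])) hR => h hR.
    by exists Q; split => [|x]; [|have [_ ?] := PQle x].
  by exists P; split => [|x]; [|have [? _] := PQle x].
have fc0 : f.[c] != 0 by rewrite -cabs_gt0 fc tnorm_gt0.
pose u x := ln (tnorm Rad (orb L n (a + x *: b))).
have fu x : f.[x] != 0 -> ln (cabs f.[x]) <= u x.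
  by move=> fx; rewrite ler_ln ?posrE ?tnorm_gt0 ?fle// cabs_gt0.
have eps' : 0 < eps / 3 * D%:R ^+ n by rewrite mulr_gt0.
have [r' [hr' [N0 HN0]]] := discrete_submean r0 eta0 eps' fc0 fu.
exists r'; split => //; exists N0 => N hN; have := HN0 N hN.
rewrite fc -(ler_pM2r (x := (D%:R ^+ n)^-1)) ?invr_gt0//.
rewrite mulrBl mulfK ?gt_eqF// -mulrA mulr_suml; apply.
Qed.

Hypothesis cf : forall l z, M l ->
    (fun p : V * (C * C) => F p.1 p.2) @ filter_prod (within M (nbhs l)) (nbhs z) --> F l z.
Hypothesis cM : compact M.

(** Joint continuity of the n-th iterate in the first n parameters and the point. *)
Lemma orb_cylinder L0 n z0 (O : set (C * C)) : (forall i, M (L0 i)) ->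
  nbhs (orb L0 n z0) O -> exists U : nat -> set V,
   [/\ forall i, open (U i), forall i, U i (L0 i) &
    exists2 W, nbhs z0 W & forall L z, (forall i, M (L i)) ->
      (forall i, (i < n)%N -> U i (L i)) -> W z -> O (orb L n z)].
Proof.
move=> ML0; elim: n O => [|n IH] O HO.
  exists (fun=> setT); split => //; first by move=> i; exact: openT.
  by exists O.
have [[A1' O'] /= [nA nO] AO] := cf (z := orb L0 n z0) (ML0 n) HO.
have [U [Uo UL0 [W W0 HW]]] := IH O' nO.
have : nbhs (L0 n) [set l | M l -> A1' l] by exact: nA.
rewrite nbhsE => -[A' [A'o A'L0] A'A].
exists (fun i => if i == n then A' else U i); split.
- by move=> i; case: eqP.
- by move=> i; case: eqP => [->|_].
exists W => // L z ML HL Wz /=.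
apply: (AO (L n, orb L n z)); split => /=.
  by apply: A'A => //; have := HL n (ltnSn n); rewrite eqxx.
apply: HW => // i ni; have := HL i (ltnW ni : (i < n.+1)%N).
by rewrite lt_eqF.
Qed.

Lemma esc_open z : escaped s Rad z -> nbhs z [set w | escaped s Rad w].
Proof.
move=> /andP[h1 h2]; apply/nbhsC2_ballP.
exists (Num.min (cabs (dominant s z) - Rad) ((cabs (dominant s z) - cabs (recessive s z)) / 2)).
  by rewrite lt_min subr_gt0 h1 divr_gt0// subr_gt0.
move=> w; rewrite lt_min => /andP[w1 w2].
have d1 := le_trans (dist_cabs (dominant s w) (dominant s z)) _.
have d2 := le_trans (dist_cabs (recessive s w) (recessive s z)) _.
have := d1 _ (eq_ind _ (fun t => is_true (cabs t <= supn (w - z))) (supn_dominant s (w - z)) _ (dominantB s w z)).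
have := d2 _ (eq_ind _ (fun t => is_true (cabs t <= supn (w - z))) (supn_recessive s (w - z)) _ (recessiveB s w z)).
rewrite !ler_norml => /andP[a1 a2] /andP[b1 b2].
by rewrite /= /escaped; apply/andP; split; move: w1 w2 a1 a2 b1 b2; lra.
Qed.

(** Escape at time n persists near L0 and z0 by [orb_cylinder] and at later times by
invariance.  The space of sequences is compact by Tychonoff's theorem, which gives
a common time. *)
Lemma uniform_escape z0 : (forall L, (forall i, M (L i)) -> exists n, escaped s Rad (orb L n z0)) ->
  exists N, \forall z \near z0, forall L, (forall i, M (L i)) -> escaped s Rad (orb L N z).
Proof.
move=> H.
have cX := @tychonoff nat (fun=> V) (fun=> M) (fun=> cM).
move/compact_near_coveringP : cX => cX.
have := cX (nat * (C * C))%type (filter_prod \oo (nbhs z0))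
  (fun p L => (forall i, M (L i)) -> escaped s Rad (orb L p.1 p.2)) _.
case.
  move=> L0 ML0; have [n0 e0] := H L0 ML0.
  have [U [Uo UL0 [W W0 HW]]] := orb_cylinder ML0 (esc_open e0).
  exists ([set L : prod_topology (fun=> V) | forall i, (i < n0)%N -> U i (L i)],
    [set p : nat * (C * C) | (n0 <= p.1)%N /\ W p.2]).
    split => /=.
      elim: n0 {e0 HW} => [|n IH]; first by apply: filterS filterT.
      have h : nbhs (L0 : prod_topology (fun=> V)) (proj n @^-1` U n).
        exact: (proj_continuous (open_nbhs_nbhs (conj (Uo n) (UL0 n)))).
      apply: filterS2 IH h => L h1 h2 i; rewrite ltnS leq_eqVlt => /orP[/eqP ->//|].
      exact: h1.
    by exists ([set n | (n0 <= n)%N], W) => //=; split => //; exists n0.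
  move=> [L [n z]] /= [HL [n0n Wz]] ML.
  by rewrite -(subnKC n0n); apply: orb_esc => //; exact: HW.
move=> [A' W] /= [[N _ HN] W0] AW.
exists N; apply: filterS W0 => z Wz L ML.
by apply: (AW (N, z)); [split => //=; apply: HN => /=|exact: ML|].
Qed.

(** Where the n-th iterate has escaped, the n-th approximation is D^-n ln|f| with f
a zero-free polynomial of degree at most D^n, so the bounds of [ln_poly_taylor]
are independent of n and of the sequence after division by D^n. *)
Lemma pregreen_taylor z0 (U : set (C * C)) h : nbhs z0 U -> exists K d : R,
  [/\ 0 <= K, 0 < d & \forall z \near z0, forall L n, (forall i, M (L i)) ->
    (forall w, U w -> escaped s Rad (orb L n w)) -> taylor_ineqs (pregreen L n) z h K d].
Proof.
move=> /nbhsC2_ballP[e e0 He].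
(* From points within e / 2 of z0, moving by x h with |x| < sig stays within e. *)
pose sig := e / (2 * (supn h + 1)).
have h1 : 0 < supn h + 1 by rewrite ltr_wpDl// supn_ge0.
have sig0 : 0 < sig by rewrite divr_gt0// mulr_gt0.
pose rho := Num.min 1 (sig / 4).
have rho0 : 0 < rho by rewrite lt_min ltr01 divr_gt0.
exists (1 / sig ^+ 2 + 2 * (26 / sig ^+ 3)), rho; split => //.
  have h2 : 0 <= 1 / sig ^+ 2 by rewrite divr_ge0// exprn_ge0// ltW.
  have h3 : 0 <= 26 / sig ^+ 3 by rewrite divr_ge0// exprn_ge0// ltW.
  by move: h2 h3; lra.
have : nbhs z0 [set z | supn (z - z0) < e / 2].
  by apply/nbhsC2_ballP; exists (e / 2) => //; rewrite divr_gt0.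
apply: filterS => z /= ze L n ML He'.
have inU (x : C) : cabs x < sig -> U (z + x *: h).
  move=> xs; apply: He.
  rewrite (_ : z + x *: h - z0 = (z - z0) + x *: h); last by rewrite addrAC.
  apply: le_lt_trans (supnD _ _) _; rewrite supnZ.
  have : cabs x * supn h <= e / 2.
    have -> : e / 2 = sig * (supn h + 1) by rewrite /sig; field; rewrite gt_eqF.
    by rewrite ler_pM ?cabs_ge0 ?supn_ge0 ?(ltW xs)// lerDl.
  by move: ze; lra.
have [P [Q [sP sQ PQ]]] := orb_line n z h ML.
pose f := if s then Q else P.
have sf : (size f <= (D ^ n).+1)%N by rewrite /f; case: (s).
have fE x : dominant s (orb L n (z + x *: h)) = f.[x] by rewrite PQ /dominant /f; case: (s).
have fesc x : cabs x < sig -> tnorm Rad (orb L n (z + x *: h)) = cabs f.[x].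
  by move=> /inU/He'/tnorm_esc ->; rewrite fE.
have f0 x : cabs x < sig -> f.[x] != 0.
  by move=> xs; rewrite -cabs_gt0 -fesc// tnorm_gt0.
have [al [be [hbe H]]] := ln_poly_taylor sig0 sf f0.
have DnC : toC (D%:R ^+ n) != 0 :> C by rewrite -cabs_gt0 cabs_toC normr_gt0 gt_eqF.
pose iD : R := (D%:R ^+ n)^-1.
have iD0 : 0 < iD by rewrite invr_gt0.
have ReM (x : C) (r : R) : complex.Re (x * toC r) = complex.Re x * r.
  by case: x => p q; rewrite /= mulr0 subr0.
have DDn : (D ^ n)%:R * iD = 1 :> R by rewrite natrX mulfV// gt_eqF.
apply: (@expansion_taylor _ _ _ _ _ (al * toC iD) (be * toC iD)).
- by rewrite ge_min lexx.
- by rewrite divr_ge0// exprn_ge0// ltW.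
- by rewrite divr_ge0// exprn_ge0// ltW.
- rewrite cabsM cabs_toC (gtr0_norm iD0).
  have : cabs be * iD <= (D ^ n)%:R / sig ^+ 2 * iD by rewrite ler_pM2r.
  by rewrite mulrAC DDn.
move=> x xr.
have x4 : cabs x <= sig / 4 by rewrite (le_trans xr)// ge_min lexx orbT.
have xs : cabs x < sig by apply: le_lt_trans x4 _; move: sig0; lra.
have := H x x4.
rewrite ![_ * toC iD * _]mulrAC !ReM /pregreen fesc//.
have -> : tnorm Rad (orb L n z) = cabs f.[0].
  by rewrite -fesc ?cabs0// scale0r addr0.
rewrite -/iD -!mulrBl normrM (gtr0_norm iD0) => hh.
have : `|ln (cabs f.[x]) - ln (cabs f.[0]) - complex.Re (al * x) - complex.Re (be * x ^+ 2)| * iD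
   <= 26 * (D ^ n)%:R / sig ^+ 3 * cabs x ^+ 3 * iD by rewrite ler_pM2r.
move/le_trans; apply.
have -> : 26 * (D ^ n)%:R / sig ^+ 3 * cabs x ^+ 3 * iD =
   ((D ^ n)%:R * iD) * (26 / sig ^+ 3 * cabs x ^+ 3) by ring.
by rewrite DDn mul1r.
Qed.

Lemma lincomb_cvg L cs : (forall i, M (L i)) ->
  lincomb cs (pregreen L n) @[n --> \oo] --> lincomb cs (rgreen L).
Proof.
move=> ML; elim: cs => [|[x z] cs IH].
  rewrite /lincomb big_nil (_ : (fun n => _) = (fun=> 0)); first exact: cvg_cst.
  by apply/funext => n; rewrite big_nil.
rewrite /lincomb big_cons (_ : (fun n => _) = (fun n => x * pregreen L n z + lincomb cs (pregreen L n))).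
  apply: cvgD IH; apply: cvgM; first exact: cvg_cst.
  exact: pregreen_cvg.
by apply/funext => n; rewrite /lincomb big_cons.
Qed.

Lemma rgreen_dominated L N : (forall i, M (L i)) ->
  dominated [set pregreen L n | n in [set n | (N <= n)%N]] (rgreen L).
Proof.
move=> ML Phi c [cs Phics] H; rewrite Phics.
have cc : `|lincomb cs (pregreen L n)| @[n --> \oo] --> `|lincomb cs (rgreen L)|.
  by apply: cvg_norm; exact: lincomb_cvg.
apply: ler_cvg_to cc (@cvg_cst _ c nat \oo _) _.
exists N => // n /= Nn; rewrite -Phics; apply: H.
by exists n.
Qed.

Lemma rgreen_taylor z0 h :
  (forall L, (forall i, M (L i)) -> exists n, escaped s Rad (orb L n z0)) ->
  exists K d : R, [/\ 0 <= K, 0 < d & \forall z \near z0, forall L, (forall i, M (L i)) ->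
    taylor_ineqs (rgreen L) z h K d].
Proof.
move=> /uniform_escape[N HN].
have [K [d [K0 d0 H]]] := pregreen_taylor h HN.
exists K, d; split => //; apply: filterS H => z H L ML.
apply: dominated_taylor (@rgreen_dominated L N ML) _ => _ [n /= Nn <-].
apply: H => // w Hw; rewrite -(subnKC Nn); apply: orb_esc => //; exact: Hw.
Qed.

End Orbit.

(** * Riemann sums and circle means *)

Section RiemannSums.
Context {R : realType}.

Lemma Rintegral_piece (g : R -> R) (x y v eta : R) : continuous g -> x <= y ->
  (forall t, x <= t <= y -> `|g t - v| <= eta) ->
  `|\int[lebesgue_measure]_(t in `]x, y]) g t - v * (y - x)| <= eta * (y - x).
Proof.
move=> cg xy H.
have mD : measurable (`]x, y]%classic : set R) by exact: measurable_itv.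
have muD : lebesgue_measure (`]x, y]%classic : set R) = (y - x)%:E.
  rewrite lebesgue_measure_itv /= lte_fin; case: ltP => [_|yx]; first by rewrite EFinB.
  by have -> : x = y; [apply/eqP; rewrite eq_le xy|rewrite subrr].
have ic (f : R -> R) : continuous f -> lebesgue_measure.-integrable `]x, y] (EFin \o f).
  move=> cf; apply: (@integrableS _ _ _ lebesgue_measure `[x, y]) => //.
    by apply: subset_itvr; rewrite bnd_simp.
  apply: continuous_compact_integrable; first exact: segment_compact.
  exact: continuous_subspaceT.
have ccst (c : R) : continuous (fun _ : R => c) by move=> t; exact: cst_continuous.
have cgv : continuous (fun t => g t - v).
  by move=> t; apply: cvgB; [exact: cg|exact: cvg_cst].
have cstE (c : R) : \int[lebesgue_measure]_(t in `]x, y]) c = c * (y - x).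
  rewrite Rintegral_cst//=; congr (_ * _); first exact: (congr1 fine muD).
rewrite -!cstE -RintegralB//; [|exact: ic|exact: ic].
apply: (le_trans (le_normr_Rintegral _ _)) => //; first exact: ic.
apply: le_Rintegral => //.
- by apply: ic => t; apply: cvg_norm; exact: cgv.
- exact: ic.
- move=> t; rewrite /= in_itv /= => /andP[h1 h2]; apply: H.
  by rewrite (ltW h1).
Qed.

(** The modulus of continuity eta at scale T / N bounds the error on each of the N
pieces. *)
Lemma riemann_sum (g : R -> R) (N : nat) (T eta : R) : continuous g -> (0 < N)%N -> 0 <= T ->
  (forall s t, `|s - t| <= T / N%:R -> `|g s - g t| <= eta) ->
  `|\int[lebesgue_measure]_(t in `[0, T]) g t -
     T / N%:R * \sum_(j < N) g (T * (j%:R / N%:R))| <= eta * T.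
Proof.
move=> cg N0 T0 H.
have NR : 0 < N%:R :> R by rewrite ltr0n.
pose x (j : nat) := T * (j%:R / N%:R).
pose dl := T / N%:R.
have dl0 : 0 <= dl by rewrite divr_ge0.
have xS j : x j.+1 - x j = dl by rewrite /x /dl -natr1; field; rewrite gt_eqF.
have x0 j : 0 <= x j by rewrite mulr_ge0// divr_ge0.
have xle j : x j <= x j.+1 by rewrite -subr_ge0 xS.
have ig a b : lebesgue_measure.-integrable `[a, b] (EFin \o g).
  apply: continuous_compact_integrable; first exact: segment_compact.
  exact: continuous_subspaceT.
have gen j : `|\int[lebesgue_measure]_(t in `[0, x j]) g t - dl * \sum_(i < j) g (x i)|
    <= eta * (j%:R * dl).
  elim: j => [|j IH].
    rewrite /x mul0r mulr0 big_ord0 mulr0 subr0 mul0r mulr0 set_itv1.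
    by rewrite /Rintegral integral_set1 normr0.
  have split : \int[lebesgue_measure]_(t in `[0, x j.+1]) g t =
     \int[lebesgue_measure]_(t in `[0, x j]) g t + \int[lebesgue_measure]_(t in `]x j, x j.+1]) g t.
    have := @Rintegral_itvB R g (BLeft 0) (BRight (x j.+1)) (x j) (ig _ _).
    by rewrite !bnd_simp => /(_ (x0 j) (xle j)) <-; rewrite addrC subrK.
  have piece := @Rintegral_piece g (x j) (x j.+1) (g (x j)) eta cg (xle j) _.
  have {}piece : `|\int[lebesgue_measure]_(t in `]x j, x j.+1]) g t - g (x j) * dl| <= eta * dl.
    rewrite -(xS j); apply: piece => t /andP[t1 t2]; apply: H.
    by rewrite -/dl -(xS j) ger0_norm ?subr_ge0// lerD2r.
  rewrite split big_ord_recr /= mulrDr.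
  have -> : \int[lebesgue_measure]_(t in `[0, x j]) g t + \int[lebesgue_measure]_(t in `]x j, x j.+1]) g t
    - (dl * \sum_(i < j) g (x i) + dl * g (x j)) =
    (\int[lebesgue_measure]_(t in `[0, x j]) g t - dl * \sum_(i < j) g (x i)) +
    (\int[lebesgue_measure]_(t in `]x j, x j.+1]) g t - g (x j) * dl) by ring.
  apply: le_trans (ler_normD _ _) _.
  by rewrite -natr1 mulrDl mul1r mulrDr lerD.
have := gen N; rewrite {1}/x mulfV ?gt_eqF// mulr1.
by rewrite [N%:R * dl]mulrC /dl divfK ?gt_eqF.
Qed.

End RiemannSums.

Section CircleMean.
Context {R : realType}.
Local Notation C := (Cplx R).

Lemma sincos_lip (x y : R) : `|cos x - cos y| <= `|x - y| /\ `|sin x - sin y| <= `|x - y|.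
Proof.
have gen (f df : R -> R) : (forall t : R, is_derive t (1 : R) f (df t)) -> (forall t, `|df t| <= 1) ->
    forall a b, a <= b -> `|f b - f a| <= b - a.
  move=> fd db a b ab.
  have cf : {within `[a, b], continuous f}.
    by apply: derivable_within_continuous => t _; case: (fd t).
  have [c _ ->] := MVT_segment ab (fun t _ => fd t) cf.
  by rewrite normrM [X in _ * X]ger0_norm ?subr_ge0// ler_piMl// subr_ge0.
have sym (f : R -> R) : (forall a b, a <= b -> `|f b - f a| <= b - a) -> `|f x - f y| <= `|x - y|.
  move=> H; case: (leP y x) => xy; first by rewrite [leRHS]ger0_norm ?subr_ge0// H.
  by rewrite distrC [leRHS]distrC [leRHS]ger0_norm ?subr_ge0 ?H// ltW.
split; apply: sym.
  apply: (gen _ (fun t => - sin t)) => t.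
  by rewrite normrN ler_norml sin_geN1 sin_le1.
apply: (gen _ cos) => t.
by rewrite ler_norml cos_geN1 cos_le1.
Qed.

Lemma expi_lip (x y : R) : cabs (expi x - expi y) <= 2 * `|x - y|.
Proof.
have [h1 h2] := sincos_lip x y.
apply: le_trans (cabs_le_ReIm _) _; rewrite /expi /=.
by move: h1 h2; lra.
Qed.

Lemma circle_mean_EFin (u : C -> R) c r :
  continuous (fun t : R => u (c + toC r * expi t)) ->
  circle_mean (fun z => (u z)%:E) c r =
  ((2 * pi)^-1 * \int[lebesgue_measure]_(t in `[0, 2 * pi]) u (c + toC r * expi t))%:E.
Proof.
move=> cu; rewrite /circle_mean EFinM; congr (_ * _)%E.
rewrite /Rintegral fineK//.
apply: integrable_fin_num => //.
apply: continuous_compact_integrable; first exact: segment_compact.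
exact: continuous_subspaceT.
Qed.

Lemma circle_mean_sum (u : C -> R) (c : C) (r eta : R) N : (0 < N)%N ->
  continuous (fun t : R => u (c + toC r * expi t)) ->
  (forall s t, `|s - t| <= 2 * pi / N%:R ->
     `|u (c + toC r * expi s) - u (c + toC r * expi t)| <= eta) ->
  `|(2 * pi)^-1 * \int[lebesgue_measure]_(t in `[0, 2 * pi]) u (c + toC r * expi t)
    - N%:R^-1 * \sum_(j < N) u (circ_pt c r N j)| <= eta.
Proof.
move=> N0 cu H.
have p0 : 0 < 2 * pi :> R by rewrite mulr_gt0// pi_gt0.
have NR : 0 < N%:R :> R by rewrite ltr0n.
have := riemann_sum cu N0 (ltW p0) H.
rewrite -(ler_pM2l (x := (2 * pi)^-1)) ?invr_gt0//.
rewrite -{1}[(2 * pi)^-1]gtr0_norm ?invr_gt0// -normrM mulrBr.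
rewrite [_ * (eta * _)]mulrCA mulVf ?gt_eqF// mulr1 => h.
apply: le_trans h; rewrite le_eqVlt; apply/orP; left; apply/eqP; congr (`|_ - _|).
rewrite [RHS]mulrA; congr (_ * _).
by rewrite mulrA mulVf ?mul1r// gt_eqF.
Qed.

End CircleMean.

(** * The product measure *)

Section Average.
Context {R : realType} {k : nat}.
Local Notation C := (Cplx R).
Local Notation V := 'rV[C]_k.
Variables (M : set V) (P : probability (@seqC R k) R).
Hypothesis cM : compact M.
Hypothesis hP : is_product_measure (normalized_lebesgue M) P.

(** Otherwise the quotient defining the normalized measure would be 0, and the product
formula would fail for the whole space. *)
Let leb0 : fine (lebesgueC M) != 0.
Proof.
have := @hP 1%N (fun=> setT) (fun=> borelC_open openT).
have -> : [set L : nat -> V | forall i, (i < 1)%N -> [set: V] (L i)] = setT.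
  by apply/seteqP; split.
rewrite probability_setT big_ord1 => -[] /eqP; rewrite /normalized_lebesgue setTI => h.
by apply: contraTneq h => ->; rewrite mul0r oner_eq0.
Qed.

Let nuM : normalized_lebesgue M M = 1.
Proof. by rewrite /normalized_lebesgue setIid mulfV. Qed.

(** The product formula gives probability 1 to the sequences whose first n entries
lie in M; let n tend to infinity. *)
Lemma prob_prodM : P (prodM M) = 1%E.
Proof.
have mP := measurable_prodM cM.
have bM := borelC_compact cM.
pose S n := [set L : @seqC R k | forall i, (i < n)%N -> M (L i)].
have PS n : P (S n) = 1%E.
  by rewrite (@hP n (fun=> M) (fun=> bM)) big1 // => i _; exact: nuM.
have mS n : measurable (S n).
  elim: n => [|n IH]; first by rewrite (_ : S 0%N = setT)//; apply/seteqP; split.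
  rewrite (_ : S n.+1 = S n `&` [set L | M (L n)]).
    by apply: measurableI => //; exact: measurable_cylinder.
  apply/seteqP; split => [L h|L [h1 h2] i].
    by split => [i ni|]; [apply: h; exact: ltnW|exact: h].
  by rewrite ltnS leq_eqVlt => /orP[/eqP -> //|]; exact: h1.
have -> : prodM M = \bigcap_n S n.
  apply/seteqP; split => [L h n _ i _|L h i]; first exact: h.
  exact: (h i.+1 I i).
have mbig : measurable (\bigcap_n S n).
  by apply: bigcap_measurable; [exists 0%N|move=> i _; exact: mS].
have c := @nonincreasing_cvg_mu _ _ _ P S _ mS mbig _.
have {}c : (P \o S) x @[x --> \oo] --> P (\bigcap_n S n).
  apply: c; first exact: le_lt_trans (probability_le1 P (mS 0%N)) (ltry _).
  by move=> n m nm; apply/subsetPset => L h i ni; apply: h; exact: leq_trans nm.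
have e : P \o S = cst 1%E by apply/funext => n; exact: PS.
rewrite e in c.
rewrite -(cvg_lim (@ereal_hausdorff R) c) lim_cst//; exact: ereal_hausdorff.
Qed.

(** The product formula has finitely many positive factors, and the sequences with
an entry outside M form a null set. *)
Lemma prob_cylinder n (U : nat -> set V) : (forall i, open (U i)) ->
  (forall i, (0 < lebesgueC (U i `&` M))%E) ->
  (0 < P ([set L | forall i, (i < n)%N -> U i (L i)] `&` prodM M))%E.
Proof.
move=> Uo Upos.
set S := [set L : nat -> V | _].
have PS : (0 < P S)%E.
  rewrite (@hP n U (fun i => borelC_open (Uo i))).
  rewrite lte_fin; apply: prodr_gt0 => i _; rewrite /normalized_lebesgue.
  have Mfin : lebesgueC M \is a fin_num.
    by move: leb0; case: (lebesgueC M) => //=; rewrite eqxx.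
  have UM : (lebesgueC (U i `&` M) <= lebesgueC M)%E.
    apply: ereal_inf_le_tmp => _ [B /= MB <-]; exists B => //=.
    by move=> z [_ /MB].
  have Mpos : (0 < lebesgueC M)%E by exact: lt_le_trans (Upos i) UM.
  have Ufin : lebesgueC (U i `&` M) \is a fin_num.
    rewrite ge0_fin_numE ?(ltW (Upos i))// (le_lt_trans UM)//.
    by rewrite -ge0_fin_numE ?ltW.
  by rewrite divr_gt0// fine_gt0// ?Upos ?Mpos -?ge0_fin_numE ?ltW ?Ufin ?Mfin.
have mS : measurable (S : set (@seqC R k)).
  rewrite (_ : S = \bigcap_(i < n) [set L : @seqC R k | U i (L i)]); last first.
    by apply/seteqP; split => L h i; exact: h.
  apply: fin_bigcap_measurable => // i _; apply: measurable_cylinder; exact: borelC_open.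
have mP := measurable_prodM cM.
have PC : P (~` prodM M) = 0%E.
  by rewrite probability_setC// prob_prodM subee.
rewrite (_ : P _ = P S)//.
have := measureDI P mS mP => ->.
rewrite [X in (X + _)%E](_ : _ = 0%E) ?add0e//.
apply/eqP; rewrite eq_le measure_ge0 andbT -PC.
by apply: le_measure; rewrite ?inE//; [exact: measurableD|exact: measurableC].
Qed.

End Average.

(** * The averaged Green function *)

Fact submean_arith {R : realFieldType} (x1 x2 x3 x4 x5 e : R) : x1 <= x2 + e -> x2 <= x3 + e ->
  `|x4 - x3| <= e -> `|x4 - x5| <= e -> x1 <= x5 + 4 * e.
Proof. by move=> h1 h2; rewrite !ler_norml => /andP[h3 h4] /andP[h5 h6]; lra. Qed.

Fact mean_arith {R : realFieldType} (x1 x2 x3 e : R) : `|x1 - x2| <= e ->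
  - (4 * e) <= x2 - x3 -> x3 <= x1 + 5 * e.
Proof. by rewrite !ler_norml => /andP[h3 h4]; lra. Qed.

Lemma usc_continuous {R : realType} {E : topologicalType} (u : E -> R) :
  (forall z, {for z, continuous u}) -> upper_semicontinuous (fun z => (u z)%:E).
Proof.
move=> cu z x; rewrite -EFinN lte_fin => xu.
have h : 0 < - u z - x by rewrite subr_gt0.
move/cvgrPdist_lt : (cu z) => /(_ _ h) H.
exists [set y | `|u z - u y| < - u z - x] => // y /=.
by rewrite lte_fin ltr_norml => /andP[]; lra.
Qed.

Section AverageGreen.
Context {R : realType} {k : nat}.
Local Notation C := (Cplx R).
Local Notation V := 'rV[C]_k.
Variables (s : bool) (M : set V) (P : probability (@seqC R k) R).
Hypothesis cM : compact M.
Hypothesis hP : is_product_measure (normalized_lebesgue M) P.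
Variables (D : nat) (F : V -> C * C -> C * C) (Rad A : R).
Hypothesis D2 : (2 <= D)%N.
Hypothesis A1 : 1 <= A.
Hypothesis RadA : A < Rad.
Hypothesis gr : growth s M D F Rad A.
Hypothesis rl : rel_lip s M F Rad.
Hypothesis pf : forall l N f, M l -> polycurve N f -> polycurve (D * N) (fun x => F l (f x)).
Hypothesis cf : forall l z, M l ->
    (fun p : V * (C * C) => F p.1 p.2) @ filter_prod (within M (nbhs l)) (nbhs z) --> F l z.
Hypothesis mf : forall n psi, cmeas2 M psi -> cmeas2 M (fun L => F (L n) (psi L)).

Local Notation GL := (rgreen D F Rad).
Local Notation TN := (tnorm Rad).

(** The average Green function in terms of the limits [rgreen]; it agrees with
[average_green]. *)
Definition mean_green (z : C * C) : R := \int[P]_(L in prodM M) GL L z.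

Let mM : measurable (prodM M). Proof. exact: measurable_prodM. Qed.
Let P1 : P (prodM M) = 1%E. Proof. exact: prob_prodM. Qed.
Let Pfin : (P (prodM M) < +oo)%E.
Proof. exact: le_lt_trans (probability_le1 P mM) (ltry _). Qed.

Lemma measurable_cabs (f : @seqC R k -> C) : cmeas (prodM M) f ->
  measurable_fun (prodM M) (fun L => cabs (f L)).
Proof.
move=> [h1 h2].
rewrite (_ : (fun L => _) = (@Num.sqrt R) \o
  ((fun L => complex.Re (f L) ^+ 2) \+ (fun L => complex.Im (f L) ^+ 2))); last first.
  by apply/funext => L /=; rewrite cabsE.
apply: measurableT_comp.
  by apply: continuous_measurable_fun; exact: sqrt_continuous.
by apply: measurable_funD; exact: measurable_funX.
Qed.

Lemma measurable_rgreen z : measurable_fun (prodM M) (fun L => GL L z).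
Proof.
apply: (@measurable_fun_cvg _ (@seqC R k) R (prodM M)
   (fun n L => pregreen D F Rad L n z) (fun L => GL L z)); last first.
  by move=> L ML; exact: (pregreen_cvg D2 A1 RadA gr).
move=> n.
have morb : cmeas2 M (fun L => orb F L n z).
  elim: n => [|n IH]; first by split; exact: cmeas_cst.
  exact: mf.
have [m1 m2] := morb.
rewrite /pregreen (_ : (fun L => _) = (fun x => x / D%:R ^+ n) \o ((@ln R) \o
   (fun L => Num.max Rad (Num.max (cabs (orb F L n z).1) (cabs (orb F L n z).2)))))//.
apply: measurableT_comp; first exact: mulrr_measurable.
apply: measurableT_comp; first exact: measurable_ln.
apply: measurable_maxr; first exact: measurable_cst.
by apply: measurable_maxr; exact: measurable_cabs.
Qed.

Lemma rgreen_bound L z : (forall i, M (L i)) -> `|GL L z| <= ln (TN z) + gap_bound D A (TN z).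
Proof.
move=> ML; have := rgreen_dist D2 A1 RadA gr ML 0 (lexx (TN z)).
rewrite /pregreen expr0 !divr1 /= => h.
have l0 : `|ln (TN z)| = ln (TN z) by rewrite ger0_norm// (ln_tnorm_ge0 A1 RadA).
rewrite -[X in `|X|](subrK (ln (TN z))) (le_trans (ler_normD _ _))//.
by rewrite l0 addrC lerD2l.
Qed.

Lemma integrable_rgreen z : P.-integrable (prodM M) (EFin \o (fun L => GL L z)).
Proof.
apply: measurable_bounded_integrable => //.
- exact: measurable_rgreen.
- exists (ln (TN z) + gap_bound D A (TN z)); split; first exact: num_real.
  by move=> x hx L ML; apply: le_trans (rgreen_bound z ML) (ltW hx).
Qed.

(** The integral over L commutes with finite linear combinations of evaluations. *)
Lemma lincomb_average cs :
  P.-integrable (prodM M) (EFin \o (fun L => lincomb cs (GL L))) /\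
  lincomb cs mean_green = \int[P]_(L in prodM M) lincomb cs (GL L).
Proof.
elim: cs => [|[x z] cs [IH1 IH2]].
  have e : (fun L => lincomb [::] (GL L)) = cst 0.
    by apply/funext => L; rewrite /lincomb big_nil.
  rewrite e; split.
    apply: measurable_bounded_integrable => //.
    by exists 0; split; [exact: num_real|move=> y y0 L _ /=; rewrite normr0 ltW].
  by rewrite /lincomb big_nil Rintegral_cst// mul0r.
have ix : P.-integrable (prodM M) (EFin \o (fun L => x * GL L z)).
  rewrite (_ : _ \o _ = (fun L => x%:E * (EFin \o (fun L => GL L z)) L)%E)//.
  by apply: integrableZl => //; exact: integrable_rgreen.
have e : (fun L => lincomb ((x, z) :: cs) (GL L)) = (fun L => x * GL L z + lincomb cs (GL L)).
  by apply/funext => L; rewrite /lincomb big_cons.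
rewrite e; split.
  exact: (integrableD mM ix IH1).
rewrite /lincomb big_cons /= -/(lincomb cs mean_green) RintegralD// -IH2 RintegralZl//.
exact: integrable_rgreen.
Qed.

Lemma lincomb_mean_green_ge cs (c : R) : (forall L, (forall i, M (L i)) -> c <= lincomb cs (GL L)) ->
  c <= lincomb cs mean_green.
Proof.
move=> H; have [i1 ->] := lincomb_average cs.
have -> : c = \int[P]_(L in prodM M) c.
  rewrite Rintegral_cst//; have := congr1 (fun x => c * fine x) P1.
  by rewrite /= mulr1.
apply: le_Rintegral => //.
apply: measurable_bounded_integrable => //.
by exists `|c|; split; [exact: num_real|move=> y y0 L _ /=; exact: ltW].
Qed.

Lemma is_lincomb_mean_green_ge Phi (c : R) : is_lincomb Phi ->
  (forall L, (forall i, M (L i)) -> c <= Phi (GL L)) -> c <= Phi mean_green.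
Proof.
move=> [cs e] H; rewrite e; apply: lincomb_mean_green_ge => L ML; rewrite -e; exact: H.
Qed.

(** A bound for each L integrates to the same bound, the total mass being 1. *)
Lemma mean_green_dominated : dominated [set GL L | L in [set L | forall i, M (L i)]] mean_green.
Proof.
move=> Phi c lP H.
have H' L : (forall i, M (L i)) -> `|Phi (GL L)| <= c by move=> ML; apply: H; exists L.
rewrite ler_norml; apply/andP; split.
  apply: is_lincomb_mean_green_ge => // L ML; have := H' L ML; rewrite ler_norml => /andP[]//.
have := @is_lincomb_mean_green_ge (fun u => -1 * Phi u) (- c) (is_lincombZ _ lP).
rewrite mulN1r lerN2; apply => L ML.
by rewrite mulN1r lerN2; have := H' L ML; rewrite ler_norml => /andP[].
Qed.

Lemma mean_green_holder B : 1 <= B -> exists alpha c : R, [/\ 0 < alpha <= 1, 0 <= c,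
   (forall L, (forall i, M (L i)) -> forall z w, TN z <= B -> TN w <= B ->
     supn (z - w) <= 1 -> `|GL L z - GL L w| <= c * supn (z - w) `^ alpha) &
   forall z w, TN z <= B -> TN w <= B ->
     supn (z - w) <= 1 -> `|mean_green z - mean_green w| <= c * supn (z - w) `^ alpha].
Proof.
move=> B1; have [alpha [c [ha c0 H]]] := rgreen_holder D2 A1 RadA gr rl B1.
exists alpha, c; split => // z w zB wB zw.
apply: (mean_green_dominated (Phi := fun u => u z - u w)).
  by apply: is_lincombB; exact: is_lincomb_ev.
by move=> _ [L ML <-]; exact: H.
Qed.

(** The Holder constants do not depend on L, hence one modulus of continuity serves
the average and all Green functions. *)
Lemma unif_modulus B e : 0 < e -> exists2 d0 : R, 0 < d0 &
  forall u : C * C -> R, u = mean_green \/ (exists2 L, (forall i, M (L i)) & u = GL L) ->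
  forall z w, TN z <= B -> TN w <= B -> supn (z - w) <= d0 -> `|u z - u w| <= e.
Proof.
move=> e0; have B'1 : 1 <= Num.max 1 B by rewrite le_max lexx.
have [alpha [c [/andP[a0 a1] c0 H1 H2]]] := mean_green_holder B'1.
have c1 : 0 < c + 1 by rewrite ltr_wpDl.
have ec : 0 < e / (c + 1) by rewrite divr_gt0.
exists (Num.min 1 ((e / (c + 1)) `^ alpha^-1)).
  by rewrite lt_min ltr01 powR_gt0.
move=> u hu z w zB wB; rewrite le_min => /andP[d1 d2].
have {}zB : TN z <= Num.max 1 B by rewrite le_max zB orbT.
have {}wB : TN w <= Num.max 1 B by rewrite le_max wB orbT.
have : `|u z - u w| <= c * supn (z - w) `^ alpha.
  by case: hu => [->|[L ML ->]]; [exact: H2|exact: H1].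
move/le_trans; apply.
have : supn (z - w) `^ alpha <= e / (c + 1).
  have -> : e / (c + 1) = ((e / (c + 1)) `^ alpha^-1) `^ alpha.
    by rewrite -powRrM mulVf ?gt_eqF// powRr1// ltW.
  by apply: ge0_ler_powR; rewrite ?nnegrE ?supn_ge0 ?powR_ge0// ltW.
move=> h; apply: (@le_trans _ _ (c * (e / (c + 1)))); first by rewrite ler_wpM2l.
by rewrite mulrA ler_pdivrMr// [e * _]mulrC ler_wpM2r ?lerDl// ltW.
Qed.

Lemma class_continuous (u : C * C -> R) z :
  u = mean_green \/ (exists2 L, (forall i, M (L i)) & u = GL L) -> {for z, continuous u}.
Proof.
move=> hu; apply/cvgrPdist_le => e e0.
have [d0 d00 H] := unif_modulus (TN z + 1) e0.
apply/nbhsC2_ballP; exists (Num.min 1 d0); first by rewrite lt_min ltr01.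
move=> w; rewrite lt_min => /andP[w1 wd].
apply: (H u hu); first by rewrite lerDl.
  by rewrite (le_trans (tnorm_lip Rad w z))// lerD2l ltW.
by rewrite supnC ltW.
Qed.

Lemma mean_green_continuous z : {for z, continuous mean_green}.
Proof. by apply: class_continuous; left. Qed.

Lemma locally_holder_mean_green : locally_holder mean_green.
Proof.
move=> z0; have B1 : 1 <= TN z0 + 1 by rewrite lerDr (le_trans ler01)// (tnorm_ge1 A1 RadA).
have [alpha [c [ha c0 _ H]]] := mean_green_holder B1.
exists alpha, c; split => //; exists [set z | supn (z - z0) < 1 / 2].
  by apply/nbhsC2_ballP; exists (1 / 2) => //; rewrite divr_gt0.
have hB z : supn (z - z0) < 1 / 2 -> TN z <= TN z0 + 1.
  move=> hz; rewrite (le_trans (tnorm_lip Rad z z0))// lerD2l; move: hz; lra.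
move=> z w /= hz hw.
have zw : supn (z - w) <= 1.
  have -> : z - w = (z - z0) + (z0 - w) by rewrite addrA subrK.
  by rewrite (le_trans (supnD _ _))// [supn (z0 - w)]supnC; move: hz hw; lra.
apply: le_trans (H z w (hB _ hz) (hB _ hw) zw) _.
rewrite ler_wpM2l//; case/andP: ha => a0 _.
by apply: ge0_ler_powR; rewrite ?nnegrE ?supn_ge0 ?sqrtr_ge0 ?supn_norm2// ltW.
Qed.

Section OnLine.
Variables (a b : C * C) (c : C) (r : R).
Hypothesis r0 : 0 < r.

Let B := TN (a + c *: b) + (r + 1) * supn b.

Let line_bound (x : C) : cabs (x - c) <= r + 1 -> TN (a + x *: b) <= B.
Proof.
move=> xc; apply: le_trans (tnorm_lip Rad _ (a + c *: b)) _.
rewrite lerD2l (_ : _ - _ = (x - c) *: b); last first.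
  by rewrite opprD addrACA subrr add0r scalerBl.
by rewrite supnZ ler_wpM2r ?supn_ge0.
Qed.

Let dist_line (x y : C) : supn ((a + x *: b) - (a + y *: b)) = cabs (x - y) * supn b.
Proof. by rewrite opprD addrACA subrr add0r -scalerBl supnZ. Qed.

Let on_circ (r' t : R) : 0 < r' -> cabs (c + toC r' * expi t - c) = r'.
Proof. by move=> r'0; rewrite addrAC subrr add0r cabsM cabs_expi mulr1 cabs_toC gtr0_norm. Qed.

Let circ_bound t : TN (a + (c + toC r * expi t) *: b) <= B.
Proof. by apply: line_bound; rewrite on_circ// lerDl. Qed.

Local Notation in_class u := (u = mean_green \/ (exists2 L, (forall i, M (L i)) & u = GL L)).

Let circle_modulus (e : R) : 0 < e -> exists2 d : R, 0 < d & forall u, in_class u ->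
  forall t t', `|t - t'| <= d ->
  `|u (a + (c + toC r * expi t) *: b) - u (a + (c + toC r * expi t') *: b)| <= e.
Proof.
move=> e0; have [d0 d00 H] := unif_modulus B e0.
have p0 : 0 < 2 * r * supn b + 1 by rewrite ltr_wpDl// !mulr_ge0 ?supn_ge0// ltW.
exists (d0 / (2 * r * supn b + 1)); first by rewrite divr_gt0.
move=> u hu t t'; rewrite ler_pdivlMr// => ht.
apply: (H u hu); rewrite ?circ_bound// dist_line.
have -> : c + toC r * expi t - (c + toC r * expi t') = toC r * (expi t - expi t') by ring.
rewrite cabsM cabs_toC gtr0_norm//; apply: le_trans ht.
have h : r * cabs (expi t - expi t') <= r * (2 * `|t - t'|).
  by rewrite ler_pM2l// expi_lip.
apply: (@le_trans _ _ (r * (2 * `|t - t'|) * supn b)).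
  by rewrite ler_wpM2r ?supn_ge0.
have -> : r * (2 * `|t - t'|) * supn b = `|t - t'| * (2 * r * supn b) by ring.
by rewrite ler_wpM2l// lerDl.
Qed.

Let circle_cont u : in_class u -> continuous (fun t : R => u (a + (c + toC r * expi t) *: b)).
Proof.
move=> hu t; apply/cvgrPdist_le => e e0.
have [d d0 H] := circle_modulus e0.
apply/nbhs_ballP; exists d => //= t'; rewrite /ball /= => /ltW; exact: H.
Qed.

Let mean (u : C * C -> R) : R := (2 * pi)^-1 *
  \int[lebesgue_measure]_(t in `[0%R, (2 * pi)%R]) u (a + (c + toC r * expi t) *: b).

Let dmean (r' : R) N (u : C * C -> R) : R := N%:R^-1 * \sum_(j < N) u (a + circ_pt c r' N j *: b).

Let mean_dmean (e : R) : 0 < e -> exists N0, forall N, (N0 < N)%N -> forall u, in_class u ->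
  `|mean u - dmean r N u| <= e.
Proof.
move=> e0; have [d d0 H] := circle_modulus e0.
exists (Num.truncn (2 * pi / d)) => N hN u hu.
have N0 : (0 < N)%N by exact: leq_ltn_trans hN.
have NR : 0 < N%:R :> R by rewrite ltr0n.
apply: (@circle_mean_sum _ (fun x => u (a + x *: b)) c r e N N0 (circle_cont hu)).
move=> t t' tt; apply: H => //; apply: le_trans tt _.
rewrite ler_pdivrMr// [d * _]mulrC -ler_pdivrMr// ltW// (lt_le_trans (truncnS_gt _))//.
by rewrite ler_nat.
Qed.

(** For each L the center value is at most the discrete mean over a circle of radius
r' slightly larger than r, with N points for N large depending on L.  The uniform
modulus of continuity brings the radius back to r and the number of points to a
value N1 + 1 common to all L.  The resulting inequality is a finite linear
combination of evaluations and passes to the average. *)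
Lemma mean_green_submean : mean_green (a + c *: b) <= mean mean_green.
Proof.
(* Each L costs four errors e, and the passage to the circle mean a fifth one. *)
apply/ler_addgt0Pr => e' e'0; pose e := e' / 5.
have e0 : 0 < e by rewrite divr_gt0.
have [N1 HN1] := mean_dmean e0.
have [d0 d00 Hd] := unif_modulus B e0.
pose eta := Num.min 1 (d0 / (supn b + 1)).
have sb : 0 < supn b + 1 by rewrite ltr_wpDl// supn_ge0.
have eta0 : 0 < eta by rewrite lt_min ltr01 divr_gt0.
have GLc L : (forall i, M (L i)) -> GL L (a + c *: b) <= dmean r N1.+1 (GL L) + 4 * e.
  move=> ML; have hL : in_class (GL L) by right; exists L.
  have HB x : cabs (x - c) <= r + eta -> TN (a + x *: b) <= B.
    by move=> h; apply: line_bound; rewrite (le_trans h)// lerD2l ge_min lexx.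
  have [r' [/andP[rr' r'e] [N0 HN0]]] :=
    rgreen_discrete_submean D2 A1 RadA gr pf ML r0 eta0 e0 HB.
  pose N := maxn N0 N1.+1.
  have := HN0 N (leq_maxl _ _); rewrite -/(dmean r' N (GL L)) lerBlDr => h1.
  have r'0 : 0 < r' by exact: lt_trans rr'.
  have NR : 0 < N%:R :> R by rewrite ltr0n (leq_trans _ (leq_maxr _ _)).
  have h2 : dmean r' N (GL L) <= dmean r N (GL L) + e.
    rewrite /dmean -[e](mulKf (lt0r_neq0 NR)) -mulrDr ler_pM2l ?invr_gt0//.
    rewrite mulr_natl -[in X in _ *+ X](card_ord N) -sumr_const -big_split /=.
    apply: ler_sum => j _.
    have : `|GL L (a + circ_pt c r' N j *: b) - GL L (a + circ_pt c r N j *: b)| <= e.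
      apply: (Hd _ hL).
      - by apply: HB; rewrite /circ_pt on_circ// ltW.
      - by apply: HB; rewrite /circ_pt on_circ// lerDl ltW.
      rewrite dist_line.
      have -> : circ_pt c r' N j - circ_pt c r N j = toC (r' - r) * expi (2 * pi * (j%:R / N%:R)).
        by rewrite /circ_pt toCD toCN; ring.
      rewrite cabsM cabs_expi mulr1 cabs_toC gtr0_norm ?subr_gt0//.
      apply: (@le_trans _ _ (eta * supn b)).
        by rewrite ler_wpM2r ?supn_ge0// lerBlDl ltW.
      apply: (@le_trans _ _ (d0 / (supn b + 1) * supn b)).
        by rewrite ler_wpM2r ?supn_ge0// ge_min lexx orbT.
      by rewrite mulrAC ler_pdivrMr// ler_pM2l// lerDl.
    exact: ler_distlDr.
  exact: (submean_arith h1 h2 (HN1 N (leq_maxr _ _) _ hL) (HN1 N1.+1 (ltnSn _) _ hL)).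
have hE : in_class mean_green by left.
have h2 : - (4 * e) <= dmean r N1.+1 mean_green - mean_green (a + c *: b).
  apply: (@is_lincomb_mean_green_ge (fun u => dmean r N1.+1 u - u (a + c *: b))).
    apply: is_lincombB; last exact: is_lincomb_ev.
    by apply: is_lincombZ; exact: (@is_lincomb_sum _ _ _ (fun j => a + circ_pt c r N1.+1 j *: b)).
  by move=> L ML; rewrite lerNl opprB lerBlDl GLc.
have -> : e' = 5 * e by rewrite /e mulrC divfK.
exact: (mean_arith (HN1 N1.+1 (ltnSn _) _ hE) h2).
Qed.

Lemma mean_green_circle_mean :
  ((mean_green (a + c *: b))%:E <= circle_mean (fun x => (mean_green (a + x *: b))%:E) c r)%E.
Proof.
rewrite (@circle_mean_EFin _ (fun x => mean_green (a + x *: b))) ?lee_fin; first exact: mean_green_submean.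
by apply: circle_cont; left.
Qed.

End OnLine.

Lemma plurisubharmonic_mean_green : plurisubharmonic (fun z => (mean_green z)%:E).
Proof.
split; first by move=> z; exact: ltry.
  by apply: usc_continuous; exact: mean_green_continuous.
move=> a b; split; first by move=> z; exact: ltry.
  apply: (@usc_continuous _ _ (fun x : C => mean_green (a + x *: b))) => z.
  apply: continuous_comp; first exact: line_continuous.
  exact: mean_green_continuous.
by move=> c r r0; exact: mean_green_circle_mean.
Qed.

(** Near a point of Om the expansion inequalities hold for all L at once, with the
same constants, and so does the lower bound at a common escape time. *)
Lemma pluriharmonic_mean_green (Om : set (C * C)) : open Om ->
  (forall z, Om z -> forall L, (forall i, M (L i)) -> exists n, escaped s Rad (orb F L n z)) ->
  pluriharmonic Om mean_green /\ (forall z, Om z -> 0 < mean_green z).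
Proof.
move=> Oo H; split.
  apply: taylor_pluriharmonic => //; first by move=> z _; exact: mean_green_continuous.
  move=> z Oz h.
  have [K [d [K0 d0 HK]]] := rgreen_taylor D2 A1 RadA gr pf cf cM h (H z Oz).
  exists K, d; split => //; apply: filterS HK => w HK.
  by apply: dominated_taylor mean_green_dominated _ => _ [L ML <-]; exact: HK.
move=> z Oz; have [N HN] := uniform_escape gr cf cM (H z Oz).
have {}HN := nbhs_singleton HN.
apply: (lt_le_trans (esc_low_gt0 D2 A1 RadA N)).
apply: (is_lincomb_mean_green_ge (is_lincomb_ev z)) => L ML.
by apply: (rgreen_esc D2 A1 RadA gr ML); exact: HN.
Qed.

Lemma mean_green_zero z : (forall L, (forall i, M (L i)) -> GL L z = 0) -> mean_green z = 0.
Proof.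
move=> H; apply/eqP; rewrite -normr_le0.
by apply: (mean_green_dominated (is_lincomb_ev z)) => _ [L ML <-]; rewrite H// normr0.
Qed.

(** Sequences close to L0 in their first n entries escape at time n as well; they
have positive probability and contribute at least the lower bound of
[rgreen_esc]. *)
Lemma mean_green_gt0 z L0 n : (forall U : set V, open U -> U `&` M !=set0 -> (0 < lebesgueC (U `&` M))%E) ->
  (forall i, M (L0 i)) -> escaped s Rad (orb F L0 n z) -> 0 < mean_green z.
Proof.
move=> full ML0 ez.
have [U [Uo UL0 [W W0 HW]]] := orb_cylinder cf ML0 (esc_open ez).
have Upos i : (0 < lebesgueC (U i `&` M))%E by apply: full => //; exists (L0 i).
have := prob_cylinder cM hP n Uo Upos.
set S := [set L : nat -> V | _] => PS.
have mS : measurable (S : set (@seqC R k)).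
  rewrite (_ : S = \bigcap_(i < n) [set L : @seqC R k | U i (L i)]); last first.
    by apply/seteqP; split => L h i; exact: h.
  apply: fin_bigcap_measurable => // i _; apply: measurable_cylinder; exact: borelC_open.
pose e := (ln Rad - ln A) / D%:R ^+ n.
have e0 : 0 < e by exact: esc_low_gt0.
have low L : (S `&` prodM M) L -> e <= GL L z.
  move=> [SL ML]; apply: (rgreen_esc D2 A1 RadA gr ML); apply: HW => //; exact: nbhs_singleton.
have mSM : measurable (S `&` prodM M : set (@seqC R k)) by exact: measurableI.
have iG := integrable_rgreen z.
have EGE : (mean_green z)%:E = (\int[P]_(L in prodM M) (GL L z)%:E)%E.
  by rewrite /mean_green /Rintegral fineK//; exact: integrable_fin_num.
rewrite -lte_fin EGE.
apply: (@lt_le_trans _ _ (e%:E * P (S `&` prodM M))%E); first by rewrite mule_gt0.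
rewrite -integral_cst//.
apply: (@le_trans _ _ (\int[P]_(L in S `&` prodM M) (GL L z)%:E)%E).
  apply: ge0_le_integral => //.
  - by move=> L _; rewrite lee_fin ltW.
  - apply/measurable_EFinP; apply: measurable_funS (measurable_rgreen z) => //.
apply: ge0_subset_integral => //.
- by apply/measurable_EFinP; exact: measurable_rgreen.
- by move=> L ML; rewrite lee_fin (rgreen_ge0 D2 A1 RadA gr).
Qed.

End AverageGreen.

(** * Average Green functions of Henon maps *)

Unset Implicit Arguments.
Theorem proposition1p6 (R : realType) (k : nat) (hk : (0 < k)%N)
    (M : set 'rV[Cplx R]_k) (hM : compact M)
    (hM0 : (0 < lebesgueC M)%E)
    (P : probability (@seqC R k) R)
    (hP : is_product_measure (normalized_lebesgue M) P)
    (m : nat) (hm : (0 < m)%N)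
    (d : 'I_m -> nat) (hd : forall j, (2 <= d j)%N)
    (p : 'I_m -> 'rV[Cplx R]_k -> {poly (Cplx R)})
    (a : 'I_m -> 'rV[Cplx R]_k -> Cplx R)
    (hp_monic : forall j l, M l -> p j l \is monic)
    (hp_deg : forall j l, M l -> size (p j l) = (d j).+1)
    (hp_cont : forall j i,
       {within M, continuous (fun l : 'rV[Cplx R]_k => (p j l)`_i)})
    (ha_cont : forall j, {within M, continuous (a j)})
    (ha_neq0 : forall j l, M l -> a j l != 0)
    (s : bool) :
  let EG := average_green p a M P (\prod_(j < m) d j)%N s in
  let K := Kset p a s in
  let Omega := ~` closure (\bigcup_(L in prodM M) K L) in
  [/\ plurisubharmonic (fun z => (EG z)%:E),
      locally_holder EG,
      pluriharmonic Omega EG /\ (forall z, Omega z -> 0 < EG z),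
      (forall z, (\bigcap_(L in prodM M) K L) z -> EG z = 0) &
      (forall U : set 'rV[Cplx R]_k, open U -> U `&` M !=set0 ->
         (0 < lebesgueC (U `&` M))%E) ->
      forall z, EG z = 0 <-> (\bigcap_(L in prodM M) K L) z].
Proof.
have pc j i : cont_on M (fun l => (p j l)`_i) by exact: cont_on_within.
have ac j : cont_on M (a j) by exact: cont_on_within.
have [[A [R0 [A1 R01 bd]]] pf cf mf] := tame_henon hM hd hp_deg pc ac ha_neq0 s.
set D := (\prod_(j < m) d j)%N in bd pf cf mf *.
have D2 : (2 <= D)%N.
  rewrite /D (bigD1 (Ordinal hm)) //=; apply: leq_trans (hd (Ordinal hm)) _.
  apply: leq_pmulr; apply: prodn_gt0 => j; exact: leq_trans (hd j).
(* A < Rad makes the lower bound ln Rad - ln A after escape positive. *)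
pose F := henon_sign p a s; pose Rad := Num.max R0 (A + 1).
have RadA : A < Rad by rewrite lt_max ltrDl ltr01 orbT.
have [gr rl] : growth s M D F Rad A /\ rel_lip s M F Rad by apply: bd; rewrite le_max lexx.
have orbE L n z : henon_seq p a s L n z = orb F L n z.
  by elim: n => //= n ->.
have greenE L z : (forall i, M (L i)) -> green p a D s L z = rgreen D F Rad L z.
  move=> ML; apply/cvg_lim => //.
  under eq_fun do rewrite orbE.
  exact: (green_lim D2 A1 RadA gr ML).
have -> : average_green p a M P D s = mean_green M P D F Rad.
  by apply/funext => z; apply: eq_Rintegral => L; rewrite inE => ML; exact: greenE.
have KE L z : (forall i, M (L i)) -> Kset p a s L z <-> forall n, ~~ escaped s Rad (orb F L n z).
  move=> ML; apply: iff_trans (bounded_orb_nesc D2 A1 RadA gr ML z).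
  by split=> -[B HB]; exists B => n; have := HB n; rewrite orbE.
have Kzero z : (\bigcap_(L in prodM M) Kset p a s L) z -> mean_green M P D F Rad z = 0.
  move=> Kz; apply: (mean_green_zero hM hP D2 A1 RadA gr mf) => L ML.
  by apply: (rgreen_nesc D2 A1 RadA gr ML); apply/KE => //; exact: Kz.
split => //.
- exact: (plurisubharmonic_mean_green hM hP D2 A1 RadA gr rl pf mf).
- exact: (locally_holder_mean_green hM hP D2 A1 RadA gr rl mf).
- apply: (pluriharmonic_mean_green hM hP D2 A1 RadA gr rl pf cf mf).
    by rewrite openC; exact: closed_closure.
  move=> z Oz L ML; apply: contrapT => /forallNP nesc; apply: Oz.
  apply: subset_closure; exists L => //; apply/KE => // n; exact/negP.
- move=> full z; split => [E0 L ML|]; last exact: Kzero.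
  apply/KE => // n; apply/negP => ez.
  by have := mean_green_gt0 hM hP D2 A1 RadA gr cf mf full ML ez; rewrite E0 ltxx.
Qed.
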